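(* Let $F:(\overline M^{\overline m},g_1)\to (M(c)^m,\psi,\xi,\eta,g_2)$ be a bi-slant Riemannian map from a Riemannian manifold $\overline M$ to a Kenmotsu space form $M(c)$ with $\xi\in\Gamma((\mathrm{range}F_* )^\perp)$ and $3\le r=\mathrm{rank}F<\min\{\overline m,m\}$. Then the normalized Casorati curvatures $\delta_{\mathcal C}^{(\ker F_* )^\perp}(r-1)$ and $\hat\delta_{\mathcal C}^{(\ker F_* )^\perp}(r-1)$ of $(\ker F_* )^\perp$ satisfy $$\varrho^{(\ker F_* )^\perp}\le\delta_{\mathcal C}^{(\ker F_* )^\perp}(r-1)+\frac{c-3}{4}+\frac{3(c+1)}{2r(r-1)}\left(r_1\cos^2\theta_1+r_2\cos^2\theta_2\right),$$ $$\varrho^{(\ker F_* )^\perp}\le\hat\delta_{\mathcal C}^{(\ker F_* )^\perp}(r-1)+\frac{c-3}{4}+\frac{3(c+1)}{2r(r-1)}\left(r_1\cos^2\theta_1+r_2\cos^2\theta_2\right),$$ where $\theta_1,\theta_2$ are the slant angles and $2r_1,2r_2$ the dimensions of $\mathcal D_{\theta_1}$ and $\mathcal D_{\theta_2}$, respectively. Further, equality holds in any of these two inequalities at a point $p\in\overline M$ if and only if, with respect to suitable orthonormal bases $\{e_1,\dots,e_r\}$ of $(\ker F_* )^\perp_p$ and $\{v_{r+1},\dots,v_m\}$ of $(\mathrm{range}F_{*p})^\perp$, the components of $\zeta$ satisfy, for all $\alpha=r+1,\dots,m$, $$\zeta^\alpha_{11}=\zeta^\alpha_{22}=\dots=\zeta^\alpha_{r-1\,r-1}=\tfrac12\zeta^\alpha_{rr},\qquad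 \zeta^\alpha_{ij}=0\quad(i\ne j,\ i,j=1,\dots,r).$$
   Context: An almost contact metric manifold $(M,\psi,\xi,\eta,g_2)$ has a $(1,1)$-tensor $\psi$, vector field $\xi$, 1-form $\eta$ and Riemannian metric $g_2$ with $\psi^2=-I+\eta\otimes\xi$, $\psi\xi=0$, $\eta\circ\psi=0$, $\eta(\xi)=1$, $g_2(\psi X,\psi Y)=g_2(X,Y)-\eta(X)\eta(Y)$, $g_2(\psi X,Y)=-g_2(X,\psi Y)$, $\eta(X)=g_2(X,\xi)$. It is Kenmotsu if its Levi-Civita connection satisfies $(\nabla_X\psi)Y=g_2(\psi X,Y)\xi-\eta(Y)\psi X$ and $\nabla_X\xi=X-\eta(X)\xi$. A Kenmotsu space form $M(c)$ is a Kenmotsu manifold of constant $\psi$-holomorphic sectional curvature $c$; its curvature tensor is $$R(X,Y)Z=\tfrac{c-3}{4}[g_2(Y,Z)X-g_2(X,Z)Y]+\tfrac{c+1}{4}[\eta(X)\eta(Z)Y-\eta(Y)\eta(Z)X+\eta(Y)g_2(X,Z)\xi-\eta(X)g_2(Y,Z)\xi-g_2(\psi X,Z)\psi Y+g_2(\psi Y,Z)\psi X+2g_2(\psi Y,X)\psi Z].$$ A smooth map $F:(\overline M^{\overline m},g_1)\to(M^m,g_2)$ with $0<\mathrm{rank}F<\min\{\overline m,m\}$ is a Riemannian map if $g_2(F_*X,F_*Y)=g_1(X,Y)$ for all horizontal $X,Y\in\Gamma((\ker F_* )^\perp)$. Its second fundamental form is $(\nabla F_* )(X,Y)=\nabla^F_XF_*Y-F_*(\nabla^{\overline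 M}_XY)$, with $\nabla^F$ the pullback connection; for horizontal $X,Y$ it takes values in $(\mathrm{range}F_* )^\perp$. Bi-slant Riemannian map: a Riemannian map $F$ to a Kenmotsu manifold for which there are mutually orthogonal slant distributions $\mathcal D_{\theta_1},\mathcal D_{\theta_2}\subset \mathrm{range}F_*$ (slant angle $\theta_i$: for every nonzero vector $W\in\mathcal D_{\theta_i}$ the angle between $\psi W$ and $\mathcal D_{\theta_i}$ is the constant $\theta_i$), with $\psi\mathcal D_{\theta_i}\perp\mathcal D_{\theta_j}$ for $i\ne j$, such that $\mathrm{range}F_*=\mathcal D_{\theta_1}\oplus\mathcal D_{\theta_2}\oplus\{\xi\}$ if $\xi\in\Gamma(\mathrm{range}F_* )$, and $\mathrm{range}F_*=\mathcal D_{\theta_1}\oplus\mathcal D_{\theta_2}$ if $\xi\in\Gamma((\mathrm{range}F_* )^\perp)$. Here $r=2r_1+2r_2$. For orthonormal bases $\{e_1,\dots,e_r\}$ of $(\ker F_* )^\perp_p$ and $\{v_{r+1},\dots,v_m\}$ of $(\mathrm{range}F_{*p})^\perp$ put $\zeta^\alpha_{ij}=g_2((\nabla F_* )(e_i,e_j),v_\alpha)$. With $R^{\overline M}$ the curvature tensor of $\overline M$ (convention $R(X,Y)Z=\nabla_X\nabla_YZ-\nabla_Y\nabla_XZ-\nabla_{[X,Y]}Z$), $\varrho^{(\ker F_* )^\perp}=\frac{2}{r(r-1)}\sum_{1\le i<j\le r}g_1(R^{\overline M}(e_i,e_j)e_j,e_i)$. Casorati curvature: $\mathcal C^{(\ker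 F_* )^\perp}=\frac1r\sum_{\alpha=r+1}^m\sum_{i,j=1}^r(\zeta^\alpha_{ij})^2$. For an $s$-dimensional subspace $\mathcal L$ of $(\ker F_* )^\perp_p$ ($s\ge2$) with orthonormal basis $\{e_1,\dots,e_s\}$, $\mathcal C^{(\ker F_* )^\perp}(\mathcal L)=\frac1s\sum_{\alpha=r+1}^m\sum_{i,j=1}^s(\zeta^\alpha_{ij})^2$. The normalized Casorati curvatures at $p$ are $$[\delta_{\mathcal C}^{(\ker F_* )^\perp}(r-1)]_p=\tfrac12\mathcal C_p^{(\ker F_* )^\perp}+\tfrac{r+1}{2r}\inf\{\mathcal C^{(\ker F_* )^\perp}(\mathcal L):\mathcal L\text{ a hyperplane of }(\ker F_* )^\perp_p\},$$ $$[\hat\delta_{\mathcal C}^{(\ker F_* )^\perp}(r-1)]_p=2\mathcal C_p^{(\ker F_* )^\perp}-\tfrac{2r-1}{2r}\sup\{\mathcal C^{(\ker F_* )^\perp}(\mathcal L):\mathcal L\text{ a hyperplane of }(\ker F_* )^\perp_p\}.$$ *)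

(* Defs.v *)
(* Tensors are written in coordinates, as families of
   component functions (one per chart) obeying the transformation law.  Tangent
   vectors are row vectors, so linear maps act on the right: F_* u is u *m 'J F x
   and psi u is u *m psi. *)
From HB Require Import structures.
From mathcomp Require Import all_boot all_order all_algebra.
From mathcomp Require Import all_classical all_reals all_analysis.

Set Implicit Arguments.
Unset Strict Implicit.
Unset Printing Implicit Defensive.

Import Order.TTheory GRing.Theory Num.Theory.
Import numFieldNormedType.Exports.

Local Open Scope classical_set_scope.
Local Open Scope ring_scope.

Section Calculus.
Context {R : realType} {n : nat} {V : normedModType R}.

Definition partial (a : 'I_n) (f : 'rV[R]_n -> V) : 'rV[R]_n -> V :=
  'D_(delta_mx 0 a : 'rV[R]_n) f.

(* C^oo on an open set U: every iterated partial derivative is (Frechet)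
   differentiable, hence continuous, on U. *)
Definition smooth_on (U : set 'rV[R]_n) (f : 'rV[R]_n -> V) : Prop :=
  forall (s : seq 'I_n) x, U x -> differentiable (foldr partial f s) x.

End Calculus.

Section Manifolds.
Context {R : realType}.

Record chart (n : nat) (T : topologicalType) := Chart {
  cdom : set T;
  chart_map : T -> 'rV[R]_n;
  chart_inv : 'rV[R]_n -> T;
  cdom_open : open cdom;
  chart_map_open : open (chart_map @` cdom);
  chart_mapK : {in cdom, cancel chart_map chart_inv};
  chart_map_cont : {in cdom, continuous chart_map};
  chart_inv_cont : {in chart_map @` cdom, continuous chart_inv} }.

Definition cimg n T (k : chart n T) : set 'rV[R]_n := chart_map k @` cdom k.

Definition overlap n T (k l : chart n T) : set 'rV[R]_n :=
  chart_map k @` (cdom k `&` cdom l).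

Definition transition n T (k l : chart n T) : 'rV[R]_n -> 'rV[R]_n :=
  chart_map l \o chart_inv k.

Record manifold (n : nat) := Manifold {
  carrier :> topologicalType;
  chart_index : Type;
  atlas : chart_index -> chart n carrier;
  manifold_hausdorff : hausdorff_space carrier;
  manifold_countable : @second_countable carrier;
  atlas_cover : forall p : carrier, exists i, cdom (atlas i) p;
  atlas_smooth : forall i j,
    smooth_on (overlap (atlas i) (atlas j)) (transition (atlas i) (atlas j)) }.

Definition trans n (M : manifold n) (i j : chart_index M) := transition (atlas i) (atlas j).
Definition jac n (M : manifold n) (i j : chart_index M) (x : 'rV[R]_n) : 'M[R]_n :=
  'J (trans i j) x.
Definition over n (M : manifold n) (i j : chart_index M) := overlap (atlas i) (atlas j).
Definition img n (M : manifold n) (i : chart_index M) := cimg (atlas i).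

Definition inner n (G : 'M[R]_n) (u v : 'rV[R]_n) : R := (u *m G *m v^T) 0 0.
Definition normv n (G : 'M[R]_n) (u : 'rV[R]_n) : R := Num.sqrt (inner G u u).

Record riem_metric n (M : manifold n) := Metric {
  gmat :> chart_index M -> 'rV[R]_n -> 'M[R]_n;
  gmat_smooth : forall i, smooth_on (img i) (gmat i);
  gmat_law : forall i j x, over i j x ->
    gmat i x = jac i j x *m gmat j (trans i j x) *m (jac i j x)^T;
  gmat_sym : forall i x, img i x -> (gmat i x)^T = gmat i x;
  gmat_pos : forall i x, img i x -> forall u, u != 0 -> 0 < inner (gmat i x) u u }.

(* gam i x a b is the vector nabla_{d_a} d_b at x, i.e. its k-th entry is the
   connection coefficient Gamma^k_{ab}; bil extends it bilinearly. *)
Definition bil n (C : 'I_n -> 'I_n -> 'rV[R]_n) (u v : 'rV[R]_n) : 'rV[R]_n :=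
  \sum_(a < n) \sum_(b < n) (u 0 a * v 0 b) *: C a b.

Record connection n (M : manifold n) := Connection {
  gam : chart_index M -> 'rV[R]_n -> 'I_n -> 'I_n -> 'rV[R]_n;
  gam_smooth : forall i a b, smooth_on (img i) (fun x => gam i x a b);
  gam_law : forall i j x a b, over i j x ->
    gam i x a b *m jac i j x =
      partial a (partial b (trans i j)) x +
      bil (gam j (trans i j x)) (row a (jac i j x)) (row b (jac i j x)) }.

(* Vector fields on a chart domain are functions of the coordinates. *)
Definition vfield n := 'rV[R]_n -> 'rV[R]_n.

Definition nabla n (M : manifold n) (D : connection M) (i : chart_index M)
    (X Y : vfield n) : vfield n :=
  fun x => 'D_(X x) Y x + bil (gam D i x) (X x) (Y x).

Definition bracket n (X Y : vfield n) : vfield n :=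
  fun x => 'D_(X x) Y x - 'D_(Y x) X x.

Definition levi_civita n (M : manifold n) (g : riem_metric M) (D : connection M) :=
  forall (i : chart_index M) (X Y Z : vfield n),
    smooth_on (img i) X -> smooth_on (img i) Y -> smooth_on (img i) Z ->
  forall x, img i x ->
    nabla D i X Y x - nabla D i Y X x = bracket X Y x /\
    'D_(X x) (fun y => inner (g i y) (Y y) (Z y)) x =
      inner (g i x) (nabla D i X Y x) (Z x) +
      inner (g i x) (Y x) (nabla D i X Z x).

Definition curvature n (M : manifold n) (D : connection M) (i : chart_index M)
    (X Y Z : vfield n) : vfield n :=
  fun x => nabla D i X (nabla D i Y Z) x - nabla D i Y (nabla D i X Z) x
           - nabla D i (bracket X Y) Z x.

(* The curvature is tensorial, so its value on tangent vectors at x is computed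
   on the fields extending them with constant components; likewise for sff. *)
Definition curv n (M : manifold n) (D : connection M) (i : chart_index M)
    (x u v w : 'rV[R]_n) : 'rV[R]_n :=
  curvature D i (cst u) (cst v) (cst w) x.

Record almost_contact_metric n (M : manifold n) (g : riem_metric M) := AlmostContactMetric {
  psi : chart_index M -> 'rV[R]_n -> 'M[R]_n;
  xi : chart_index M -> 'rV[R]_n -> 'rV[R]_n;
  eta : chart_index M -> 'rV[R]_n -> 'rV[R]_n -> R;
  eta_lin : forall i x, img i x -> scalar (eta i x);
  psi_smooth : forall i, smooth_on (img i) (psi i);
  xi_smooth : forall i, smooth_on (img i) (xi i);
  eta_smooth : forall i u, smooth_on (img i) (fun x => eta i x u);
  psi_law : forall i j x, over i j x ->
    psi i x *m jac i j x = jac i j x *m psi j (trans i j x);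
  xi_law : forall i j x, over i j x -> xi i x *m jac i j x = xi j (trans i j x);
  eta_law : forall i j x u, over i j x ->
    eta i x u = eta j (trans i j x) (u *m jac i j x);
  psi_psi : forall i x u, img i x -> u *m psi i x *m psi i x = - u + eta i x u *: xi i x;
  psi_xi : forall i x, img i x -> xi i x *m psi i x = 0;
  eta_psi : forall i x u, img i x -> eta i x (u *m psi i x) = 0;
  eta_xi : forall i x, img i x -> eta i x (xi i x) = 1;
  psi_metric : forall i x u v, img i x ->
    inner (g i x) (u *m psi i x) (v *m psi i x) =
      inner (g i x) u v - eta i x u * eta i x v;
  psi_skew : forall i x u v, img i x ->
    inner (g i x) (u *m psi i x) v = - inner (g i x) u (v *m psi i x);
  eta_metric : forall i x u, img i x -> eta i x u = inner (g i x) u (xi i x) }.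

Definition kenmotsu n (M : manifold n) (g : riem_metric M)
    (S : almost_contact_metric g) (D : connection M) :=
  levi_civita g D /\
  forall (i : chart_index M) (X Y : vfield n),
    smooth_on (img i) X -> smooth_on (img i) Y ->
  forall x, img i x ->
    nabla D i X (fun y => Y y *m psi S i y) x - nabla D i X Y x *m psi S i x =
      inner (g i x) (X x *m psi S i x) (Y x) *: xi S i x
      - eta S i x (Y x) *: (X x *m psi S i x) /\
    nabla D i X (xi S i) x = X x - eta S i x (X x) *: xi S i x.

(* psi-holomorphic sectional curvature: that of the planes spanned by a unit
   vector u orthogonal to xi and psi u. *)
Definition kenmotsu_space_form n (M : manifold n) (g : riem_metric M)
    (S : almost_contact_metric g) (D : connection M) (c : R) :=
  kenmotsu S D /\
  forall (i : chart_index M) x u, img i x ->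
    inner (g i x) u u = 1 -> inner (g i x) u (xi S i x) = 0 ->
    let pu := u *m psi S i x in inner (g i x) (curv D i x u pu pu) u = c.

End Manifolds.

Section RiemannianMaps.
Context {R : realType} {n m : nat} {M1 : @manifold R n} {M2 : @manifold R m}.
Implicit Types (F : M1 -> M2) (i : chart_index M1) (j : chart_index M2) (p : M1).

Definition rep F i j : 'rV[R]_n -> 'rV[R]_m :=
  chart_map (atlas j) \o F \o chart_inv (atlas i).

Definition rep_dom F i j : set 'rV[R]_n :=
  chart_map (atlas i) @` (cdom (atlas i) `&` F @^-1` cdom (atlas j)).

Definition smooth_map F :=
  continuous F /\ forall i j, smooth_on (rep_dom F i j) (rep F i j).

(* i and j are charts around p and F p *)
Definition charts_at F p i j := cdom (atlas i) p /\ cdom (atlas j) (F p).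

Definition x_ p i := chart_map (atlas i) p.
Definition y_ F p j := chart_map (atlas j) (F p).
Definition dF F p i j : 'M[R]_(n, m) := 'J (rep F i j) (x_ p i).

(* The G-orthogonal complement of the row space of A. *)
Definition ocompl d k (G : 'M[R]_d) (A : 'M[R]_(k, d)) : 'M[R]_d := kermx (G *m A^T).

Definition horizontal_space (g1 : riem_metric M1) F p i j : 'M[R]_n :=
  ocompl (g1 i (x_ p i)) (kermx (dF F p i j)).

Definition range_ortho (g2 : riem_metric M2) F p i j : 'M[R]_m :=
  ocompl (g2 j (y_ F p j)) (dF F p i j).

Definition riemannian_map (g1 : riem_metric M1) (g2 : riem_metric M2) F (r : nat) :=
  [/\ smooth_map F, (0 < r < minn n m)%N,
      (forall p i j, charts_at F p i j -> \rank (dF F p i j) = r) &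
      forall p i j (u v : 'rV[R]_n), charts_at F p i j ->
        (u <= horizontal_space g1 F p i j)%MS -> (v <= horizontal_space g1 F p i j)%MS ->
        inner (g2 j (y_ F p j)) (u *m dF F p i j) (v *m dF F p i j) =
        inner (g1 i (x_ p i)) u v].

Definition nablaF (D2 : connection M2) F i j (X : vfield n) (W : 'rV[R]_n -> 'rV[R]_m) :
    'rV[R]_n -> 'rV[R]_m :=
  fun x => 'D_(X x) W x +
           bil (gam D2 j (rep F i j x)) ('D_(X x) (rep F i j) x) (W x).

Definition sff_field (D1 : connection M1) (D2 : connection M2) F i j (X Y : vfield n) :
    'rV[R]_n -> 'rV[R]_m :=
  fun x => nablaF D2 F i j X (fun z => 'D_(Y z) (rep F i j) z) x
           - 'D_(nabla D1 i X Y x) (rep F i j) x.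

Definition sff (D1 : connection M1) (D2 : connection M2) F p i j (u v : 'rV[R]_n) :=
  sff_field D1 D2 F i j (cst u) (cst v) (x_ p i).

(* A smooth rank-k subbundle of the pullback bundle F^{-1} TM2; the fibre over p,
   in the chart j around F p, is the row space of dist j p. *)
Record map_distribution F (k : nat) := MapDistribution {
  dist :> chart_index M2 -> M1 -> 'M[R]_m;
  dist_rank : forall p j, cdom (atlas j) (F p) -> \rank (dist j p) = k;
  dist_law : forall p j l, cdom (atlas j) (F p) -> cdom (atlas l) (F p) ->
    (dist j p *m jac j l (y_ F p j) == dist l p)%MS;
  dist_smooth : forall p i j, charts_at F p i j ->
    exists (U : set 'rV[R]_n) (B : 'rV[R]_n -> 'M[R]_(k, m)),
      [/\ open U, U (x_ p i), U `<=` rep_dom F i j, smooth_on U B &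
          forall x, U x -> (B x == dist j (chart_inv (atlas i) x))%MS] }.

(* theta is the angle between u and the row space of A: that between u and its
   orthogonal projection w. *)
Definition angle_subspace d k (G : 'M[R]_d) (u : 'rV[R]_d) (A : 'M[R]_(k, d)) (theta : R) :=
  exists w : 'rV[R]_d,
    [/\ (w <= A)%MS, (forall a : 'rV[R]_d, (a <= A)%MS -> inner G (u - w) a = 0) &
        theta = acos (normv G w / normv G u)].

Definition slant (g2 : riem_metric M2) (S : almost_contact_metric g2) F k
    (E : map_distribution F k) (theta : R) :=
  forall p j (W : 'rV[R]_m), cdom (atlas j) (F p) -> (W <= E j p)%MS -> W != 0 ->
    angle_subspace (g2 j (y_ F p j)) (W *m psi S j (y_ F p j)) (E j p) theta.

Definition orthogonal_sub d (G A B : 'M[R]_d) :=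
  forall u v : 'rV[R]_d, (u <= A)%MS -> (v <= B)%MS -> inner G u v = 0.

Definition xi_in_range (g2 : riem_metric M2) (S : almost_contact_metric g2) F :=
  forall p i j, charts_at F p i j -> (xi S j (y_ F p j) <= dF F p i j)%MS.

Definition xi_normal (g2 : riem_metric M2) (S : almost_contact_metric g2) F :=
  forall p i j, charts_at F p i j -> (xi S j (y_ F p j) <= range_ortho g2 F p i j)%MS.

Record bi_slant (g1 : riem_metric M1) (g2 : riem_metric M2) (S : almost_contact_metric g2)
    F r r1 r2 (E1 : map_distribution F r1.*2) (E2 : map_distribution F r2.*2)
    (theta1 theta2 : R) : Prop := BiSlant {
  bi_riemannian : riemannian_map g1 g2 F r;
  bi_sub : forall p i j, charts_at F p i j ->
    (E1 j p <= dF F p i j)%MS /\ (E2 j p <= dF F p i j)%MS;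
  bi_ortho : forall p j, cdom (atlas j) (F p) ->
    orthogonal_sub (g2 j (y_ F p j)) (E1 j p) (E2 j p);
  bi_slant1 : slant S E1 theta1;
  bi_slant2 : slant S E2 theta2;
  bi_psi1 : forall p j, cdom (atlas j) (F p) ->
    orthogonal_sub (g2 j (y_ F p j)) (E1 j p *m psi S j (y_ F p j)) (E2 j p);
  bi_psi2 : forall p j, cdom (atlas j) (F p) ->
    orthogonal_sub (g2 j (y_ F p j)) (E2 j p *m psi S j (y_ F p j)) (E1 j p);
  bi_range_xi : xi_in_range S F -> forall p i j, charts_at F p i j ->
    (dF F p i j == E1 j p + E2 j p + xi S j (y_ F p j))%MS /\
    mxdirect (E1 j p + E2 j p + xi S j (y_ F p j));
  bi_range_normal : xi_normal S F -> forall p i j, charts_at F p i j ->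
    (dF F p i j == E1 j p + E2 j p)%MS /\ mxdirect (E1 j p + E2 j p) }.

(* The rows of e form a G-orthonormal basis of the row space of A. *)
Definition onbasis d l k (G : 'M[R]_d) (A : 'M[R]_(l, d)) (e : 'M[R]_(k, d)) :=
  e *m G *m e^T = 1%:M /\ (e == A)%MS.

Section Casorati.
Context (g1 : riem_metric M1) (g2 : riem_metric M2) (D1 : connection M1) (D2 : connection M2).
Context (F : M1 -> M2) (p : M1) (i : chart_index M1) (j : chart_index M2).
Local Notation H := (horizontal_space g1 F p i j).
Local Notation G1 := (g1 i (x_ p i)).

Definition zeta s q (e : 'M[R]_(s, n)) (v : 'M[R]_(q, m)) (al : 'I_q) (a b : 'I_s) : R :=
  inner (g2 j (y_ F p j)) (sff D1 D2 F p i j (row a e) (row b e)) (row al v).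

Definition rho r (e : 'M[R]_(r, n)) : R :=
  2 / (r%:R * (r%:R - 1)) *
  \sum_(a < r) \sum_(b < r | (a < b)%N)
    inner G1 (curv D1 i (x_ p i) (row a e) (row b e) (row b e)) (row a e).

Definition casorati s q (e : 'M[R]_(s, n)) (v : 'M[R]_(q, m)) : R :=
  s%:R^-1 * \sum_(al < q) \sum_(a < s) \sum_(b < s) zeta e v al a b ^+ 2.

Definition hyperplane_casorati q (v : 'M[R]_(q, m)) : set R :=
  [set C | exists (L : 'M[R]_n) (f : 'M[R]_((\rank H).-1, n)),
     [/\ (L <= H)%MS, \rank L = (\rank H).-1, onbasis G1 L f & C = casorati f v]].

(* delta and delta_hat are evaluated with orthonormal bases e of the horizontal
   space and v of the normal space; the values do not depend on e and v. *)
Definition delta r q (e : 'M[R]_(r, n)) (v : 'M[R]_(q, m)) : R :=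
  2^-1 * casorati e v + (r%:R + 1) / (2 * r%:R) * inf (hyperplane_casorati v).

Definition delta_hat r q (e : 'M[R]_(r, n)) (v : 'M[R]_(q, m)) : R :=
  2 * casorati e v - (2 * r%:R - 1) / (2 * r%:R) * sup (hyperplane_casorati v).

Definition equality_shape r q (e : 'M[R]_(r, n)) (v : 'M[R]_(q, m)) :=
  forall al : 'I_q,
    (forall a b : 'I_r, (a < r.-1)%N -> b = r.-1 :> nat ->
       zeta e v al a a = 2^-1 * zeta e v al b b) /\
    (forall a b : 'I_r, a != b -> zeta e v al a b = 0).

End Casorati.

End RiemannianMaps.

(* Main.v *)
Require Import Defs.
From HB Require Import structures.
From mathcomp Require Import all_boot all_order all_algebra.
From mathcomp Require Import all_classical all_reals all_analysis.
From mathcomp Require Import ring lra.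

(* Write B for the second fundamental form of F on horizontal vectors.

   Because xi is normal to the range, differentiating <F_* v, xi> = 0 with
   nabla_X xi = X - eta(X) xi gives <B(u,v), xi> = - g1(u,v): in every pair of orthonormal
   frames the matrices zeta^alpha combine to - I.  Matrices diag(t,...,t,2t) cannot do that,
   so the equality shape never occurs; and the same combination bounds the sums of squares
   hidden in the two inequalities from below by a positive constant independent of the hyperplane,
   so the inequalities are strict even after taking the infimum or the supremum.  Both sides
   of each equivalence are false.

   The sectional curvature of M1 on horizontal vectors is compared with that of M2 through the
   Brioschi formula for a map f, which expresses <R(f_u,f_v)f_v,f_u> by second derivatives of
   the pulled back metric; it is used for f = F and for f = id.  The difference
   K = g1 - F^* g2 satisfies K g1^-1 K = K, and differentiating this twice on ker K shows that
   the terms in K add up to a square (O'Neill's term).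

   On the orthogonal complement of xi, the curvature of M2 minus that of curvature -1 commutes
   with psi, so that it is a Kaehler curvature tensor and is recovered from its holomorphic
   sectional curvatures by polarization. *)

Set Implicit Arguments.
Unset Strict Implicit.
Unset Printing Implicit Defensive.

Import Order.TTheory GRing.Theory Num.Theory.
Import numFieldNormedType.Exports.

Local Open Scope classical_set_scope.
Local Open Scope ring_scope.

(** * Differential calculus of matrix-valued functions *)

(** A horizontal vector has in general no extension to a horizontal field that is constant in a
    chart, so the usual proof of the Gauss equation would need projected fields. Brioschi's formula
    works with constant fields, at the price of saying nothing about verticality. [K], the squared
    length of the vertical part, supplies this: K g1^-1 K = K is the isometry condition on
    horizontal vectors, rewritten as a smooth equation without a choice of frame.

    A strict inequality for each hyperplane does not survive an infimum, a uniform gap does. Let c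
    be the coordinates of xi in the normal frame: |c| = 1 and the c-combination of the zeta^alpha is
    - I. If x and y are diagonal entries in an orthonormal frame, the c-combinations of 2 x - y and
    x - 2 y are -1 and 1, so by Cauchy-Schwarz their squares, summed over alpha, are at least 1.
    Summing over r - 1 indices, halving and dividing by r (r - 1) leaves the gap 1/(2 r). *)

Section Differentiability.
Context {R : realType} {V : normedModType R}.

(** The expansion with zero linear part holds trivially. Differentiability becomes a local property
    from here, by adding the difference g - f to f. *)
Lemma differentiable_near0 (W : normedModType R) (f : V -> W) x :
  {near x, f =1 cst 0} -> differentiable f x.
Proof.
move=> f0; have e0 : f \o shift x = cst (f x) + \0 +o_ (0 : V) id.
  apply/eqaddoP => _ /posnumP[e].
  have : \forall h \near (0 : V), f (h + x) = 0.
    by move: f0; rewrite (near_shift 0) subr0; apply: filterS => y /= ->.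
  apply: filterS => h /= fh.
  rewrite -![(_ - _ : _ -> _) _]/(_ - _) /= fh (nbhs_singleton f0) /=.
  by rewrite addr0 subr0 normr0 mulr_ge0.
have c0 : continuous (\0 : {linear V -> W}) by move=> ?; exact: cvg_cst.
have d0 := diff_unique c0 e0.
by apply/diff_locallyP; rewrite d0; split.
Qed.

Lemma near_eq_differentiable (W : normedModType R) (f g : V -> W) x :
  {near x, f =1 g} -> differentiable f x -> differentiable g x.
Proof.
move=> fg df; rewrite (_ : g = f + (g \- f)); last first.
  by apply/funext => y /=; rewrite -[RHS]/(f y + (g y - f y)) addrC subrK.
apply: differentiableD => //; apply: differentiable_near0.
by apply: filterS fg => y /= ->; rewrite subrr.
Qed.

Lemma differentiable_bigsum (W : normedModType R) (I : Type) (r : seq I) (P : pred I)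
    (F : I -> V -> W) x : (forall i, P i -> differentiable (F i) x) ->
  differentiable (fun y => \sum_(i <- r | P i) F i y) x.
Proof.
move=> dF; rewrite (_ : (fun _ => _) = \sum_(i <- r | P i) F i); last first.
  by apply/funext => y; rewrite fct_sumE.
apply: (big_ind (fun g : V -> W => differentiable g x)) => //.
by move=> g h dg dh; exact: differentiableD.
Qed.

Lemma differentiable_bigprod (I : Type) (r : seq I) (F : I -> V -> R) x :
  (forall i, differentiable (F i) x) -> differentiable (fun y => \prod_(i <- r) F i y) x.
Proof.
move=> dF; elim: r => [|i r IH].
  by under eq_fun do rewrite big_nil; exact: differentiable_cst.
under eq_fun do rewrite big_cons.
exact: differentiableM.
Qed.

Lemma derive_bigsum (W : normedModType R) (I : Type) (r : seq I) (P : pred I)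
    (F : I -> V -> W) x u : (forall i, P i -> differentiable (F i) x) ->
  'D_u (fun y => \sum_(i <- r | P i) F i y) x = \sum_(i <- r | P i) 'D_u (F i) x.
Proof.
move=> dF; elim: r => [|i r IH].
  by under eq_fun do rewrite big_nil; rewrite big_nil derive_cst.
rewrite big_cons; have [Pi|Pi] := boolP (P i); last first.
  by under eq_fun do rewrite big_cons (negbTE Pi).
under eq_fun do rewrite big_cons Pi.
rewrite -IH; apply: deriveD; apply: diff_derivable; first exact: dF.
exact: differentiable_bigsum.
Qed.

Lemma differentiable_mxP k l (A : V -> 'M[R]_(k, l)) x :
  differentiable A x <-> forall i j, differentiable (fun y => A y i j) x.
Proof.
split=> [dA i j|dA].
  apply: (@differentiable_comp _ _ _ _ A (fun M => M i j)) => //.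
  exact: differentiable_coord.
have -> : A = fun y => \sum_i \sum_j A y i j *: delta_mx i j.
  by apply/funext => y; rewrite [LHS]matrix_sum_delta.
apply: differentiable_bigsum => i _; apply: differentiable_bigsum => j _.
exact: differentiableZl.
Qed.

Lemma derive_coord k l (A : V -> 'M[R]_(k, l)) x u i j :
  differentiable A x -> 'D_u (fun y => A y i j) x = ('D_u A x) i j.
Proof. by move=> dA; rewrite derive_mx ?mxE //; exact: diff_derivable. Qed.

Lemma differentiable_mulmx k l q (A : V -> 'M[R]_(k, l)) (B : V -> 'M[R]_(l, q)) x :
  differentiable A x -> differentiable B x ->
  differentiable (fun y => A y *m B y) x.
Proof.
move=> /differentiable_mxP dA /differentiable_mxP dB; apply/differentiable_mxP => i j.
under eq_fun do rewrite mxE.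
by apply: differentiable_bigsum => a _; exact: differentiableM.
Qed.

Lemma derive_mulmx k l q (A : V -> 'M[R]_(k, l)) (B : V -> 'M[R]_(l, q)) x u :
  differentiable A x -> differentiable B x ->
  'D_u (fun y => A y *m B y) x = 'D_u A x *m B x + A x *m 'D_u B x.
Proof.
move=> dA dB; apply/matrixP => i j.
have dA' := (differentiable_mxP _ _).1 dA; have dB' := (differentiable_mxP _ _).1 dB.
rewrite -derive_coord; last exact: differentiable_mulmx.
under eq_fun do rewrite mxE.
rewrite derive_bigsum; last by move=> a _; exact: differentiableM.
rewrite !mxE -big_split /=; apply: eq_bigr => a _.
rewrite (@deriveM _ _ (fun y => A y i a) (fun y => B y a j)); try exact: diff_derivable.
by rewrite !derive_coord // addrC; congr (_ + _); rewrite -[LHS]/(_ * _) mulrC.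
Qed.

Lemma differentiable_trmx k l (A : V -> 'M[R]_(k, l)) x :
  differentiable A x -> differentiable (fun y => (A y)^T) x.
Proof.
move=> /differentiable_mxP dA; apply/differentiable_mxP => i j.
by under eq_fun do rewrite mxE.
Qed.

Lemma derive_trmx k l (A : V -> 'M[R]_(k, l)) x u :
  differentiable A x -> 'D_u (fun y => (A y)^T) x = ('D_u A x)^T.
Proof.
move=> dA; apply/matrixP => i j; rewrite -derive_coord; last exact: differentiable_trmx.
by under eq_fun do rewrite mxE; rewrite derive_coord ?mxE.
Qed.

Lemma differentiable_det k (A : V -> 'M[R]_k) x :
  differentiable A x -> differentiable (fun y => \det (A y)) x.
Proof.
move=> /differentiable_mxP dA; apply: differentiable_bigsum => s _.
apply: differentiableM; first exact: differentiable_cst.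
exact: differentiable_bigprod.
Qed.

(** Cramer's rule: near [x] the entries of the inverse are polynomials in the entries of [A],
    divided by the determinant. *)
Lemma differentiable_invmx k (A : V -> 'M[R]_k) x :
  (\forall y \near x, A y \in unitmx) -> differentiable A x ->
  differentiable (fun y => invmx (A y)) x.
Proof.
move=> uA dA.
apply: (@near_eq_differentiable _ (fun y => (\det (A y))^-1 *: \adj (A y))).
  by apply: filterS uA => y /= uAy; rewrite /invmx uAy.
apply/differentiable_mxP => i j; under eq_fun do rewrite !mxE.
apply: differentiableM.
  apply: differentiableV; first exact: differentiable_det.
  by have := nbhs_singleton uA; rewrite unitmxE unitfE.
apply: differentiableM; first exact: differentiable_cst.
apply: differentiable_det; apply/differentiable_mxP => a b.
under eq_fun do rewrite !mxE.
by have /differentiable_mxP := dA; apply.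
Qed.

Lemma derive_comp (W X : normedModType R) (f : V -> W) (g : W -> X) x u :
  differentiable f x -> differentiable g (f x) ->
  'D_u (fun y => g (f y)) x = 'D_('D_u f x) g (f x).
Proof.
move=> df dg; rewrite deriveE; last exact: (differentiable_comp df dg).
by rewrite (diff_comp df dg) /= -!deriveE.
Qed.

Lemma deriveDr (W : normedModType R) (f : V -> W) x u v :
  differentiable f x -> 'D_(u + v) f x = 'D_u f x + 'D_v f x.
Proof. by move=> df; rewrite !deriveE // linearD. Qed.

Lemma deriveZr (W : normedModType R) (f : V -> W) x a u :
  differentiable f x -> 'D_(a *: u) f x = a *: 'D_u f x.
Proof. by move=> df; rewrite !deriveE // linearZ. Qed.

End Differentiability.

Lemma derive_partial (R : realType) n (W : normedModType R) (f : 'rV[R]_n -> W) x u :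
  differentiable f x -> 'D_u f x = \sum_a u 0 a *: partial a f x.
Proof.
move=> df; rewrite deriveE // [u in LHS]row_sum_delta linear_sum.
by apply: eq_bigr => a _; rewrite linearZ /= /partial deriveE.
Qed.

(** Second-order differentiability at the single point [x]: enough for second derivatives to commute
    at [x], and stable under the products, inverses and compositions that occur below. *)
Definition twice_diff (R : realType) (V W : normedModType R) (f : V -> W) (x : V) :=
  (\forall y \near x, differentiable f y) /\ forall u, differentiable ('D_u f) x.

(** * Symmetry of second derivatives *)

Section Schwarz.
Context {R : realType} {V : normedModType R}.
Implicit Types f : V -> R.

Lemma diff_first_order f x : differentiable f x -> forall e, 0 < e ->
  exists2 d, 0 < d & forall h, `|h| < d -> `|f (x + h) - f x - 'D_h f x| <= e * `|h|.
Proof.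
move=> df e e0; have := diff_locallyxC df.
set o := 'o _ => fE; have /(littleoP [littleo of o])/nbhs_norm0P[d d0 dP] := e0.
exists d => // h /dP; rewrite /= fE deriveE //.
by rewrite (_ : f x + 'd f x h + o h - f x - 'd f x h = o h) //; ring.
Qed.

Lemma is_derive_line f (u w : V) s : differentiable f (s *: u + w) ->
  is_derive s 1 (fun s => f (s *: u + w)) ('D_u f (s *: u + w)).
Proof.
move=> df; pose l := fun s : R => s *: u + w.
have dl : is_diff s l ( *:%R^~ u).
    rewrite (_ : ( *:%R^~ u : R -> V) = ( *:%R^~ u : R -> V) + 0); last by rewrite addr0.
  exact: is_diffD.
have dls : differentiable l s by case: dl.
split; first by apply: diff_derivable; exact: (differentiable_comp dls).
rewrite (@derive_comp _ _ _ _ l f) //.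
by rewrite (deriveE _ dls) diff_val scale1r.
Qed.

Let Delta f x u v (t : R) := f (t *: u + (t *: v + x)) - f (t *: u + x) - f (t *: v + x) + f x.

(** The mean value theorem in the direction [u] turns the second difference into a first difference
    of 'D_u f; both of its values are then expanded to first order at [x]. *)
Lemma second_difference f x u v : twice_diff f x -> forall e, 0 < e ->
  exists2 d, 0 < d & forall t, 0 < t < d ->
    (* In the proof, [C] is chosen so that |c u + t v| + |c u| <= t C for 0 <= c <= t; the summand 1
       keeps it positive when u = v = 0. *)
    `|Delta f x u v t - t ^+ 2 * 'D_v ('D_u f) x| <= t ^+ 2 * e.
Proof.
move=> [nf ddf] e e0; pose C := `|u| + `|v| + `|u| + 1.
have C0 : 0 < C by rewrite /C ltr_wpDl.
have [d1 d10 d1P] := diff_first_order (ddf u) (divr_gt0 e0 C0).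
have [d2 d20 d2P] : exists2 d, 0 < d & forall h, `|h| < d -> differentiable f (h + x).
  move: nf; rewrite (near_shift 0) subr0 => /nbhs_norm0P[d d0 dP].
  by exists d => // h /dP.
pose d := Num.min d1 d2; have d0 : 0 < d by rewrite lt_min d10.
exists (d / C); first exact: divr_gt0.
move=> t /andP[t0 tC].
have small c a : 0 <= c <= t -> 0 <= a <= t -> `|c *: u + a *: v| < d.
  move=> /andP[c0 ct] /andP[a0 at_]; rewrite (le_lt_trans (ler_normD _ _)) //.
  rewrite !normrZ !ger0_norm // (le_lt_trans (lerD (ler_wpM2r _ ct) (ler_wpM2r _ at_))) //.
  rewrite -mulrDr; move: tC; rewrite ltr_pdivlMr //; apply: le_lt_trans.
  by rewrite ler_wpM2l ?(ltW t0) // /C -addrA lerDl addr_ge0.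
pose phi := fun s : R => f (s *: u + (t *: v + x)) - f (s *: u + x).
pose dphi := fun s : R => 'D_u f (s *: u + (t *: v + x)) - 'D_u f (s *: u + x).
have dphiP s : 0 <= s <= t -> is_derive s 1 phi (dphi s).
  move=> st; apply: is_deriveB; apply: is_derive_line.
    rewrite addrA; apply: d2P; rewrite (lt_le_trans (small _ t st _)) ?(ltW t0) ?lexx //.
    by rewrite ge_min lexx orbT.
  apply: d2P; have := small _ 0 st; rewrite scale0r addr0 lexx (ltW t0) => /(_ isT).
  by move=> /lt_le_trans; apply; rewrite ge_min lexx orbT.
have dphi_in s : s \in `]0, t[%R -> is_derive s 1 phi (dphi s).
  by rewrite in_itv /= => /andP[/ltW s0 /ltW st]; apply: dphiP; rewrite s0.
have cphi : {within `[0, t], continuous phi}.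
  apply: derivable_within_continuous => s; rewrite in_itv /= => st.
  by have [] := dphiP s st.
have [c ct phiE] := MVT t0 dphi_in cphi.
have {}ct : 0 <= c <= t by move: ct; rewrite in_itv /= => /andP[/ltW -> /ltW ->].
have -> : Delta f x u v t = t * dphi c.
  rewrite mulrC -[t in dphi c * t]subr0 -phiE /phi /Delta scale0r !add0r; ring.
rewrite expr2 -mulrA -mulrBr -mulrA normrM (ger0_norm (ltW t0)).
rewrite ler_wpM2l ?(ltW t0) //.
have dD : 'D_(c *: u + t *: v) ('D_u f) x = 'D_(c *: u) ('D_u f) x + t * 'D_v ('D_u f) x.
  by rewrite deriveDr // [X in _ + X]deriveZr.
have h1 := d1P (c *: u + t *: v); have h2 := d1P (c *: u).
rewrite dD in h1.
have {}h1 := h1 (lt_le_trans (small _ t ct _) _); rewrite lexx (ltW t0) in h1.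
have {}h1 := h1 isT; rewrite ge_min lexx in h1; have {}h1 := h1 isT.
have := small _ 0 ct; rewrite scale0r addr0 lexx (ltW t0) => /(_ isT) cu.
have {}h2 := h2 (lt_le_trans cu _); rewrite ge_min lexx in h2; have {}h2 := h2 isT.
rewrite /dphi [x in _ - _ - x]/(t * 'D_v ('D_u f) x).
have nle : `|c *: u + t *: v| + `|c *: u| <= t * C.
  move/andP: ct => [c0 ct]; rewrite (le_trans (lerD (ler_normD _ _) (lexx _))) //.
  rewrite !normrZ !ger0_norm ?(ltW t0) // /C !mulrDr mulr1 -[leLHS]addr0.
  by rewrite !lerD ?(ltW t0) // ler_wpM2r.
rewrite (_ : c *: u + (t *: v + x) = x + (c *: u + t *: v)); last by rewrite addrA addrC.
rewrite [c *: u + x]addrC.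
set a1 := 'D_u f _ in h1 *; set a2 := 'D_u f _ in h2 *.
set b := 'D_u f x in h1 h2; set l1 := 'D_(c *: u) _ _ in h1 h2.
set l := t * _ in h1 *.
rewrite (_ : a1 - a2 - l = (a1 - b - (l1 + l)) - (a2 - b - l1)); last by ring.
rewrite (le_trans (ler_normB _ _)) // (le_trans (lerD h1 h2)) // -mulrDr.
have eC0 : 0 <= e / C by rewrite divr_ge0 // ltW.
by rewrite (le_trans (ler_wpM2l eC0 nle)) // mulrCA divfK // gt_eqF.
Qed.

Lemma normB_le (D a b h h' : R) : `|D - a| <= h -> `|D - b| <= h' -> `|a - b| <= h + h'.
Proof.
move=> ha hb; rewrite (_ : a - b = (D - b) - (D - a)); last by ring.
by rewrite (le_trans (ler_normB _ _)) // addrC lerD.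
Qed.

(** The second difference is symmetric in [u] and [v], so both mixed derivatives are limits of the
    same quotient by t^2. *)
Lemma schwarz_real f x u v : twice_diff f x -> 'D_u ('D_v f) x = 'D_v ('D_u f) x.
Proof.
move=> f2; apply/eqP; rewrite -subr_eq0 -normr_le0; apply/ler_addgt0Pr => e e0.
rewrite add0r; have e20 : 0 < e / 2 by rewrite divr_gt0.
have [d1 d10 d1P] := second_difference u v f2 e20.
have [d2 d20 d2P] := second_difference v u f2 e20.
pose t := Num.min d1 d2 / 2.
have m0 : 0 < Num.min d1 d2 by rewrite lt_min d10.
have t0 : 0 < t by rewrite divr_gt0.
have tm : t < Num.min d1 d2 by rewrite /t; lra.
have {}d1P := d1P t; have {}d2P := d2P t.
rewrite t0 (lt_le_trans tm) ?ge_min ?lexx // in d1P.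
rewrite t0 (lt_le_trans tm) ?ge_min ?lexx ?orbT // in d2P.
have {}d1P := d1P isT; have {}d2P := d2P isT.
have DE : Delta f x v u t = Delta f x u v t.
  by rewrite /Delta addrCA -[LHS]addrA addrACA -!addrA; congr (_ + _); rewrite addrCA.
rewrite DE in d2P.
have t20 : 0 < t ^+ 2 by rewrite exprn_gt0.
rewrite -(ler_pM2l t20) -{1}(ger0_norm (ltW t20)) -normrM mulrBr (splitr e) mulrDr.
exact: normB_le d2P d1P.
Qed.

End Schwarz.

Section TwiceDiff.
Context {R : realType} {V : normedModType R}.

Lemma near_near (P : V -> Prop) (x : V) :
  (\forall y \near x, P y) -> \forall y \near x, \forall z \near y, P z.
Proof. by move=> /nbhs_interior. Qed.

Lemma twice_diff_near (W : normedModType R) (f : V -> W) x :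
  twice_diff f x -> \forall y \near x, differentiable f y.
Proof. by case. Qed.

Lemma twice_diffW (W : normedModType R) (f : V -> W) x :
  twice_diff f x -> differentiable f x.
Proof. by case=> /nbhs_singleton. Qed.

Lemma twice_diff_near_eq (W : normedModType R) (f g : V -> W) x :
  {near x, f =1 g} -> twice_diff f x -> twice_diff g x.
Proof.
move=> /near_near fg [nf df]; split=> [|u].
  by apply: filterS2 fg nf => y; exact: near_eq_differentiable.
apply: near_eq_differentiable (df u).
by apply: filterS fg => y; exact: near_eq_derive.
Qed.

Lemma twice_diff_of (W : normedModType R) (f : V -> W) (df : V -> V -> W) x :
  (\forall y \near x, differentiable f y) ->
  (forall u, {near x, 'D_u f =1 df u}) -> (forall u, differentiable (df u) x) ->
  twice_diff f x.
Proof.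
move=> nf dfE ddf; split=> // u; apply: near_eq_differentiable (ddf u).
by apply: filterS (dfE u) => y ->.
Qed.

Lemma twice_diff_cst (W : normedModType R) (a : W) x : twice_diff (cst a : V -> W) x.
Proof.
apply: (@twice_diff_of _ _ (fun _ _ => 0)) => [|u|u].
- by apply: nearW => y.
- by apply: nearW => y; rewrite derive_cst.
- exact: differentiable_cst.
Qed.

Lemma twice_diffD (W : normedModType R) (f g : V -> W) x :
  twice_diff f x -> twice_diff g x -> twice_diff (fun y => f y + g y) x.
Proof.
move=> [nf df] [ng dg]; apply: (@twice_diff_of _ _ (fun u y => 'D_u f y + 'D_u g y)).
- by apply: filterS2 nf ng => y; exact: differentiableD.
- by move=> u; apply: filterS2 nf ng => y fy gy; apply: deriveD; exact: diff_derivable.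
- by move=> u; exact: differentiableD.
Qed.

Lemma twice_diffZ (W : normedModType R) (a : R) (f : V -> W) x :
  twice_diff f x -> twice_diff (fun y => a *: f y) x.
Proof.
move=> [nf df]; apply: (@twice_diff_of _ _ (fun u y => a *: 'D_u f y)).
- by apply: filterS nf => y; exact: differentiableZ.
- by move=> u; apply: filterS nf => y fy; apply: deriveZ; exact: diff_derivable.
- by move=> u; exact: differentiableZ.
Qed.

Lemma twice_diffB (W : normedModType R) (f g : V -> W) x :
  twice_diff f x -> twice_diff g x -> twice_diff (fun y => f y - g y) x.
Proof.
move=> f2 /(twice_diffZ (-1)) g2.
by under eq_fun do rewrite -scaleN1r; exact: twice_diffD.
Qed.

Lemma twice_diffM (f g : V -> R) x :
  twice_diff f x -> twice_diff g x -> twice_diff (fun y => f y * g y) x.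
Proof.
move=> f2 g2; move: (f2) (g2) => [nf df] [ng dg].
apply: (@twice_diff_of _ _ (fun u y => f y * 'D_u g y + g y * 'D_u f y)).
- by apply: filterS2 nf ng => y; exact: differentiableM.
- by move=> u; apply: filterS2 nf ng => y fy gy; apply: deriveM; exact: diff_derivable.
- move=> u; apply: differentiableD; apply: differentiableM => //; exact: twice_diffW.
Qed.

Lemma twice_diff_bigsum (W : normedModType R) (I : Type) (r : seq I)
    (F : I -> V -> W) x : (forall i, twice_diff (F i) x) ->
  twice_diff (fun y => \sum_(i <- r) F i y) x.
Proof.
move=> dF; elim: r => [|i r IH].
  by under eq_fun do rewrite big_nil; exact: twice_diff_cst.
by under eq_fun do rewrite big_cons; exact: twice_diffD.
Qed.

Lemma twice_diff_mxP k l (A : V -> 'M[R]_(k, l)) x :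
  twice_diff A x <-> forall i j, twice_diff (fun y => A y i j) x.
Proof.
split=> [[nA dA] i j|A2].
  apply: (@twice_diff_of _ _ (fun u y => ('D_u A y) i j)).
  - by apply: filterS nA => y /differentiable_mxP.
  - by move=> u; apply: filterS nA => y Ay; exact: derive_coord.
  - by move=> u; have /differentiable_mxP := dA u.
have nA : \forall y \near x, differentiable A y.
  have : \forall y \near x, forall i j, differentiable (fun y => A y i j) y.
    apply: filter_forall => i; apply: filter_forall => j; by have [] := A2 i j.
  by apply: filterS => y /differentiable_mxP.
split=> // u; apply/differentiable_mxP => i j.
have [_ /(_ u)] := A2 i j; apply: near_eq_differentiable.
by apply: filterS nA => y Ay; exact: derive_coord.
Qed.

Lemma twice_diff_mulmx k l q (A : V -> 'M[R]_(k, l)) (B : V -> 'M[R]_(l, q)) x :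
  twice_diff A x -> twice_diff B x -> twice_diff (fun y => A y *m B y) x.
Proof.
move=> /twice_diff_mxP A2 /twice_diff_mxP B2; apply/twice_diff_mxP => i j.
under eq_fun do rewrite mxE.
by apply: twice_diff_bigsum => a; exact: twice_diffM.
Qed.

Lemma twice_diff_trmx k l (A : V -> 'M[R]_(k, l)) x :
  twice_diff A x -> twice_diff (fun y => (A y)^T) x.
Proof.
move=> /twice_diff_mxP A2; apply/twice_diff_mxP => i j.
by under eq_fun do rewrite mxE.
Qed.

Lemma derive_invmx k (A : V -> 'M[R]_k) x u :
  (\forall y \near x, A y \in unitmx) -> differentiable A x ->
  'D_u (fun y => invmx (A y)) x = - (invmx (A x) *m 'D_u A x *m invmx (A x)).
Proof.
move=> uA dA; have dN := differentiable_invmx uA dA.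
have : 'D_u (fun y => invmx (A y) *m A y) x = 0.
  rewrite -(derive_cst (1%:M : 'M[R]_k) x u); apply: near_eq_derive.
  by apply: filterS uA => y /= Ay; rewrite mulVmx.
rewrite derive_mulmx // => /eqP; rewrite addr_eq0 => /eqP NA.
have uAx := nbhs_singleton uA.
by rewrite -[LHS]mulmx1 -(mulmxV uAx) mulmxA NA mulNmx.
Qed.

Lemma twice_diff_invmx k (A : V -> 'M[R]_k) x :
  (\forall y \near x, A y \in unitmx) -> twice_diff A x ->
  twice_diff (fun y => invmx (A y)) x.
Proof.
move=> uA [nA dA]; have uA' := near_near uA.
have dN := differentiable_invmx uA (nbhs_singleton nA).
apply: (@twice_diff_of _ _ (fun u y => - (invmx (A y) *m 'D_u A y *m invmx (A y)))).
- by apply: filterS2 uA' nA => y; exact: differentiable_invmx.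
- by move=> u; apply: filterS2 uA' nA => y; exact: derive_invmx.
- move=> u; apply: differentiableN.
  by apply: differentiable_mulmx => //; exact: differentiable_mulmx.
Qed.

Lemma schwarz_mx k l (A : V -> 'M[R]_(k, l)) x u v :
  twice_diff A x -> 'D_u ('D_v A) x = 'D_v ('D_u A) x.
Proof.
move=> A2; have [nA dA] := A2; apply/matrixP => i j.
have DE w w' : ('D_w ('D_w' A) x) i j = 'D_w ('D_w' (fun y => A y i j)) x.
  rewrite -derive_coord //; apply: near_eq_derive.
  by apply: filterS nA => y Ay; rewrite derive_coord.
have /twice_diff_mxP/(_ i j)/(@schwarz_real _ _ _ _ u v) S := A2.
exact: etrans (DE u v) (etrans S (esym (DE v u))).
Qed.

End TwiceDiff.

(** The direction 'D_u f y in which [g] is differentiated moves with y, whereas [twice_diff] speaks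
    of fixed directions; expanding in partial derivatives separates the two. *)
Lemma twice_diff_comp_real (R : realType) (V : normedModType R) k (f : V -> 'rV[R]_k)
    (g : 'rV[R]_k -> R) x :
  twice_diff f x -> twice_diff g (f x) -> twice_diff (fun y => g (f y)) x.
Proof.
move=> f2 [ng dg]; have [nf df] := f2; have dfx := twice_diffW f2.
have ng' : \forall y \near x, differentiable g (f y).
  exact: (differentiable_continuous dfx ng).
apply: (@twice_diff_of _ _ _ _ (fun u y => \sum_a ('D_u f y) 0 a * partial a g (f y))).
- by apply: filterS2 nf ng' => y; exact: differentiable_comp.
- move=> u; apply: filterS2 nf ng' => y fy gy; rewrite (@derive_comp _ _ _ _ f g) //.
  exact: derive_partial.
move=> u; apply: differentiable_bigsum => a _; apply: differentiableM.
  by have /differentiable_mxP := df u.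
by apply: (@differentiable_comp _ _ _ _ f (partial a g)) => //; exact: dg.
Qed.

Lemma twice_diff_comp (R : realType) (V : normedModType R) k l q (f : V -> 'rV[R]_k)
    (g : 'rV[R]_k -> 'M[R]_(l, q)) x :
  twice_diff f x -> twice_diff g (f x) -> twice_diff (fun y => g (f y)) x.
Proof.
move=> f2 /twice_diff_mxP g2; apply/twice_diff_mxP => i j.
exact: (@twice_diff_comp_real _ _ _ f (fun y => g y i j)).
Qed.

Section SmoothOn.
Context {R : realType} {n : nat} {W : normedModType R}.
Implicit Types (U : set 'rV[R]_n) (f : 'rV[R]_n -> W).

Lemma smooth_on_cst U (w : W) : smooth_on U (cst w).
Proof.
move=> s x Ux; suff [w' ->] : exists w', foldr partial (cst w) s = cst w' by [].
elim: s => [|a s [w' IH]]; first by exists w.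
by exists 0; rewrite /= IH; apply/funext => y; rewrite /partial derive_cst.
Qed.

Lemma smooth_on_partial U f a : smooth_on U f -> smooth_on U (partial a f).
Proof. by move=> sf s x Ux; rewrite -foldr_rcons; exact: sf. Qed.

(** [smooth_on] controls iterated partial derivatives only; a derivative in a fixed direction is a
    fixed linear combination of them on [U]. *)
Lemma smooth_on_twice_diff U f x : open U -> smooth_on U f -> U x -> twice_diff f x.
Proof.
move=> oU sf Ux; have nU : \forall y \near x, U y by exact: open_nbhs_nbhs.
apply: (@twice_diff_of R _ W f (fun (u y : 'rV[R]_n) => \sum_a u 0 a *: partial a f y) x).
- by apply: filterS nU => y /(sf [::]).
- by move=> u; apply: filterS nU => y /(sf [::]); exact: derive_partial.
- move=> u; apply: differentiable_bigsum => a _; apply: differentiableZ.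
  exact: (sf [:: a]).
Qed.

Lemma smooth_on_twice_diff_derive U f x u :
  open U -> smooth_on U f -> U x -> twice_diff ('D_u f) x.
Proof.
move=> oU sf Ux; apply: (@twice_diff_near_eq _ _ _ (fun y => \sum_a u 0 a *: partial a f y)).
  have : \forall y \near x, U y by exact: open_nbhs_nbhs.
  by apply: filterS => y /(sf [::]) fy; rewrite -derive_partial.
apply: twice_diff_bigsum => a; apply: twice_diffZ.
by apply: (smooth_on_twice_diff oU) Ux; exact: smooth_on_partial.
Qed.

End SmoothOn.

(** * Connections along maps *)

Section Bilinear.
Context {R : realType} {m : nat}.
Implicit Types (G : 'M[R]_m) (C : 'I_m -> 'I_m -> 'rV[R]_m) (u v w : 'rV[R]_m) (a : R).

Lemma innerDl G u v w : inner G (u + v) w = inner G u w + inner G v w.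
Proof. by rewrite /inner !mulmxDl mxE. Qed.

Lemma innerDr G u v w : inner G u (v + w) = inner G u v + inner G u w.
Proof. by rewrite /inner linearD mulmxDr mxE. Qed.

Lemma innerZl G a u v : inner G (a *: u) v = a * inner G u v.
Proof. by rewrite /inner -!scalemxAl mxE. Qed.

Lemma innerZr G a u v : inner G u (a *: v) = a * inner G u v.
Proof. by rewrite /inner linearZ -scalemxAr mxE. Qed.

Lemma innerNl G u v : inner G (- u) v = - inner G u v.
Proof. by rewrite /inner !mulNmx mxE. Qed.

Lemma innerNr G u v : inner G u (- v) = - inner G u v.
Proof. by rewrite /inner linearN mulmxN mxE. Qed.

Lemma innerBl G u v w : inner G (u - v) w = inner G u w - inner G v w.
Proof. by rewrite innerDl innerNl. Qed.

Lemma innerBr G u v w : inner G u (v - w) = inner G u v - inner G u w.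
Proof. by rewrite innerDr innerNr. Qed.

Lemma inner0l G v : inner G 0 v = 0.
Proof. by rewrite /inner !mul0mx mxE. Qed.

Lemma inner0r G v : inner G v 0 = 0.
Proof. by rewrite /inner trmx0 mulmx0 mxE. Qed.

Lemma inner_sym G u v : G^T = G -> inner G u v = inner G v u.
Proof. by move=> Gs; rewrite /inner -[in LHS]Gs -{1}[u]trmxK -!trmx_mul mxE mulmxA. Qed.

Lemma inner_sumE G u v : inner G u v = \sum_a \sum_b u 0 a * v 0 b * G a b.
Proof.
rewrite /inner mxE; under eq_bigr => b _ do rewrite !mxE mulr_suml.
rewrite exchange_big; apply: eq_bigr => a _; apply: eq_bigr => b _.
by rewrite mulrAC.
Qed.

Lemma inner_trmx G u v : inner G^T u v = inner G v u.
Proof. by rewrite /inner -{1}[u]trmxK -!trmx_mul mxE mulmxA. Qed.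

Lemma inner_mx G (G' : 'M[R]_m) : (forall u v, inner G u v = inner G' u v) -> G = G'.
Proof.
move=> AB; apply/matrixP => i j; have := AB (delta_mx 0 i) (delta_mx 0 j).
by rewrite /inner -!rowE trmx_delta -!colE !mxE.
Qed.

(** Each component of [bil] is a bilinear form of the kind [inner], so algebra and differentiation
    rules of [bil] reduce to those of [inner]. *)
Definition bilmx C (k : 'I_m) : 'M[R]_m := \matrix_(a, b) C a b 0 k.

Lemma bilE C u v k : bil C u v 0 k = inner (bilmx C k) u v.
Proof.
rewrite inner_sumE /bil summxE; apply: eq_bigr => a _.
by rewrite summxE; apply: eq_bigr => b _; rewrite !mxE.
Qed.

Lemma bilDl C u v w : bil C (u + v) w = bil C u w + bil C v w.
Proof. by apply/rowP => k; rewrite mxE !bilE innerDl. Qed.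

Lemma bilDr C u v w : bil C u (v + w) = bil C u v + bil C u w.
Proof. by apply/rowP => k; rewrite mxE !bilE innerDr. Qed.

Lemma bilZl C a u v : bil C (a *: u) v = a *: bil C u v.
Proof. by apply/rowP => k; rewrite mxE !bilE innerZl. Qed.

Lemma bilZr C a u v : bil C u (a *: v) = a *: bil C u v.
Proof. by apply/rowP => k; rewrite mxE !bilE innerZr. Qed.

Lemma bilNr C u v : bil C u (- v) = - bil C u v.
Proof. by rewrite -scaleN1r bilZr scaleN1r. Qed.

Lemma bil0r C u : bil C u 0 = 0.
Proof. by apply/rowP => k; rewrite bilE inner0r mxE. Qed.

Lemma bil0l C u : bil C 0 u = 0.
Proof. by apply/rowP => k; rewrite bilE inner0l mxE. Qed.

Lemma bilBr C u v w : bil C u (v - w) = bil C u v - bil C u w.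
Proof. by rewrite bilDr bilNr. Qed.

End Bilinear.

Section DeriveBilinear.
Context {R : realType} {V : normedModType R} {m : nat}.
Implicit Types (G : V -> 'M[R]_m) (C : V -> 'I_m -> 'I_m -> 'rV[R]_m).
Implicit Types (W Z : V -> 'rV[R]_m).

Lemma differentiable_inner G W Z x :
  differentiable G x -> differentiable W x -> differentiable Z x ->
  differentiable (fun y => inner (G y) (W y) (Z y)) x.
Proof.
move=> dG dW dZ; suff /differentiable_mxP :
  differentiable (fun y => W y *m G y *m (Z y)^T) x by apply.
by do 2?[apply: differentiable_mulmx => //]; exact: differentiable_trmx.
Qed.

Lemma twice_diff_inner G W Z x :
  twice_diff G x -> twice_diff W x -> twice_diff Z x ->
  twice_diff (fun y => inner (G y) (W y) (Z y)) x.
Proof.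
move=> dG dW dZ; suff /twice_diff_mxP :
  twice_diff (fun y => W y *m G y *m (Z y)^T) x by apply.
by do 2?[apply: twice_diff_mulmx => //]; exact: twice_diff_trmx.
Qed.

Lemma derive_inner G W Z x u :
  differentiable G x -> differentiable W x -> differentiable Z x ->
  'D_u (fun y => inner (G y) (W y) (Z y)) x =
  inner ('D_u G x) (W x) (Z x) + inner (G x) ('D_u W x) (Z x) +
  inner (G x) (W x) ('D_u Z x).
Proof.
move=> dG dW dZ; have dWG := differentiable_mulmx dW dG.
have dZt := differentiable_trmx dZ.
rewrite /inner derive_coord; last exact: differentiable_mulmx.
rewrite derive_mulmx // derive_mulmx // derive_trmx // mulmxDl !mxE.
by rewrite [X in X + _]addrC.
Qed.

Lemma differentiable_bilmx C x k :
  (forall a b, differentiable (fun y => C y a b) x) ->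
  differentiable (fun y => bilmx (C y) k) x.
Proof.
move=> dC; apply/differentiable_mxP => a b; under eq_fun do rewrite mxE.
by have /differentiable_mxP := dC a b.
Qed.

Lemma derive_bilmx C x k u :
  (forall a b, differentiable (fun y => C y a b) x) ->
  'D_u (fun y => bilmx (C y) k) x = bilmx (fun a b => 'D_u (fun y => C y a b) x) k.
Proof.
move=> dC; apply/matrixP => a b; rewrite -derive_coord; last exact: differentiable_bilmx.
by under eq_fun do rewrite mxE; rewrite derive_coord // mxE.
Qed.

Lemma differentiable_bil C W Z x :
  (forall a b, differentiable (fun y => C y a b) x) ->
  differentiable W x -> differentiable Z x ->
  differentiable (fun y => bil (C y) (W y) (Z y)) x.
Proof.
move=> dC dW dZ; apply/differentiable_mxP => i k; rewrite ord1.
under eq_fun do rewrite bilE.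
by apply: differentiable_inner => //; exact: differentiable_bilmx.
Qed.

Lemma derive_bil C W Z x u :
  (forall a b, differentiable (fun y => C y a b) x) ->
  differentiable W x -> differentiable Z x ->
  'D_u (fun y => bil (C y) (W y) (Z y)) x =
  bil (fun a b => 'D_u (fun y => C y a b) x) (W x) (Z x) +
  bil (C x) ('D_u W x) (Z x) + bil (C x) (W x) ('D_u Z x).
Proof.
move=> dC dW dZ; apply/rowP => k; rewrite -derive_coord; last exact: differentiable_bil.
under eq_fun do rewrite bilE.
by rewrite derive_inner ?derive_bilmx ?mxE ?bilE //; exact: differentiable_bilmx.
Qed.

Lemma derive_bil_cst C (w z : 'rV[R]_m) x u :
  (forall a b, differentiable (fun y => C y a b) x) ->
  'D_u (fun y => bil (C y) w z) x = bil (fun a b => 'D_u (fun y => C y a b) x) w z.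
Proof.
move=> dC; have dcst (k : 'rV[R]_m) := differentiable_cst k x.
by rewrite (derive_bil u dC (dcst w) (dcst z)) !derive_cst bil0l bil0r !addr0.
Qed.

Lemma derive_mulZ (k : R) (h : V -> R) x u : derivable h x u ->
  'D_u (fun y => k * h y) x = k * 'D_u h x.
Proof. exact: deriveZ. Qed.

Lemma derive_subZ (k : R) (h l : V -> R) x u : derivable h x u -> derivable l x u ->
  'D_u (fun y => h y - k * l y) x = 'D_u h x - k * 'D_u l x.
Proof.
move=> dh dl; rewrite -derive_mulZ //.
have dkl : derivable (fun y => k * l y) x u by exact: (derivableZ (k := k)).
exact: (deriveB dh dkl).
Qed.

End DeriveBilinear.

Section AlongMap.
Context {R : realType} {V : normedModType R} {m : nat}.
Variables (Gam : 'rV[R]_m -> 'I_m -> 'I_m -> 'rV[R]_m) (G : 'rV[R]_m -> 'M[R]_m).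
Implicit Types (f W Z : V -> 'rV[R]_m) (x : V) (u v : V).

(** Pullback connection: the covariant derivative of a vector field [W] along the map [f]. *)
Definition cov f u W x := 'D_u W x + bil (Gam (f x)) ('D_u f x) (W x).

(** The curvature tensor R(a,b)c at [z], written for constant fields, whose brackets vanish. *)
Definition riem (z a b c : 'rV[R]_m) :=
  'D_a (fun y => bil (Gam y) b c) z - 'D_b (fun y => bil (Gam y) a c) z
  + bil (Gam z) a (bil (Gam z) b c) - bil (Gam z) b (bil (Gam z) a c).

Definition gam_diff (z : 'rV[R]_m) := forall a b, differentiable (fun y => Gam y a b) z.
Definition gam_sym (z : 'rV[R]_m) := forall a b : 'rV[R]_m, bil (Gam z) a b = bil (Gam z) b a.
Definition compat (z : 'rV[R]_m) := forall a v w : 'rV[R]_m,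
  inner ('D_a G z) v w = inner (G z) (bil (Gam z) a v) w + inner (G z) v (bil (Gam z) a w).

Lemma differentiable_cov f u W x : gam_diff (f x) -> twice_diff f x -> twice_diff W x ->
  differentiable (cov f u W) x.
Proof.
move=> dG [nf df] [nW dW]; apply: differentiableD => //; apply: differentiable_bil => //.
  move=> a b; apply: (@differentiable_comp _ _ _ _ f (fun z => Gam z a b)) => //.
  exact: nbhs_singleton nf.
exact: nbhs_singleton nW.
Qed.

Lemma derive_cov f u v W x : gam_diff (f x) -> twice_diff f x -> twice_diff W x ->
  'D_u (cov f v W) x = 'D_u ('D_v W) x +
    ('D_('D_u f x) (fun z => bil (Gam z) ('D_v f x) (W x)) (f x) +
     bil (Gam (f x)) ('D_u ('D_v f) x) (W x) + bil (Gam (f x)) ('D_v f x) ('D_u W x)).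
Proof.
move=> dG f2 W2; have [_ df] := f2; have [_ dW] := W2.
have dfx := twice_diffW f2; have dWx := twice_diffW W2.
have dGf a b : differentiable (fun y => Gam (f y) a b) x.
  by apply: (@differentiable_comp _ _ _ _ f (fun z => Gam z a b)).
have dB := differentiable_bil dGf (df v) dWx.
rewrite [LHS](deriveD (diff_derivable (dW v)) (diff_derivable dB)).
have DB := derive_bil_cst ('D_v f x) (W x) ('D_u f x) dG.
congr (_ + _); apply: (etrans (derive_bil u dGf (df v) dWx)).
have E : (fun a b => 'D_u (fun y => Gam (f y) a b) x) =
    (fun a b => 'D_('D_u f x) (fun z => Gam z a b) (f x)).
  apply/funext => a; apply/funext => b.
  exact: (@derive_comp _ _ _ _ f (fun z => Gam z a b)).
exact: (congr1 (fun C => C + _ + _) (etrans (congr1 (fun C => bil C _ _) E) (esym DB))).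
Qed.

(** Stated on variables so that [ring] meets atoms instead of derivatives of bilinear expressions;
    the other [_arith] lemmas serve the same purpose. *)
Lemma ricci_arith (c1 c2 w1 w2 r1 r2 b1 b2 k1 k2 q1 q2 : 'rV[R]_m) :
  w1 = w2 -> b1 = b2 -> c1 = w1 + (r1 + b1 + k1) + (k2 + q1) ->
  c2 = w2 + (r2 + b2 + k2) + (k1 + q2) -> c1 - c2 = r1 - r2 + q1 - q2.
Proof. by move=> -> -> -> ->; apply/rowP => k; rewrite !mxE; ring. Qed.

(** After expansion, the second derivatives of [W] and of [f] cancel by symmetry and the terms with
    one derivative of [W] cancel crosswise; what remains is the curvature. *)
Lemma ricci_identity f u v W x : gam_diff (f x) -> twice_diff f x -> twice_diff W x ->
  cov f u (cov f v W) x - cov f v (cov f u W) x =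
  riem (f x) ('D_u f x) ('D_v f x) (W x).
Proof.
move=> dG f2 W2.
have E a b : cov f a (cov f b W) x = 'D_a ('D_b W) x +
    ('D_('D_a f x) (fun z => bil (Gam z) ('D_b f x) (W x)) (f x) +
     bil (Gam (f x)) ('D_a ('D_b f) x) (W x) + bil (Gam (f x)) ('D_b f x) ('D_a W x)) +
    (bil (Gam (f x)) ('D_a f x) ('D_b W x) +
     bil (Gam (f x)) ('D_a f x) (bil (Gam (f x)) ('D_b f x) (W x))).
  by rewrite -bilDr; congr (_ + _); exact: derive_cov.
have SW := schwarz_mx u v W2.
have Sf := congr1 (fun d => bil (Gam (f x)) d (W x)) (schwarz_mx u v f2).
exact: (ricci_arith SW Sf (E u v) (E v u)).
Qed.

Lemma cov_torsion_free f u v x : gam_sym (f x) -> twice_diff f x ->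
  cov f u ('D_v f) x = cov f v ('D_u f) x.
Proof. by move=> Gs f2; rewrite /cov (schwarz_mx u v f2) Gs. Qed.

Lemma derive_inner_cov f u W Z x : differentiable G (f x) -> compat (f x) ->
  differentiable f x -> differentiable W x -> differentiable Z x ->
  'D_u (fun y => inner (G (f y)) (W y) (Z y)) x =
  inner (G (f x)) (cov f u W x) (Z x) + inner (G (f x)) (W x) (cov f u Z x).
Proof.
move=> dG cG df dW dZ; rewrite derive_inner //; last exact: (differentiable_comp df dG).
rewrite (@derive_comp _ _ _ _ f G) // cG /cov innerDl innerDr; ring.
Qed.

Definition pullback f u v y := inner (G (f y)) ('D_u f y) ('D_v f y).

Lemma brioschi_arith1 (X X' D1 D2 p p1 p2 : R) :
  D1 = p + X' -> X' = X -> D2 = p1 + p2 -> p2 = p1 -> p1 = p -> X = D1 - 2^-1 * D2.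
Proof. by move=> -> -> -> -> ->; lra. Qed.

Lemma brioschi_arith2 (X D1 p p1 : R) : D1 = p + p1 -> p1 = p -> X = p -> X = 2^-1 * D1.
Proof. by move=> -> -> ->; lra. Qed.

Lemma brioschi_arith (L1 R1 A S0 D11 D12 L2 Z2 B C D22 I RR N S1 : R) :
  L1 = R1 -> L1 = A + S0 -> R1 = D11 - 2^-1 * D12 ->
  L2 = Z2 -> L2 = B + C -> Z2 = 2^-1 * D22 -> I = RR -> I = A - B -> C = N -> S0 = S1 ->
  RR = D11 - 2^-1 * D12 - 2^-1 * D22 + N - S1.
Proof. by move=> *; lra. Qed.

(** Compatibility and symmetry express <nabla_v f_v, f_u> and <nabla_u f_v, f_u> by first
    derivatives of the pulled back form. Differentiating the first along [u], the second along [v]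
    and subtracting makes the curvature appear through the Ricci identity. The two products of
    covariant derivatives stay as they are: [f] may have a kernel, so the pulled back form need not
    determine them. *)
Lemma brioschi f u v x : gam_diff (f x) -> twice_diff G (f x) ->
  (\forall z \near f x, [/\ gam_sym z, compat z & (G z)^T = G z]) ->
  (\forall y \near x, twice_diff f y) -> (forall w, twice_diff ('D_w f) x) ->
  inner (G (f x)) (riem (f x) ('D_u f x) ('D_v f x) ('D_v f x)) ('D_u f x) =
  'D_u ('D_v (pullback f u v)) x - 2^-1 * 'D_u ('D_u (pullback f v v)) x
    - 2^-1 * 'D_v ('D_v (pullback f u u)) x
    + inner (G (f x)) (cov f u ('D_v f) x) (cov f u ('D_v f) x)
    - inner (G (f x)) (cov f u ('D_u f) x) (cov f v ('D_v f) x).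
Proof.
move=> dGam G2 nG nf Df2.
have f2 := nbhs_singleton nf; have dfx := twice_diffW f2.
have cts := differentiable_continuous dfx.
have [sx cx Gx] := nbhs_singleton nG.
have {}nG : \forall y \near x, [/\ gam_sym (f y), compat (f y) & (G (f y))^T = G (f y)].
  exact: (cts _ nG).
have ndG : \forall y \near x, differentiable G (f y) by exact: (cts _ (twice_diff_near G2)).
have dDf w := twice_diffW (Df2 w).
have h2 a b : twice_diff (pullback f a b) x.
  by apply: twice_diff_inner => //; exact: twice_diff_comp.
have dh a b c w : derivable ('D_c (pullback f a b)) x w by apply: diff_derivable; case: (h2 a b).
have dC a b := differentiable_cov a dGam f2 (Df2 b).
have symG y (W Z : 'rV[R]_m) : (G (f y))^T = G (f y) -> inner (G (f y)) W Z = inner (G (f y)) Z W.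
  exact: inner_sym.
have hE a b c y : twice_diff f y -> compat (f y) -> differentiable G (f y) ->
    'D_c (pullback f a b) y =
    inner (G (f y)) (cov f c ('D_a f) y) ('D_b f y) +
    inner (G (f y)) ('D_a f y) (cov f c ('D_b f) y).
  move=> fy cy dGy; have [_ dfy] := fy.
  by apply: derive_inner_cov => //; exact: twice_diffW.
(* [e1] and [e2] are needed on a neighbourhood because both are differentiated once more. *)
have e1 : {near x, (fun y => inner (G (f y)) (cov f v ('D_v f) y) ('D_u f y)) =1
    (fun y => 'D_v (pullback f u v) y - 2^-1 * 'D_u (pullback f v v) y)}.
  near=> y.
  have [sy cy Gy] : [/\ gam_sym (f y), compat (f y) & (G (f y))^T = G (f y)] by near: y.
  have fy : twice_diff f y by near: y.
  have dGy : differentiable G (f y) by near: y.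
  have S := cov_torsion_free u v sy fy.
  have S1 := congr1 (fun c => inner (G (f y)) c ('D_v f y)) S.
  have S2 := symG y ('D_v f y) (cov f u ('D_v f) y) Gy.
  have S3 := symG y ('D_u f y) (cov f v ('D_v f) y) Gy.
  exact: (brioschi_arith1 (hE u v v y fy cy dGy) S3 (hE v v u y fy cy dGy) S2 S1).
have e2 : {near x, (fun y => inner (G (f y)) (cov f u ('D_v f) y) ('D_u f y)) =1
    (fun y => 2^-1 * 'D_v (pullback f u u) y)}.
  near=> y.
  have [sy cy Gy] : [/\ gam_sym (f y), compat (f y) & (G (f y))^T = G (f y)] by near: y.
  have fy : twice_diff f y by near: y.
  have dGy : differentiable G (f y) by near: y.
  have S := cov_torsion_free u v sy fy.
  have S1 := congr1 (fun c => inner (G (f y)) c ('D_u f y)) S.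
  have S2 := symG y ('D_u f y) (cov f v ('D_u f) y) Gy.
  exact: (brioschi_arith2 (hE u u v y fy cy dGy) S2 S1).
have dGx := twice_diffW G2.
have E1 := @near_eq_derive _ _ _ _ _ x u e1.
have E1l := derive_inner_cov u dGx cx dfx (dC v v) (dDf u).
have E1r := derive_subZ (2^-1) (dh u v v u) (dh v v u u).
have E2 := @near_eq_derive _ _ _ _ _ x v e2.
have E2l := derive_inner_cov v dGx cx dfx (dC u v) (dDf u).
have E2z := derive_mulZ (2^-1) (dh u u v v).
have E3 := congr1 (fun c => inner (G (f x)) c ('D_u f x)) (ricci_identity u v dGam f2 (Df2 v)).
have E3l := innerBl (G (f x)) (cov f u (cov f v ('D_v f)) x)
  (cov f v (cov f u ('D_v f)) x) ('D_u f x).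
have S := congr1 (inner (G (f x)) (cov f u ('D_v f) x)) (cov_torsion_free v u sx f2).
have S' := symG x (cov f v ('D_v f) x) (cov f u ('D_u f) x) Gx.
exact: (brioschi_arith E1 E1l E1r E2 E2l E2z E3 E3l S S').
Unshelve. all: by end_near. Qed.

End AlongMap.

(** * Curvature of Kenmotsu space forms *)

Section AlgebraicCurvature.
Context {R : realType} {U : zmodType}.
Variables (S : U -> Prop) (J : U -> U) (K : U -> U -> U -> U -> R).

(** [S] will be the orthogonal complement of xi: [J] is a complex structure there and not on the
    whole space, so the laws [kc_JJ] and [kc_J] are restricted to it. *)
Record kaehler_curvature : Prop := KaehlerCurvature {
  kc_S : forall x y, S x -> S y -> S (x + y);
  kc_SN : forall x, S x -> S (- x);
  kc_SJ : forall x, S x -> S (J x);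
  kc_JD : forall x y, J (x + y) = J x + J y;
  kc_JN : forall x, J (- x) = - J x;
  kc_JJ : forall x, S x -> J (J x) = - x;
  kc_D1 : forall x x' y z t, K (x + x') y z t = K x y z t + K x' y z t;
  kc_D2 : forall x y y' z t, K x (y + y') z t = K x y z t + K x y' z t;
  kc_D3 : forall x y z z' t, K x y (z + z') t = K x y z t + K x y z' t;
  kc_D4 : forall x y z t t', K x y z (t + t') = K x y z t + K x y z t';
  kc_N1 : forall x y z t, K (- x) y z t = - K x y z t;
  kc_N2 : forall x y z t, K x (- y) z t = - K x y z t;
  kc_N3 : forall x y z t, K x y (- z) t = - K x y z t;
  kc_N4 : forall x y z t, K x y z (- t) = - K x y z t;
  kc_skew12 : forall x y z t, K x y z t = - K y x z t;
  kc_skew34 : forall x y z t, K x y z t = - K x y t z;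
  kc_bianchi : forall x y z t, K x y z t + K y z x t + K z x y t = 0;
  kc_J : forall x y z t, S x -> S y -> S z -> S t -> K x y (J z) t = - K x y z (J t) }.

Hypothesis H : kaehler_curvature.

(** The octahedron argument: a linear combination of the Bianchi identities at the four cyclic
    shifts of the arguments. *)
Lemma kc_pair x y z t : K x y z t = K z t x y.
Proof.
have := (kc_bianchi H x y z t, kc_bianchi H y z t x, kc_bianchi H z t x y, kc_bianchi H t x y z).
case=> [[[b1 b2] b3] b4].
have s a b c d : K a b c d = K b a d c by rewrite (kc_skew12 H) (kc_skew34 H) opprK.
have e1 := kc_skew34 H y z t x.
have e4 := kc_skew34 H z t x y.
have e7 := kc_skew34 H t x z y.
have e8 := kc_skew34 H x y t z.
have f7 := s x z t y.
have f8 := s y t x z.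
lra.
Qed.

Definition holo x := K x (J x) (J x) x.

(** Put a = K x y y x and b = K x (J y) (J y) x. Expanding and using Bianchi, holo (x + y) + holo (x
    - y) - 2 holo x - 2 holo y = 4 a + 12 b. Replacing y by J y exchanges a and b, and the weights 3
    and -1 eliminate b. *)
Lemma holo_polar x y : S x -> S y ->
  32 * K x y y x = 3 * holo (x + J y) + 3 * holo (x - J y) - holo (x + y) - holo (x - y)
    - 4 * holo x - 4 * holo y.
Proof.
move=> Sx Sy; have SJx := kc_SJ H Sx; have SJy := kc_SJ H Sy.
have JJx := kc_JJ H Sx; have JJy := kc_JJ H Sy.
rewrite /holo !(kc_JD H) !(kc_JN H) JJy opprK.
rewrite !(kc_D1 H, kc_D2 H, kc_D3 H, kc_D4 H, kc_N1 H, kc_N2 H, kc_N3 H, kc_N4 H).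
have j a b c d : S a -> S b -> S c -> S d -> K a b (J c) (J d) = K a b c d.
  by move=> Sa Sb Sc Sd; rewrite (kc_J H) ?(kc_JJ H) ?(kc_N4 H) ?opprK //; exact: kc_SJ.
have j' a b c d : S a -> S b -> S c -> S d -> K (J a) (J b) c d = K a b c d.
  by move=> *; rewrite kc_pair j // kc_pair.
have s a b c d : K a b c d = K b a d c by rewrite (kc_skew12 H) (kc_skew34 H) opprK.
have bi := kc_bianchi H x (J x) (J y) y.
rewrite (j' x y x y) // in bi.
have e1 := kc_skew34 H x y x y.
have e2 := kc_skew12 H (J y) x (J x) y.
have e3 : K x (J y) (J x) y = K x (J y) (J y) x.
  by rewrite (kc_J H) // (kc_skew34 H) opprK.
have e4 := kc_skew34 H x (J x) y (J y).
have e5 : K x y (J x) (J y) = K x y x y by exact: j.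
have e6 : K (J y) (J x) (J x) (J y) = K x y y x by rewrite j' // j // s.
have e7 : K (J y) (J x) y x = K x y x y by rewrite j' // s.
have e8 : K (J y) y (J x) x = K x (J x) y (J y) by rewrite kc_pair s.
have e9 := s (J y) y y (J y).
have f1 : K y (J x) (J x) y = K x (J y) (J y) x.
  rewrite -(j' y (J x) (J x) y) // JJx (kc_N2 H) -(j _ _ (J x) y) // JJx (kc_N3 H).
  by rewrite opprK s.
have f2 : K y (J x) (J y) x = K x (J y) (J x) y by rewrite kc_pair s.
have f3 : K y (J y) (J x) x = K x (J x) (J y) y by rewrite kc_pair s kc_pair s kc_pair.
lra.
Qed.

End AlgebraicCurvature.

Section Scale.
Context {R : realType} {V : normedModType R} {k l : nat}.

Lemma differentiable_scale (s : V -> R) (W : V -> 'M[R]_(k, l)) x :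
  differentiable s x -> differentiable W x -> differentiable (fun y => s y *: W y) x.
Proof.
move=> ds /differentiable_mxP dW; apply/differentiable_mxP => i j.
by under eq_fun do rewrite mxE; exact: differentiableM.
Qed.

Lemma derive_scale (s : V -> R) (W : V -> 'M[R]_(k, l)) x u :
  differentiable s x -> differentiable W x ->
  'D_u (fun y => s y *: W y) x = 'D_u s x *: W x + s x *: 'D_u W x.
Proof.
move=> ds dW; apply/matrixP => i j.
have dWij : differentiable (fun y => W y i j) x by move/differentiable_mxP: dW; apply.
have dWu : 'D_u (fun y => W y i j) x = ('D_u W x) i j by exact: derive_coord.
rewrite -derive_coord; last exact: differentiable_scale.
under eq_fun do rewrite mxE.
have E := @deriveM R V s (fun y => W y i j) x u (diff_derivable ds) (diff_derivable dWij).
apply: (etrans E); rewrite dWu !mxE addrC.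
by congr (_ + _); rewrite -[LHS]/(_ * _) mulrC.
Qed.

End Scale.

(** * Symmetries of the curvature tensor *)

Section Curvature.
Context {R : realType} {m : nat}.
Variables (Gam : 'rV[R]_m -> 'I_m -> 'I_m -> 'rV[R]_m) (G : 'rV[R]_m -> 'M[R]_m).
Implicit Types (x u v w t z a b c : 'rV[R]_m).

Definition dgam x a : 'I_m -> 'I_m -> 'rV[R]_m := fun i j => 'D_a (fun y => Gam y i j) x.

Lemma riemE x a b c : gam_diff Gam x ->
  riem Gam x a b c = bil (dgam x a) b c - bil (dgam x b) a c
    + bil (Gam x) a (bil (Gam x) b c) - bil (Gam x) b (bil (Gam x) a c).
Proof.
move=> dG; rewrite /riem.
by rewrite (derive_bil_cst b c a dG) (derive_bil_cst a c b dG).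
Qed.

Lemma bil_dgamD x a a' b c : gam_diff Gam x ->
  bil (dgam x (a + a')) b c = bil (dgam x a) b c + bil (dgam x a') b c.
Proof.
move=> dG; rewrite /bil -big_split; apply: eq_bigr => i _ /=.
rewrite -big_split; apply: eq_bigr => j _ /=.
by rewrite /dgam deriveDr // scalerDr.
Qed.

Lemma bil_dgamZ x k a b c : gam_diff Gam x ->
  bil (dgam x (k *: a)) b c = k *: bil (dgam x a) b c.
Proof.
move=> dG; rewrite /bil scaler_sumr; apply: eq_bigr => i _ /=.
rewrite scaler_sumr; apply: eq_bigr => j _ /=.
by rewrite /dgam deriveZr // !scalerA mulrC.
Qed.

Lemma riem_sumD (p p' q q' r r' s s' : 'rV[R]_m) :
  (p + p') - (q + q') + (r + r') - (s + s') = (p - q + r - s) + (p' - q' + r' - s').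
Proof. by apply/rowP => k; rewrite !mxE; ring. Qed.

Lemma riem_sumZ k (p q r s : 'rV[R]_m) :
  k *: p - k *: q + k *: r - k *: s = k *: (p - q + r - s).
Proof. by apply/rowP => i; rewrite !mxE; ring. Qed.

Lemma riem_sum_skew (p q r s : 'rV[R]_m) : p - q + r - s = - (q - p + s - r).
Proof. by apply/rowP => i; rewrite !mxE; ring. Qed.

Lemma riem_skew x a b c : riem Gam x a b c = - riem Gam x b a c.
Proof. exact: riem_sum_skew. Qed.

Lemma riemDa x a a' b c : gam_diff Gam x ->
  riem Gam x (a + a') b c = riem Gam x a b c + riem Gam x a' b c.
Proof.
move=> dG; rewrite (riemE _ _ _ dG) (riemE a b c dG) (riemE a' b c dG).
have E := bil_dgamD a a' b c dG.
move: (dgam x (a + a')) (dgam x a) (dgam x a') (dgam x b) E => d da da' db ->.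
rewrite (bilDl db a a' c).
rewrite (bilDl (Gam x) a a' (bil (Gam x) b c)) (bilDl (Gam x) a a' c).
rewrite (bilDr (Gam x) b (bil (Gam x) a c)).
exact: riem_sumD.
Qed.

Lemma riemDb x a b b' c : gam_diff Gam x ->
  riem Gam x a (b + b') c = riem Gam x a b c + riem Gam x a b' c.
Proof.
move=> dG; rewrite riem_skew (riemDa b b' a c dG) opprD.
by rewrite -(riem_skew x a b c) -(riem_skew x a b' c).
Qed.

Lemma riemDc x a b c c' : gam_diff Gam x ->
  riem Gam x a b (c + c') = riem Gam x a b c + riem Gam x a b c'.
Proof.
move=> dG; rewrite (riemE _ _ _ dG) (riemE a b c dG) (riemE a b c' dG).
move: (dgam x a) (dgam x b) => da db.
rewrite (bilDr da b c c') (bilDr db a c c').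
rewrite (bilDr (Gam x) b c c') (bilDr (Gam x) a c c').
rewrite (bilDr (Gam x) a (bil (Gam x) b c)) (bilDr (Gam x) b (bil (Gam x) a c)).
exact: riem_sumD.
Qed.

Lemma riemZa x k a b c : gam_diff Gam x ->
  riem Gam x (k *: a) b c = k *: riem Gam x a b c.
Proof.
move=> dG; rewrite (riemE _ _ _ dG) (riemE a b c dG).
have E := bil_dgamZ k a b c dG.
move: (dgam x (k *: a)) (dgam x a) (dgam x b) E => d da db ->.
rewrite (bilZl db k a c).
rewrite (bilZl (Gam x) k a (bil (Gam x) b c)) (bilZl (Gam x) k a c).
rewrite (bilZr (Gam x) k b (bil (Gam x) a c)).
exact: riem_sumZ.
Qed.

Lemma riemZb x k a b c : gam_diff Gam x ->
  riem Gam x a (k *: b) c = k *: riem Gam x a b c.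
Proof.
by move=> dG; rewrite riem_skew (riemZa k b a c dG) -scalerN -(riem_skew x a b c).
Qed.

Lemma riemZc x k a b c : gam_diff Gam x ->
  riem Gam x a b (k *: c) = k *: riem Gam x a b c.
Proof.
move=> dG; rewrite (riemE _ _ _ dG) (riemE a b c dG).
move: (dgam x a) (dgam x b) => da db.
rewrite (bilZr da k b c) (bilZr db k a c).
rewrite (bilZr (Gam x) k b c) (bilZr (Gam x) k a c).
rewrite (bilZr (Gam x) k a (bil (Gam x) b c)) (bilZr (Gam x) k b (bil (Gam x) a c)).
exact: riem_sumZ.
Qed.

Lemma riem_sum_bianchi (p1 p2 p3 q1 q2 q3 : 'rV[R]_m) :
  (p1 - p2 + q1 - q2) + (p2 - p3 + q2 - q3) + (p3 - p1 + q3 - q1) = 0.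
Proof. by apply/rowP => i; rewrite !mxE; ring. Qed.

Lemma bianchi_identity x a b c : (\forall y \near x, gam_sym Gam y) ->
  riem Gam x a b c + riem Gam x b c a + riem Gam x c a b = 0.
Proof.
move=> nG; have Gx := nbhs_singleton nG.
have D u v w : 'D_u (fun y => bil (Gam y) v w) x = 'D_u (fun y => bil (Gam y) w v) x.
  by apply: near_eq_derive; apply: filterS nG => y ->.
rewrite /riem (D b a c) (D c b a) (D a c b) (Gx a c) (Gx b a) (Gx c b).
exact: riem_sum_bianchi.
Qed.

End Curvature.

Lemma twice_diff_id (R : realType) (V : normedModType R) (x : V) : twice_diff (id : V -> V) x.
Proof.
split=> [|u]; first by apply: nearW => y.
apply: near_eq_differentiable (differentiable_cst u x).
by apply: nearW => y; rewrite derive_id.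
Qed.

Section Nabla.
Context {R : realType} {m : nat}.
Variables (Gam : 'rV[R]_m -> 'I_m -> 'I_m -> 'rV[R]_m) (G : 'rV[R]_m -> 'M[R]_m).
Implicit Types (x u v w t z a b c : 'rV[R]_m) (W Z : 'rV[R]_m -> 'rV[R]_m).

Definition nab u W x := 'D_u W x + bil (Gam x) u (W x).

Lemma cov_id u W : cov Gam (id : 'rV[R]_m -> 'rV[R]_m) u W = nab u W.
Proof. by apply/funext => x; rewrite /cov derive_id. Qed.

Lemma differentiable_nab u W x : gam_diff Gam x -> twice_diff W x ->
  differentiable (nab u W) x.
Proof.
move=> dG W2; have := @differentiable_cov _ _ _ Gam id u W x dG (twice_diff_id x) W2.
by rewrite cov_id.
Qed.

Lemma nab_ricci u v W x : gam_diff Gam x -> twice_diff W x ->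
  nab u (nab v W) x - nab v (nab u W) x = riem Gam x u v (W x).
Proof.
move=> dG W2.
have := @ricci_identity _ _ _ Gam id u v W x dG (twice_diff_id x) W2.
by rewrite !cov_id !derive_id.
Qed.

Lemma derive_inner_nab u W Z x : differentiable G x -> compat Gam G x ->
  differentiable W x -> differentiable Z x ->
  'D_u (fun y => inner (G y) (W y) (Z y)) x =
  inner (G x) (nab u W x) (Z x) + inner (G x) (W x) (nab u Z x).
Proof.
move=> dG cG dW dZ; rewrite -!cov_id.
exact: (@derive_inner_cov _ _ _ Gam G id u W Z x dG cG (twice_diffW (twice_diff_id x)) dW dZ).
Qed.

Lemma near_eq_nab u W Z x : {near x, W =1 Z} -> nab u W x = nab u Z x.
Proof. by move=> E; rewrite /nab (near_eq_derive u E) (nbhs_singleton E). Qed.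

Lemma nabD u W Z x : differentiable W x -> differentiable Z x ->
  nab u (fun y => W y + Z y) x = nab u W x + nab u Z x.
Proof.
move=> dW dZ; have E := @deriveD _ _ _ W Z x u (diff_derivable dW) (diff_derivable dZ).
by rewrite /nab bilDr [X in X + _]E addrACA.
Qed.

Lemma nab_scale u (s : 'rV[R]_m -> R) W x : differentiable s x -> differentiable W x ->
  nab u (fun y => s y *: W y) x = 'D_u s x *: W x + s x *: nab u W x.
Proof. by move=> ds dW; rewrite /nab bilZr derive_scale // -addrA -scalerDr. Qed.

Lemma nabB u W Z x : differentiable W x -> differentiable Z x ->
  nab u (fun y => W y - Z y) x = nab u W x - nab u Z x.
Proof.
move=> dW dZ; have E := @deriveB _ _ _ W Z x u (diff_derivable dW) (diff_derivable dZ).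
by rewrite /nab bilBr [X in X + _]E opprD addrACA.
Qed.

Lemma nab_cst u w x : nab u (cst w) x = bil (Gam x) u w.
Proof. by rewrite /nab derive_cst add0r. Qed.

Lemma skew_arith (D1 D2 a b n n' p q : R) : D1 = (a + n) + (n' + p) -> D2 = (b + n') + (n + q) ->
  D1 = D2 -> n = n' -> p = a -> q = b -> a - b = 0.
Proof. by move=> *; lra. Qed.

(** The second derivatives of the function <w,w> along [z] and [u] commute; by compatibility and the
    Ricci identity their difference is 2 <R(z,u)w, w>. *)
Lemma riem_metric0 x z u w : gam_diff Gam x -> twice_diff G x ->
  (\forall y \near x, compat Gam G y) -> (G x)^T = G x ->
  inner (G x) (riem Gam x z u w) w = 0.
Proof.
move=> dGam G2 cG Gs; pose W : 'rV[R]_m -> 'rV[R]_m := cst w.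
have W2 : twice_diff W x by exact: twice_diff_cst.
have dW y : differentiable W y by exact: differentiable_cst.
pose h y := inner (G y) (W y) (W y).
have h2 : twice_diff h x by exact: twice_diff_inner.
have dGx := twice_diffW G2; have cGx := nbhs_singleton cG.
have h1 a : {near x, 'D_a h =1
    fun y => inner (G y) (nab a W y) (W y) + inner (G y) (W y) (nab a W y)}.
  by apply: filterS2 cG (twice_diff_near G2) => y cy dy; exact: derive_inner_nab.
have dN a := differentiable_nab a dGam W2.
have hh a b : 'D_b ('D_a h) x =
    (inner (G x) (nab b (nab a W) x) (W x) + inner (G x) (nab a W x) (nab b W x)) +
    (inner (G x) (nab b W x) (nab a W x) + inner (G x) (W x) (nab b (nab a W) x)).
  rewrite (near_eq_derive b (h1 a)).
  have i1 : differentiable (fun y => inner (G y) (nab a W y) (W y)) x.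
    by apply: differentiable_inner.
  have i2 : differentiable (fun y => inner (G y) (W y) (nab a W y)) x.
    by apply: differentiable_inner.
  apply: (etrans (@deriveD _ _ _ _ _ x b (diff_derivable i1) (diff_derivable i2))).
  by congr (_ + _); apply: derive_inner_nab.
have sym a b := @inner_sym R m (G x) a b Gs.
have S := schwarz_real z u h2.
have E1 := hh u z; have E2 := hh z u.
have E3 := sym (nab u W x) (nab z W x).
have E4 := sym (W x) (nab z (nab u W) x); have E5 := sym (W x) (nab u (nab z W) x).
rewrite -(nab_ricci z u dGam W2) innerBl.
by apply: (skew_arith E1 E2 S E3 E4 E5).
Qed.

End Nabla.

Section HolomorphicCurvature.
Context {R : realType} {m : nat}.
Variables (A P : 'M[R]_m) (xi : 'rV[R]_m).
Variables (r : 'rV[R]_m -> 'rV[R]_m -> 'rV[R]_m -> 'rV[R]_m) (c : R).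
Implicit Types (u v w t z a b : 'rV[R]_m).
Local Notation g := (inner A).

(** The data at one point from which the space form formula follows by linear algebra. [hc_P] gives
    the commutator of the curvature with psi on vectors orthogonal to xi; it equals the commutator
    found for constant curvature -1. *)
Record holomorphic_curvature : Prop := HolomorphicCurvature {
  hc_sym : A^T = A;
  hc_pos : forall u, u != 0 -> 0 < g u u;
  hc_skew : forall u v, g (u *m P) v = - g u (v *m P);
  hc_PP : forall u, u *m P *m P = - u + g u xi *: xi;
  hc_Pxi : forall u, g (u *m P) xi = 0;
  hc_Da : forall a a' b w, r (a + a') b w = r a b w + r a' b w;
  hc_Db : forall a b b' w, r a (b + b') w = r a b w + r a b' w;
  hc_Dc : forall a b w w', r a b (w + w') = r a b w + r a b w';
  hc_Za : forall k a b w, r (k *: a) b w = k *: r a b w;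
  hc_Zb : forall k a b w, r a (k *: b) w = k *: r a b w;
  hc_Zc : forall k a b w, r a b (k *: w) = k *: r a b w;
  hc_skew12 : forall a b w, r a b w = - r b a w;
  hc_skew34 : forall a b w, g (r a b w) w = 0;
  hc_bianchi : forall a b w, r a b w + r b w a + r w a b = 0;
  hc_P : forall z u w t, g z xi = 0 -> g u xi = 0 -> g w xi = 0 -> g t xi = 0 ->
    g (r z u (w *m P)) t = g (r z u w *m P) t
    + g (u *m P) w * g z t - g (z *m P) w * g u t
    - g w z * g (u *m P) t + g w u * g (z *m P) t;
  hc_hol : forall u, g u u = 1 -> g u xi = 0 -> g (r u (u *m P) (u *m P)) u = c }.

Hypothesis K : holomorphic_curvature.

Definition xi_perp u := g u xi = 0.

(** The curvature minus that of constant curvature -1, the value that nabla_X xi = X - eta(X) xi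
    forces on planes containing xi. *)
Definition curv4 z u w t := g (r z u w) t + g u w * g z t - g z w * g u t.

Lemma gsym u v : g u v = g v u.
Proof. by apply: inner_sym; exact: (hc_sym K). Qed.

Lemma riem_metric_skew z u w t : g (r z u w) t = - g (r z u t) w.
Proof.
have r0 := hc_skew34 K z u.
have := r0 (w + t); rewrite (hc_Dc K).
rewrite innerDl !innerDr r0 r0 add0r addr0 => /eqP.
by rewrite addr_eq0 => /eqP.
Qed.

Lemma kaehler_curv4 : kaehler_curvature xi_perp (fun u => u *m P) curv4.
Proof.
split; rewrite /xi_perp /curv4.
- by move=> u v Su Sv; rewrite innerDl Su Sv addr0.
- by move=> u Su; rewrite innerNl Su oppr0.
- by move=> u _; exact: hc_Pxi.
- by move=> u v; rewrite mulmxDl.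
- by move=> u; rewrite mulNmx.
- by move=> u Su; rewrite (hc_PP K) Su scale0r addr0.
- by move=> z z' u w t; rewrite (hc_Da K z z' u w) !innerDl; ring.
- by move=> z u u' w t; rewrite (hc_Db K z u u' w) !innerDl; ring.
- by move=> z u w w' t; rewrite (hc_Dc K z u w w') !innerDl !innerDr; ring.
- by move=> z u w t t'; rewrite !innerDr; ring.
- by move=> z u w t; rewrite -(scaleN1r z) (hc_Za K _ z u w) !innerZl; ring.
- by move=> z u w t; rewrite -(scaleN1r u) (hc_Zb K _ z u w) !innerZl; ring.
- by move=> z u w t; rewrite -(scaleN1r w) (hc_Zc K _ z u w) !innerZl !innerZr; ring.
- by move=> z u w t; rewrite -(scaleN1r t) !innerZr; ring.
- by move=> z u w t; rewrite (hc_skew12 K z u w) innerNl; ring.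
- by move=> z u w t; rewrite riem_metric_skew; ring.
- move=> z u w t; have B := hc_bianchi K z u w.
  have {B} := congr1 (fun v => g v t) B; rewrite /= !innerDl inner0l => B.
  rewrite (gsym u w) (gsym z w) (gsym z u); lra.
- move=> z u w t Sz Su Sw St; rewrite (hc_P K) //.
  have E1 := hc_skew K; rewrite !E1 (gsym w z) (gsym w u); ring.
Qed.

(** [hc_hol] speaks of unit vectors; the general case follows since both sides are homogeneous of
    degree 4. The shift from c to c + 1 is the subtracted curvature -1. *)
Lemma holo_curv4 u : xi_perp u -> holo (fun u => u *m P) curv4 u = (c + 1) * g u u ^+ 2.
Proof.
move=> Su; rewrite /holo /curv4.
have uP : g u (u *m P) = 0.
  by have := hc_skew K u u; rewrite gsym => /eqP; rewrite -addr_eq0 -mulr2n mulrn_eq0 => /eqP.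
have PP : g (u *m P) (u *m P) = g u u.
  by rewrite (hc_skew K) (hc_PP K) Su scale0r addr0 innerNr opprK.
rewrite uP PP mul0r subr0.
have [->|u0] := eqVneq u 0.
  by rewrite !inner0r; ring.
have guu := hc_pos K u0.
pose k := (Num.sqrt (g u u))^-1; pose v := k *: u.
have k2 : k ^+ 2 * g u u = 1.
  by rewrite exprVn sqr_sqrtr ?mulVf // ?gt_eqF // ltW.
have Sv : xi_perp v by rewrite /xi_perp innerZl Su mulr0.
have vv : g v v = 1 by rewrite innerZl innerZr -k2; ring.
have := hc_hol K vv Sv; rewrite /v -scalemxAl.
rewrite (hc_Za K _ _ _ _) (hc_Zb K _ _ _ _) (hc_Zc K _ _ _ _) !innerZl innerZr => E.
rewrite -E; set q := g (r _ _ _) _.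
have -> : k * (k * (k * (k * q))) = (k ^+ 2) ^+ 2 * q by ring.
have -> : ((k ^+ 2) ^+ 2 * q + 1) * g u u ^+ 2 = (k ^+ 2 * g u u) ^+ 2 * q + g u u ^+ 2 by ring.
by rewrite k2; ring.
Qed.

(** Polarization gives the complex space form expression with factor (c + 1) / 4 for [curv4]; adding
    back curvature -1 turns the first coefficient into (c + 1) / 4 - 1 = (c - 3) / 4. *)
Lemma sectional_curvature u v : xi_perp u -> xi_perp v ->
  g (r u v v) u =
  (c - 3) / 4 * (g u u * g v v - g u v ^+ 2) + 3 * (c + 1) / 4 * g (u *m P) v ^+ 2.
Proof.
move=> Su Sv; have H := kaehler_curv4.
have SJv := kc_SJ H Sv.
have PP : g (v *m P) (v *m P) = g v v.
  by rewrite (hc_skew K) (hc_PP K) Sv scale0r addr0 innerNr opprK.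
have uJv : g u (v *m P) = - g (u *m P) v by rewrite (hc_skew K) opprK.
have := holo_polar H Su Sv.
have S1 := kc_S H Su SJv; have S2 := kc_S H Su (kc_SN H SJv).
have S3 := kc_S H Su Sv; have S4 := kc_S H Su (kc_SN H Sv).
rewrite !holo_curv4 //.
rewrite !(innerDl, innerDr, innerNl, innerNr) /curv4 PP uJv.
rewrite (gsym (v *m P) u) uJv (gsym v u).
set a := g u u; set b := g v v; set s := g u v; set q := g _ v; set k := g _ u => E.
have -> : k = (32 * (k + b * a - s * s)) / 32 - b * a + s * s by field.
by rewrite E; field.
Qed.

End HolomorphicCurvature.

Section Kenmotsu.
Context {R : realType} {m : nat}.
Variables (Gam : 'rV[R]_m -> 'I_m -> 'I_m -> 'rV[R]_m) (G P : 'rV[R]_m -> 'M[R]_m).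
Variables (xi : 'rV[R]_m -> 'rV[R]_m) (x : 'rV[R]_m) (c : R).
Implicit Types (u v w t z a b : 'rV[R]_m).

(** The Kenmotsu structure in coordinates around [x]. [ka_nab_P] is stated near [x] and for constant
    fields because it is differentiated once to reach the curvature. *)
Record kenmotsu_at : Prop := KenmotsuAt {
  ka_gam : gam_diff Gam x;
  ka_sym : \forall y \near x, gam_sym Gam y;
  ka_compat : \forall y \near x, compat Gam G y;
  ka_G : twice_diff G x;
  ka_P : twice_diff P x;
  ka_xi : twice_diff xi x;
  ka_Gs : (G x)^T = G x;
  ka_skew : forall u v, inner (G x) (u *m P x) v = - inner (G x) u (v *m P x);
  ka_PP : forall u, u *m P x *m P x = - u + inner (G x) u (xi x) *: xi x;
  ka_Pxi : forall u, inner (G x) (u *m P x) (xi x) = 0;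
  ka_pos : forall u, u != 0 -> 0 < inner (G x) u u;
  ka_hol : forall u, inner (G x) u u = 1 -> inner (G x) u (xi x) = 0 ->
    inner (G x) (riem Gam x u (u *m P x) (u *m P x)) u = c;
  ka_nab_xi : \forall y \near x, forall u, nab Gam u xi y = u - inner (G y) u (xi y) *: xi y;
  ka_nab_P : \forall y \near x, forall u w,
    nab Gam u (fun y => w *m P y) y - bil (Gam y) u w *m P y =
    inner (G y) (u *m P y) w *: xi y - inner (G y) w (xi y) *: (u *m P y) }.

Hypothesis K : kenmotsu_at.

(** Tensoriality: nabla psi at [x] depends only on B x, so the law for the constant field with that
    value yields the law for [B]. *)
Lemma nab_P z (B : 'rV[R]_m -> 'rV[R]_m) : differentiable B x ->
  nab Gam z (fun y => B y *m P y) x = nab Gam z B x *m P x +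
    (inner (G x) (z *m P x) (B x) *: xi x - inner (G x) (B x) (xi x) *: (z *m P x)).
Proof.
move=> dB; have dP := twice_diffW (ka_P K).
rewrite -(nbhs_singleton (ka_nab_P K) z (B x)).
have E1 := derive_mulmx z dB dP.
have E2 := derive_mulmx z (differentiable_cst (B x) x) dP.
rewrite derive_cst mul0mx add0r in E2.
have -> : nab Gam z (fun y => B y *m P y) x =
    'D_z (fun y => B y *m P y) x + bil (Gam x) z (B x *m P x) by [].
have -> : nab Gam z (fun y => B x *m P y) x =
    'D_z (fun y => B x *m P y) x + bil (Gam x) z (B x *m P x) by [].
have -> : nab Gam z B x = 'D_z B x + bil (Gam x) z (B x) by [].
rewrite mulmxDl E1; move: E2; rewrite /cst => ->.
move: (_ *m _) (_ *m _) (bil _ _ _) (bil _ _ _ *m _) => p q r s.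
by apply/rowP => k; rewrite !mxE; ring.
Qed.

Local Notation xi_perp := (xi_perp (G x) (xi x)).

Lemma nab_nab_P z u w t : xi_perp z -> xi_perp u -> xi_perp w -> xi_perp t ->
  inner (G x) (nab Gam z (nab Gam u (fun y => w *m P y)) x) t =
  inner (G x) (nab Gam z (fun y => bil (Gam y) u w) x *m P x) t
  - inner (G x) (bil (Gam x) u w) (xi x) * inner (G x) (z *m P x) t
  + inner (G x) (u *m P x) w * inner (G x) z t
  - (inner (G x) (bil (Gam x) z w) (xi x) + inner (G x) w z) * inner (G x) (u *m P x) t.
Proof.
move=> Sz Su Sw St; have dP := twice_diffW (ka_P K); have dxi := twice_diffW (ka_xi K).
have dG := twice_diffW (ka_G K).
have dcst v : differentiable (cst v : 'rV[R]_m -> 'rV[R]_m) x by exact: differentiable_cst.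
have duP v : differentiable (fun y => v *m P y) x by exact: differentiable_mulmx (dcst v) dP.
pose B y := bil (Gam y) u w.
have dB : differentiable B x by exact: differentiable_bil (ka_gam K) (dcst u) (dcst w).
pose s y := inner (G y) (u *m P y) w; pose e y := inner (G y) w (xi y).
have ds : differentiable s x by exact: differentiable_inner dG (duP u) (dcst w).
have de : differentiable e x by exact: differentiable_inner dG (dcst w) dxi.
have dBP : differentiable (fun y => B y *m P y) x by exact: differentiable_mulmx.
have dsx : differentiable (fun y => s y *: xi y) x by exact: differentiable_scale.
have deP : differentiable (fun y => e y *: (u *m P y)) x by exact: differentiable_scale.
have dse : differentiable (fun y => s y *: xi y - e y *: (u *m P y)) x.
  exact: differentiableB.
have E : {near x, nab Gam u (fun y => w *m P y) =1
    fun y => B y *m P y + (s y *: xi y - e y *: (u *m P y))}.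
  by apply: filterS (ka_nab_P K) => y <-; rewrite addrC subrK.
rewrite (near_eq_nab Gam z E) (nabD Gam z dBP dse) (nabB Gam z dsx deP).
rewrite (nab_P z dB) (nab_scale Gam z ds dxi) (nab_scale Gam z de (duP u)).
rewrite (nbhs_singleton (ka_nab_xi K) z).
have De : 'D_z e x = inner (G x) (bil (Gam x) z w) (xi x) + inner (G x) w z.
  apply: (etrans (derive_inner_nab z dG (nbhs_singleton (ka_compat K)) (dcst w) dxi)).
  rewrite nab_cst (nbhs_singleton (ka_nab_xi K) z) [inner (G x) z (xi x)]Sz scale0r.
  by rewrite subr0.
have xt : inner (G x) (xi x) t = 0 by rewrite inner_sym //; exact: ka_Gs.
have zx : inner (G x) z (xi x) = 0 by [].
have wx : inner (G x) w (xi x) = 0 by [].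
have ex : e x = 0 by [].
rewrite De ex zx !(scale0r, subr0, addr0).
move: (inner (G x) (z *m P x) (B x)) => k1; rewrite -/(B x).
rewrite !(innerDl, innerBl, innerZl, innerNl) xt /s; ring.
Qed.

(** Compare the Ricci identities for the fields psi w and w. In [nab_nab_P] the terms containing
    connection coefficients paired with xi are, taken together, symmetric in [z] and [u], so they
    cancel in the commutator. *)
Lemma riem_P z u w t : xi_perp z -> xi_perp u -> xi_perp w -> xi_perp t ->
  inner (G x) (riem Gam x z u (w *m P x)) t =
  inner (G x) (riem Gam x z u w *m P x) t
  + inner (G x) (u *m P x) w * inner (G x) z t - inner (G x) (z *m P x) w * inner (G x) u t
  - inner (G x) w z * inner (G x) (u *m P x) t + inner (G x) w u * inner (G x) (z *m P x) t.
Proof.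
move=> Sz Su Sw St.
have wP2 : twice_diff (fun y => w *m P y) x.
  by apply: twice_diff_mulmx (ka_P K); exact: twice_diff_cst.
have w2 : twice_diff (cst w : 'rV[R]_m -> 'rV[R]_m) x by exact: twice_diff_cst.
have E1 := nab_ricci z u (ka_gam K) wP2.
have E2 := nab_ricci z u (ka_gam K) w2.
have nE v : nab Gam v (cst w) = fun y => bil (Gam y) v w.
  by apply/funext => y; rewrite nab_cst.
rewrite !nE in E2.
rewrite -E1 innerBl (nab_nab_P Sz Su Sw St) (nab_nab_P Su Sz Sw St).
have {}E2 := congr1 (fun v => inner (G x) (v *m P x) t) E2.
rewrite /= mulmxBl innerBl in E2.
by rewrite -E2; ring.
Qed.

Lemma kenmotsu_holomorphic_curvature :
  holomorphic_curvature (G x) (P x) (xi x) (riem Gam x) c.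
Proof.
have dG := ka_gam K; split.
- exact: ka_Gs.
- exact: ka_pos.
- exact: ka_skew.
- exact: ka_PP.
- exact: ka_Pxi.
- by move=> *; exact: riemDa.
- by move=> *; exact: riemDb.
- by move=> *; exact: riemDc.
- by move=> *; exact: riemZa.
- by move=> *; exact: riemZb.
- by move=> *; exact: riemZc.
- by move=> *; exact: riem_skew.
- by move=> *; apply: riem_metric0 (ka_compat K) (ka_Gs K) => //; exact: ka_G.
- by move=> *; exact: bianchi_identity (ka_sym K).
- exact: riem_P.
- exact: ka_hol.
Qed.

End Kenmotsu.

(** * The Gauss inequality for Riemannian maps *)

Section IdempotentDefect.
Context {R : realType} {n : nat}.
Variables (K N : 'rV[R]_n -> 'M[R]_n) (x : 'rV[R]_n).
Hypotheses (K2 : twice_diff K x) (N2 : twice_diff N x).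
Hypothesis KNK : \forall y \near x, K y *m N y *m K y = K y.
Hypothesis Ks : \forall y \near x, (K y)^T = K y.
Implicit Types (u v w z a b : 'rV[R]_n).

Lemma derive_symmx u : ('D_u K x)^T = 'D_u K x.
Proof.
rewrite -derive_trmx; last exact: twice_diffW.
exact: near_eq_derive.
Qed.

Lemma ker_sym w : w *m K x = 0 -> K x *m w^T = 0.
Proof. by move=> wK; rewrite -(nbhs_singleton Ks) -trmx_mul wK trmx0. Qed.

Lemma derive_idem z : {near x, 'D_z K =1
  fun y => 'D_z K y *m (N y *m K y) + K y *m ('D_z N y *m K y) + K y *m N y *m 'D_z K y}.
Proof.
apply: filterS3 (near_near KNK) (twice_diff_near K2) (twice_diff_near N2) => y KNKy dK dN.
have E := near_eq_derive z KNKy.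
have E1 := derive_mulmx z (differentiable_mulmx dK dN) dK.
have E2 := derive_mulmx z dK dN.
rewrite -[LHS]E; apply: (etrans E1); rewrite E2 mulmxDl.
by congr (_ + _ + _); rewrite -mulmxA.
Qed.

(** Each term of the differentiated equation K N K = K has [K] at its left or right end. *)
Lemma derive_ker z v w : v *m K x = 0 -> w *m K x = 0 -> inner ('D_z K x) v w = 0.
Proof.
move=> vK /ker_sym wK; rewrite [X in inner X](nbhs_singleton (derive_idem z)).
rewrite /inner !mulmxDr !mulmxDl -!mulmxA wK !mulmx0 !mulmxA vK !mul0mx !addr0.
by rewrite mxE.
Qed.

(** Differentiating K N K = K twice, the only terms without [K] at an end are those in which each
    outer factor is differentiated once. *)
Lemma derive2_ker u z v w : v *m K x = 0 -> w *m K x = 0 ->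
  inner ('D_u ('D_z K) x) v w =
  inner (N x) (v *m 'D_z K x) (w *m 'D_u K x) + inner (N x) (v *m 'D_u K x) (w *m 'D_z K x).
Proof.
move=> vK wK; have vKt := ker_sym vK; have wKt := ker_sym wK.
have dK := twice_diffW K2; have dN := twice_diffW N2.
have dKz : differentiable ('D_z K) x by case: K2.
have dNz : differentiable ('D_z N) x by case: N2.
have dNK := differentiable_mulmx dN dK; have dKN := differentiable_mulmx dK dN.
have dNzK := differentiable_mulmx dNz dK.
have d1 := differentiable_mulmx dKz dNK; have d2 := differentiable_mulmx dK dNzK.
have d3 := differentiable_mulmx dKN dKz.
have E0 := near_eq_derive u (derive_idem z).
have E1 := @deriveD _ _ _ _ _ x u (diff_derivable (differentiableD d1 d2)) (diff_derivable d3).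
have E2 := @deriveD _ _ _ _ _ x u (diff_derivable d1) (diff_derivable d2).
have F1 := derive_mulmx u dKz dNK; have F2 := derive_mulmx u dK dNzK.
have F3 := derive_mulmx u dKN dKz; have F4 := derive_mulmx u dN dK.
have F5 := derive_mulmx u dK dN.
rewrite (etrans E0 (etrans E1 (congr1 (fun M => M + _) E2))) F1 F2 F3 F4 F5.
have wz := derive_symmx z; have wu := derive_symmx u.
move: ('D_u K x) ('D_z K x) ('D_u ('D_z K) x) (K x) (N x) ('D_u (fun y => _ *m _) x)
  ('D_z N x) ('D_u N x) wz wu vK wKt => ku kz kuz k nn X nz nu wz wu vK wKt.
rewrite /inner !trmx_mul wz wu !(mulmxDr, mulmxDl) -!mulmxA wKt !mulmx0 !mulmxA vK !mul0mx.
by rewrite !addr0 !add0r mxE.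
Qed.

End IdempotentDefect.

(** * Koszul and Brioschi formulas for constant fields *)

Section Koszul.
Context {R : realType} {m : nat}.
Variables (Gam : 'rV[R]_m -> 'I_m -> 'I_m -> 'rV[R]_m) (G : 'rV[R]_m -> 'M[R]_m).

Lemma koszul_arith (da db dz ab ba az bz za zb : R) :
  da = ab + az -> db = ba + bz -> dz = za + zb -> ba = ab -> az = za -> bz = zb ->
  ab = 2^-1 * (da + db - dz).
Proof. by move=> *; lra. Qed.

Lemma koszul (V : normedModType R) (f : V -> 'rV[R]_m) a b z x :
  gam_sym Gam (f x) -> compat Gam G (f x) -> (G (f x))^T = G (f x) ->
  differentiable G (f x) -> twice_diff f x ->
  inner (G (f x)) (cov Gam f a ('D_b f) x) ('D_z f x) =
  2^-1 * ('D_a (pullback G f b z) x + 'D_b (pullback G f a z) x - 'D_z (pullback G f a b) x).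
Proof.
move=> sG cG Gs dG f2; have dfx := twice_diffW f2; have [_ df] := f2.
have hE u v w := derive_inner_cov w dG cG dfx (df u) (df v).
have S u v := cov_torsion_free u v sG f2.
have C u v (W : 'rV[R]_m) := congr1 (fun c => inner (G (f x)) c W) (S u v).
have Y W Z := @inner_sym R m (G (f x)) W Z Gs.
have e1 := hE b z a; have e2 := hE a z b; have e3 := hE a b z.
have s1 := C b a ('D_z f x).
have s2 := etrans (Y ('D_b f x) (cov Gam f a ('D_z f) x)) (C a z ('D_b f x)).
have s3 := congr1 (inner (G (f x)) ('D_a f x)) (S b z).
exact: (koszul_arith e1 e2 e3 s1 s2 s3).
Qed.

Lemma derive_idf u : 'D_u (id : 'rV[R]_m -> 'rV[R]_m) = cst u.
Proof. by apply/funext => y; rewrite derive_id. Qed.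

Lemma pullback_id u v : pullback G id u v = fun y => inner (G y) u v.
Proof. by apply/funext => y; rewrite /pullback !derive_id. Qed.

Lemma cov_id_cst u v x : cov Gam id u ('D_v id) x = bil (Gam x) u v.
Proof. by rewrite derive_idf cov_id nab_cst. Qed.

Lemma koszul_id a b z x :
  gam_sym Gam x -> compat Gam G x -> (G x)^T = G x -> differentiable G x ->
  inner (G x) (bil (Gam x) a b) z =
  2^-1 * ('D_a (fun y => inner (G y) b z) x + 'D_b (fun y => inner (G y) a z) x
          - 'D_z (fun y => inner (G y) a b) x).
Proof.
move=> sG cG Gs dG.
have := @koszul _ id a b z x sG cG Gs dG (twice_diff_id x).
by rewrite !pullback_id cov_id_cst derive_id.
Qed.

Lemma brioschi_id u v x : gam_diff Gam x -> twice_diff G x ->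
  (\forall z \near x, [/\ gam_sym Gam z, compat Gam G z & (G z)^T = G z]) ->
  inner (G x) (riem Gam x u v v) u =
  'D_u ('D_v (fun y => inner (G y) u v)) x - 2^-1 * 'D_u ('D_u (fun y => inner (G y) v v)) x
    - 2^-1 * 'D_v ('D_v (fun y => inner (G y) u u)) x
    + inner (G x) (bil (Gam x) u v) (bil (Gam x) u v)
    - inner (G x) (bil (Gam x) u u) (bil (Gam x) v v).
Proof.
move=> dGam G2 nG.
have nid : \forall y \near x, twice_diff (id : 'rV[R]_m -> 'rV[R]_m) y.
  by apply: filterS nG => y _; exact: twice_diff_id.
have id2 w : twice_diff ('D_w (id : 'rV[R]_m -> 'rV[R]_m)) x.
  by rewrite derive_idf; exact: twice_diff_cst.
have := @brioschi _ _ _ Gam G id u v x dGam G2 nG nid id2.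
by rewrite !pullback_id !cov_id_cst !derive_id.
Qed.

End Koszul.

Lemma row_inner (R : realType) n (k d d' : 'M[R]_n) (w a b : 'rV[R]_n) :
  (forall z, inner k w z = 2^-1 * (inner d b z + inner d' a z)) ->
  w *m k = 2^-1 *: (b *m d + a *m d').
Proof.
move=> E; apply/rowP => i; have := E (delta_mx 0 i).
rewrite /inner trmx_delta -!colE !mxE => Ei.
by [].
Qed.

Lemma inner_half (R : realType) n (M : 'M[R]_n) p q :
  (forall p q, inner M p q = inner M q p) ->
  inner M (2^-1 *: (p + q)) (2^-1 *: (p + q)) =
  4^-1 * (inner M p p + inner M p q + inner M p q + inner M q q).
Proof. by move=> s; rewrite innerZl innerZr innerDl !innerDr (s q p); field. Qed.

Lemma inner_half2 (R : realType) n (M : 'M[R]_n) p q :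
  inner M (2^-1 *: (p + p)) (2^-1 *: (q + q)) = inner M p q.
Proof. by rewrite innerZl innerZr innerDl !innerDr; field. Qed.

Lemma inner_sqB (R : realType) n (M : 'M[R]_n) p q :
  (forall p q, inner M p q = inner M q p) ->
  inner M (p - q) (p - q) = inner M p p - inner M p q - inner M p q + inner M q q.
Proof. by move=> s; rewrite innerBl !innerBr (s q p); ring. Qed.

Section Gauss.
Context {R : realType} {n m : nat}.
Variables (Gam1 : 'rV[R]_n -> 'I_n -> 'I_n -> 'rV[R]_n) (G1 : 'rV[R]_n -> 'M[R]_n).
Variables (Gam2 : 'rV[R]_m -> 'I_m -> 'I_m -> 'rV[R]_m) (G2 : 'rV[R]_m -> 'M[R]_m).
Variables (f : 'rV[R]_n -> 'rV[R]_m) (K : 'rV[R]_n -> 'M[R]_n) (x : 'rV[R]_n).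
Implicit Types (u v w z a b : 'rV[R]_n).

(** A Riemannian map in coordinates around [x]. The rank and the horizontal spaces do not appear:
    [rm_K] and [rm_idem] encode the isometry at all points near [x]. *)
Record riem_map_at : Prop := RiemMapAt {
  rm_gam1 : gam_diff Gam1 x;
  rm_G1 : twice_diff G1 x;
  rm_near1 : \forall y \near x, [/\ gam_sym Gam1 y, compat Gam1 G1 y & (G1 y)^T = G1 y];
  rm_unit1 : \forall y \near x, G1 y \in unitmx;
  rm_pos1 : forall u, 0 <= inner (G1 x) u u;
  rm_gam2 : gam_diff Gam2 (f x);
  rm_G2 : twice_diff G2 (f x);
  rm_near2 : \forall y \near f x, [/\ gam_sym Gam2 y, compat Gam2 G2 y & (G2 y)^T = G2 y];
  rm_pos2 : forall p : 'rV[R]_m, p != 0 -> 0 < inner (G2 (f x)) p p;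
  rm_f : \forall y \near x, twice_diff f y;
  rm_Df : forall w, twice_diff ('D_w f) x;
  rm_K2 : twice_diff K x;
  rm_K : \forall y \near x, forall u v,
    inner (K y) u v = inner (G1 y) u v - pullback G2 f u v y;
  rm_idem : \forall y \near x, K y *m invmx (G1 y) *m K y = K y }.

Hypothesis H : riem_map_at.

Local Notation N := (fun y => invmx (G1 y)).
Local Notation g2 := (inner (G2 (f x))).
Local Notation Gm := (bil (Gam1 x)).

Definition second_form a b := cov Gam2 f a ('D_b f) x - 'D_(Gm a b) f x.

Lemma pullback_sym y u v : (G2 (f y))^T = G2 (f y) -> pullback G2 f u v y = pullback G2 f v u y.
Proof. by move=> Gs; rewrite /pullback inner_sym. Qed.

Lemma near_f (Q : 'rV[R]_m -> Prop) : (\forall z \near f x, Q z) -> \forall y \near x, Q (f y).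
Proof.
have dfx := twice_diffW (nbhs_singleton (rm_f H)).
by move=> nQ; exact: (differentiable_continuous dfx nQ).
Qed.

Lemma rm_Ks : \forall y \near x, (K y)^T = K y.
Proof.
apply: filterS3 (rm_K H) (rm_near1 H) (near_f (rm_near2 H)) => y KE [_ _ s1] [_ _ s2].
apply: inner_mx => u v; rewrite inner_trmx !KE (inner_sym v u s1).
by rewrite (pullback_sym u v s2).
Qed.

Lemma rm_N2 : twice_diff N x.
Proof. exact: twice_diff_invmx (rm_unit1 H) (rm_G1 H). Qed.

Lemma derive_inner_cst (A : 'rV[R]_n -> 'M[R]_n) y a u v : differentiable A y ->
  'D_a (fun y => inner (A y) u v) y = inner ('D_a A y) u v.
Proof.
move=> dA; have dc w : differentiable (cst w : 'rV[R]_n -> 'rV[R]_n) y by exact: differentiable_cst.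
apply: (etrans (derive_inner a dA (dc u) (dc v))).
by rewrite !derive_cst inner0l inner0r !addr0.
Qed.

Lemma derive2_inner_cst (A : 'rV[R]_n -> 'M[R]_n) a b u v : twice_diff A x ->
  'D_a ('D_b (fun y => inner (A y) u v)) x = inner ('D_a ('D_b A) x) u v.
Proof.
move=> A2; have [nA dA] := A2.
rewrite -derive_inner_cst //; apply: near_eq_derive.
by apply: filterS nA => y dAy; exact: derive_inner_cst.
Qed.

Lemma pullbackE u v : {near x, pullback G2 f u v =1
  fun y => inner (G1 y) u v - inner (K y) u v}.
Proof. by apply: filterS (rm_K H) => y ->; rewrite opprB addrC subrK. Qed.

Lemma twice_diff_inner_cst (A : 'rV[R]_n -> 'M[R]_n) u v : twice_diff A x ->
  twice_diff (fun y => inner (A y) u v) x.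
Proof. by move=> A2; apply: twice_diff_inner => //; exact: twice_diff_cst. Qed.

Lemma derive_pullback a u v : 'D_a (pullback G2 f u v) x =
  'D_a (fun y => inner (G1 y) u v) x - inner ('D_a K x) u v.
Proof.
have d1 := twice_diffW (twice_diff_inner_cst u v (rm_G1 H)).
have d2 := twice_diffW (twice_diff_inner_cst u v (rm_K2 H)).
rewrite (near_eq_derive a (pullbackE u v)).
apply: (etrans (@deriveB _ _ _ _ _ x a (diff_derivable d1) (diff_derivable d2))).
by congr (_ - _); apply: derive_inner_cst; exact: twice_diffW (rm_K2 H).
Qed.

Lemma derive2_pullback a b u v : 'D_a ('D_b (pullback G2 f u v)) x =
  'D_a ('D_b (fun y => inner (G1 y) u v)) x - inner ('D_a ('D_b K) x) u v.
Proof.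
have [n1 d1] := twice_diff_inner_cst u v (rm_G1 H).
have [n2 d2] := twice_diff_inner_cst u v (rm_K2 H).
have E : {near x, 'D_b (pullback G2 f u v) =1 fun y =>
    'D_b (fun y => inner (G1 y) u v) y - 'D_b (fun y => inner (K y) u v) y}.
  apply: filterS3 (near_near (pullbackE u v)) n1 n2 => y Ey e1 e2.
  rewrite (near_eq_derive b Ey).
  exact: (@deriveB _ _ _ _ _ y b (diff_derivable e1) (diff_derivable e2)).
rewrite (near_eq_derive a E).
apply: (etrans (@deriveB _ _ _ _ _ x a (diff_derivable (d1 b)) (diff_derivable (d2 b)))).
by congr (_ - _); apply: derive2_inner_cst; exact: rm_K2.
Qed.

Local Notation k1 a u v := (inner ('D_a K x) u v).
Local Notation kk := (inner (K x)).
Local Notation hor u := (u *m K x = 0).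

Let fx2 : twice_diff f x := nbhs_singleton (rm_f H).
Let dfx : differentiable f x := twice_diffW fx2.
Let K2 := rm_K2 H.

Lemma second_form_arith (L A d1 d2 d3 g1 g2 g3 k1 k2 k3 : R) :
  L = 2^-1 * (d1 + d2 - d3) -> d1 = g1 - k1 -> d2 = g2 - k2 -> d3 = g3 - k3 ->
  A = 2^-1 * (g1 + g2 - g3) -> L = A - 2^-1 * (k1 + k2 - k3).
Proof. by move=> *; lra. Qed.

Lemma second_form_arith' (L C D A k c : R) : L = C - D -> C = A - c -> k = A - D -> L = k - c.
Proof. by move=> *; lra. Qed.

(** The Koszul formula for [f] minus the one for the identity: the two metrics differ by [K]. *)
Lemma second_form_range a b z :
  g2 (second_form a b) ('D_z f x) = kk (Gm a b) z - 2^-1 * (k1 a b z + k1 b a z - k1 z a b).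
Proof.
have [s1 c1 t1] := nbhs_singleton (rm_near1 H); have [s2 c2 t2] := nbhs_singleton (rm_near2 H).
have E1 := koszul a b z s2 c2 t2 (twice_diffW (rm_G2 H)) fx2.
have E2 := koszul_id a b z s1 c1 t1 (twice_diffW (rm_G1 H)).
have E3 := second_form_arith E1 (derive_pullback a b z) (derive_pullback b a z)
  (derive_pullback z a b) E2.
have E4 := nbhs_singleton (rm_K H) (Gm a b) z.
exact: (second_form_arith' (innerBl (G2 (f x)) _ _ ('D_z f x)) E3 E4).
Qed.

Lemma inner_hor u w : hor w -> kk u w = 0.
Proof.
move=> wK; rewrite (inner_sym _ _ (nbhs_singleton rm_Ks)).
by rewrite /inner wK mul0mx mxE.
Qed.

(* For self-adjoint K with K g1^-1 K = K, this is the g1-orthogonal projection of [z] onto the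
   kernel of F_*. *)
Definition vpart z := z *m (K x *m invmx (G1 x)).

Lemma vpart_K z : vpart z *m K x = z *m K x.
Proof. by rewrite /vpart -mulmxA (nbhs_singleton (rm_idem H)). Qed.

Lemma vpart_G z : vpart z *m G1 x = z *m K x.
Proof. by rewrite /vpart -!mulmxA mulVmx ?mulmx1 //; exact: nbhs_singleton (rm_unit1 H). Qed.

Lemma hpart_hor z : hor (z - vpart z).
Proof. by rewrite mulmxBl vpart_K subrr. Qed.

(** On [vpart z] the forms G1 and [K] agree, so its image has length 0 and vanishes by
    positivity. *)
Lemma derive_vpart z : 'D_(vpart z) f x = 0.
Proof.
apply/eqP/negPn/negP => /(rm_pos2 H).
have := nbhs_singleton (rm_K H) (vpart z) (vpart z).
rewrite /pullback /inner vpart_K vpart_G => /eqP.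
by rewrite eq_sym subr_eq addrC -subr_eq subrr eq_sym => /eqP ->; rewrite ltxx.
Qed.

Lemma derive_hor u v w : hor v -> hor w -> k1 u v w = 0.
Proof. exact: derive_ker K2 rm_N2 (rm_idem H) rm_Ks u v w. Qed.

(** Subtracting [vpart z] leaves 'D_z f unchanged, so [z] may be taken horizontal; then every term
    of [second_form_range] vanishes. *)
Lemma second_form_normal a b z : hor a -> hor b -> g2 (second_form a b) ('D_z f x) = 0.
Proof.
move=> ha hb; rewrite -(subrK (vpart z) z) (deriveDr _ _ dfx) derive_vpart addr0.
have hz := hpart_hor z; rewrite second_form_range (inner_hor _ hz).
by rewrite !derive_hor // !addr0 subr0 mulr0 subr0.
Qed.

(** Now [second_form_range] is zero for every [z]; read as an equation for [Gm a b], it gives the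
    vertical part of nabla_a b through first derivatives of [K]. *)
Lemma Gm_K a b : hor a -> hor b ->
  Gm a b *m K x = 2^-1 *: (b *m 'D_a K x + a *m 'D_b K x).
Proof.
move=> ha hb; apply: row_inner => z.
have := second_form_range a b z; rewrite (second_form_normal z ha hb) (derive_hor z ha hb) subr0.
by move/esym/subr0_eq.
Qed.

Local Notation nn := (inner (invmx (G1 x))).

Lemma nn_sym p q : nn p q = nn q p.
Proof.
have [_ _ t1] := nbhs_singleton (rm_near1 H).
by apply: inner_sym; rewrite trmx_inv t1.
Qed.

Lemma nn_ge0 p : 0 <= nn p p.
Proof.
have uG := nbhs_singleton (rm_unit1 H); have [_ _ t1] := nbhs_singleton (rm_near1 H).
have := rm_pos1 H (p *m invmx (G1 x)).
by rewrite /inner trmx_mul trmx_inv t1 !mulmxA mulmxKV.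
Qed.

Lemma kk_nn p q : kk p q = nn (p *m K x) (q *m K x).
Proof.
rewrite /inner trmx_mul (nbhs_singleton rm_Ks) !mulmxA -[in LHS](nbhs_singleton (rm_idem H)).
by rewrite !mulmxA.
Qed.

(** A covariant derivative is a normal second form plus the image of [Gm a b]; the product of two
    images is measured by the pulled back metric G1 - K. *)
Lemma cov_second_form a b a' b' : hor a -> hor b -> hor a' -> hor b' ->
  g2 (cov Gam2 f a ('D_b f) x) (cov Gam2 f a' ('D_b' f) x) =
  g2 (second_form a b) (second_form a' b') +
  (inner (G1 x) (Gm a b) (Gm a' b') - kk (Gm a b) (Gm a' b')).
Proof.
move=> ha hb ha' hb'; have [_ _ t2] := nbhs_singleton (rm_near2 H).
have E c d : cov Gam2 f c ('D_d f) x = second_form c d + 'D_(Gm c d) f x.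
  by rewrite /second_form subrK.
have E1 := second_form_normal (Gm a' b') ha hb.
have E2 := second_form_normal (Gm a b) ha' hb'.
have E3 := nbhs_singleton (rm_K H) (Gm a b) (Gm a' b'); rewrite /pullback in E3.
rewrite (E a b) (E a' b') E3 subKr.
move: (second_form a b) (second_form a' b') ('D_(Gm a b) f x) ('D_(Gm a' b') f x) E1 E2.
move=> B B' D D' E1 E2; rewrite innerDl !innerDr E1 addr0.
by rewrite (inner_sym D B' t2) E2 add0r.
Qed.

(* [on] is O'Neill's term, which the Gauss equation for submanifolds does not have: up to a
   factor, the squared norm of the vertical part of the bracket of horizontal extensions of
   [u] and [v]. *)
Lemma gauss_arith (R1 R2 A B C a b d BB B1 g g' pp qq pq uv on : R) :
  R1 = A - 2^-1 * B - 2^-1 * C + g - g' ->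
  R2 = (A - a) - 2^-1 * (B - b) - 2^-1 * (C - d) + (BB + (g - 4^-1 * (pp + pq + pq + qq)))
       - (B1 + (g' - uv)) ->
  a = pq + uv -> b = pp + pp -> d = qq + qq -> on = pp - pq - pq + qq -> 0 <= on ->
  R1 <= R2 + B1 - BB.
Proof. by move=> *; lra. Qed.

Lemma pullback_arith (R2 da db dc A B C k1 k2 k3 X Y X' Y' : R) :
  R2 = da - 2^-1 * db - 2^-1 * dc + X - Y ->
  da = A - k1 -> db = B - k2 -> dc = C - k3 -> X = X' -> Y = Y' ->
  R2 = (A - k1) - 2^-1 * (B - k2) - 2^-1 * (C - k3) + X' - Y'.
Proof. by move=> -> -> -> -> -> ->. Qed.

Lemma gauss_inequality u v : hor u -> hor v ->
  inner (G1 x) (riem Gam1 x u v v) u <=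
  g2 (riem Gam2 (f x) ('D_u f x) ('D_v f x) ('D_v f x)) ('D_u f x)
  + g2 (second_form u u) (second_form v v) - g2 (second_form u v) (second_form u v).
Proof.
move=> hu hv.
have E1 := brioschi_id u v (rm_gam1 H) (rm_G1 H) (rm_near1 H).
have E2 := brioschi u v (rm_gam2 H) (rm_G2 H) (rm_near2 H) (rm_f H) (rm_Df H).
have d2 a b p q := derive2_ker K2 rm_N2 (rm_idem H) rm_Ks a b (v := p) (w := q).
pose P := v *m 'D_u K x; pose Q := u *m 'D_v K x.
pose U := u *m 'D_u K x; pose V := v *m 'D_v K x.
have kuv := etrans (kk_nn (Gm u v) (Gm u v))
  (etrans (congr2 (fun p q => nn p q) (Gm_K hu hv) (Gm_K hu hv)) (inner_half P Q nn_sym)).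
have kuuvv := etrans (kk_nn (Gm u u) (Gm v v))
  (etrans (congr2 (fun p q => nn p q) (Gm_K hu hu) (Gm_K hv hv)) (inner_half2 _ U V)).
have c1 := cov_second_form hu hv hu hv; have c2 := cov_second_form hu hu hv hv.
rewrite kuv in c1; rewrite kuuvv in c2.
have {}E2 := pullback_arith E2 (derive2_pullback u v u v) (derive2_pullback u u v v)
  (derive2_pullback v v u u) c1 c2.
(* The terms in [K] add up to 3/4 of the squared norm of P - Q; those in [U] and [V] cancel. *)
have n0 := nn_ge0 (P - Q).
have nE := inner_sqB P Q nn_sym.
have e1 := etrans (d2 u v u v hu hv) (congr1 (fun c => c + nn U V) (nn_sym Q P)).
exact: (gauss_arith E1 E2 e1 (d2 u u v v hv hv) (d2 v v u u hu hu) nE n0).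
Qed.

End Gauss.

(** * Orthonormal frames and Casorati curvatures *)

Section Sums.
Context {R : realType}.

Lemma sum_cauchy_schwarz k (c x : 'I_k -> R) :
  (\sum_i c i * x i) ^+ 2 <= (\sum_i c i ^+ 2) * (\sum_i x i ^+ 2).
Proof.
rewrite -subr_ge0 -(pmulr_rge0 _ (@ltr0n R 2)).
suff -> : 2%:R * ((\sum_i c i ^+ 2) * (\sum_i x i ^+ 2) - (\sum_i c i * x i) ^+ 2) =
    \sum_i \sum_j (c i * x j - c j * x i) ^+ 2.
  by do 2![apply: sumr_ge0 => ? _]; exact: sqr_ge0.
pose a i j := c i ^+ 2 * x j ^+ 2; pose b i j := c i * x i * (c j * x j).
have sa : (\sum_i c i ^+ 2) * (\sum_i x i ^+ 2) = \sum_i \sum_j a i j.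
  by rewrite mulr_suml; apply: eq_bigr => i _; rewrite mulr_sumr.
have sa' : \sum_i \sum_j a i j = \sum_i \sum_j a j i by rewrite exchange_big.
have sb : (\sum_i c i * x i) ^+ 2 = \sum_i \sum_j b i j.
  by rewrite expr2 mulr_suml; apply: eq_bigr => i _; rewrite mulr_sumr.
have -> : \sum_i \sum_j (c i * x j - c j * x i) ^+ 2 =
    \sum_i \sum_j a i j + \sum_i \sum_j a j i - 2 * \sum_i \sum_j b i j.
  rewrite mulr_sumr -big_split -sumrB; apply: eq_bigr => i _ /=.
  rewrite mulr_sumr -big_split -sumrB; apply: eq_bigr => j _ /=.
  by rewrite /a /b; ring.
by rewrite sa sb -sa'; ring.
Qed.

Lemma sum_sq_le k (x : 'I_k -> R) : (\sum_i x i) ^+ 2 <= k%:R * \sum_i x i ^+ 2.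
Proof.
have := sum_cauchy_schwarz (fun=> 1) x.
under eq_bigr do rewrite mul1r; under [X in _ <= X * _]eq_bigr do rewrite expr1n.
by rewrite sumr_const card_ord.
Qed.

Lemma sum_const k (y : R) : \sum_(i < k) y = k%:R * y.
Proof. by rewrite sumr_const card_ord mulr_natl. Qed.

(** The squares on the left absorb the cross term of the squared trace, and what remains is
    [sum_sq_le]. They measure the distance from the shape y = 2 x_i. *)
Lemma trace_sq_le k (x : 'I_k -> R) y :
  (\sum_i x i + y) ^+ 2 + 2^-1 * \sum_i (2 * x i - y) ^+ 2 <=
  (k%:R + 2) * \sum_i x i ^+ 2 + (k%:R + 2) / 2 * y ^+ 2.
Proof.
have := sum_sq_le x.
have -> : \sum_i (2 * x i - y) ^+ 2 =
    4 * (\sum_i x i ^+ 2) - 4 * y * (\sum_i x i) + k%:R * y ^+ 2.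
  rewrite -(sum_const k) !mulr_sumr -sumrB -big_split /=.
  by apply: eq_bigr => i _; ring.
lra.
Qed.

(** The same cancellation; here the squares vanish for the shape x_i = 2 y. *)
Lemma trace_sq_le_hat k (x : 'I_k -> R) y :
  (\sum_i x i + y) ^+ 2 + 2^-1 * \sum_i (x i - 2 * y) ^+ 2 <=
  (2 * k%:R + 1) * (2^-1 * \sum_i x i ^+ 2 + y ^+ 2).
Proof.
have := sum_sq_le x.
have -> : \sum_i (x i - 2 * y) ^+ 2 =
    (\sum_i x i ^+ 2) - 4 * y * (\sum_i x i) + k%:R * (4 * y ^+ 2).
  rewrite -(sum_const k) !mulr_sumr -sumrB -big_split /=.
  by apply: eq_bigr => i _; ring.
lra.
Qed.

End Sums.

Section Orthonormal.
Context {R : realType}.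

Definition frob k l (M : 'M[R]_(k, l)) : R := \sum_a \sum_b M a b ^+ 2.

Lemma frobE k l (M : 'M[R]_(k, l)) : frob M = \tr (M *m M^T).
Proof.
apply: eq_bigr => a _; rewrite mxE; apply: eq_bigr => b _.
by rewrite mxE expr2.
Qed.

Lemma dot_gt0 k (u : 'rV[R]_k) : u != 0 -> 0 < (u *m u^T) 0 0.
Proof.
move=> u0; rewrite mxE lt_def; apply/andP; split; last first.
  by apply: sumr_ge0 => i _; rewrite mxE -expr2 sqr_ge0.
apply: contra u0; rewrite psumr_eq0; last by move=> i _; rewrite mxE -expr2 sqr_ge0.
move=> /allP u0; apply/eqP/rowP => i; have := u0 i (mem_index_enum _).
by rewrite !mxE mulf_eq0 orbb => /eqP.
Qed.

Lemma normalize k (u : 'rV[R]_k) : u != 0 -> exists2 s : R, s != 0 & (s *: u) *m (s *: u)^T = 1%:M.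
Proof.
move=> u0; have d0 := dot_gt0 u0; set d := (_ *m _) 0 0 in d0.
exists (Num.sqrt d)^-1; first by rewrite invr_eq0 gt_eqF // sqrtr_gt0.
rewrite linearZ /= -scalemxAl -scalemxAr scalerA [_ *m _]mx11_scalar -/d.
rewrite -scalemx1 scalerA -expr2 exprVn sqr_sqrtr ?mulVf ?scale1r ?gt_eqF //.
exact: ltW.
Qed.

Lemma orthonormal_extend k (A : 'M[R]_(k, k + 1)) : A *m A^T = 1%:M ->
  exists a : 'rV[R]_(k + 1), a *m a^T = 1%:M /\ A *m a^T = 0.
Proof.
move=> AA; have rk : (\rank A^T <= k)%N by exact: rank_leq_col.
have : kermx A^T != 0.
  by rewrite -mxrank_eq0 mxrank_ker -lt0n subn_gt0 (leq_ltn_trans rk) // addn1.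
move=> /rowV0Pn[u /sub_kermxP uA u0]; have [s s0 us] := normalize u0.
exists (s *: u); split=> //.
by rewrite -[A]trmxK -trmx_mul -scalemxAl uA scaler0 trmx0.
Qed.

Lemma orthonormal_free d r (B : 'M[R]_(d, r)) : B *m B^T = 1%:M -> row_free B.
Proof. by move=> BB; apply/row_freeP; exists B^T. Qed.

Lemma gram_schmidt d r (A : 'M[R]_(d, r)) : row_free A ->
  exists B : 'M[R]_(d, r), B *m B^T = 1%:M /\ (B == A)%MS.
Proof.
elim: d A => [|d IH] A fA.
  by exists 0; split; [by rewrite [LHS]flatmx0 [RHS]flatmx0 | rewrite (flatmx0 A) submx_refl].
move: A fA; rewrite -[d.+1]addn1 => A; rewrite -[A]vsubmxK.
move: (usubmx A) (dsubmx A) => {A} A1 a fA.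
have rA : \rank (A1 + a)%MS = (d + 1)%N by rewrite addsmxE; apply/eqP.
have fA1 : row_free A1.
  rewrite /row_free eqn_leq rank_leq_row /= -(leq_add2r 1) -{1}rA.
  have [le1 _] := mxrank_adds_leqif A1 a.
  by rewrite (leq_trans le1) // leq_add2l rank_leq_row.
have [B1 [BB1 /andP[B1A A1B]]] := IH A1 fA1.
pose w := a - a *m B1^T *m B1.
have wB : w *m B1^T = 0 by rewrite mulmxBl -(mulmxA _ B1) BB1 mulmx1 subrr.
(* Otherwise the d + 1 independent rows would lie in the span of the d rows of [B1]. *)
have w0 : w != 0.
  apply/eqP => /subr0_eq aE; have aB : (a <= B1)%MS by rewrite aE submxMl.
  have : (A1 + a <= B1)%MS by rewrite addsmx_sub A1B.
  move=> /mxrankS; rewrite rA leqNgt addn1 ltnS rank_leq_row //.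
have [s s0 ww] := normalize w0.
pose B := col_mx B1 (s *: w).
have BB : B *m B^T = 1%:M.
  rewrite /B tr_col_mx mul_col_row BB1 ww linearZ /= -scalemxAl wB scaler0.
  by rewrite -scalemxAr -[B1]trmxK -trmx_mul wB trmx0 scaler0 -scalar_mx_block.
exists B; split=> //.
have A1le : (A1 <= A1 + a)%MS by exact: addsmxSl.
have BA : (B <= A1 + a)%MS.
  rewrite /B -addsmxE addsmx_sub (submx_trans B1A) //= scalemx_sub //.
  rewrite /w addmx_sub ?addsmxSr // -mulNmx mulmx_sub // (submx_trans B1A) //.
have := mxrank_leqif_eq BA => -[_]; rewrite rA.
have /eqP -> := orthonormal_free BB; rewrite eqxx => /esym/andP[_ AB].
by move: BA AB; rewrite !addsmxE => -> ->.
Qed.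

Lemma frob_orth k l (U : 'M[R]_(k, l)) (M : 'M[R]_l) : U^T *m U = 1%:M ->
  frob (U *m M *m U^T) = frob M.
Proof.
move=> UU; rewrite !frobE !trmx_mul trmxK -!mulmxA (mulmxA U^T U) UU mul1mx.
by rewrite mxtrace_mulC -!mulmxA UU mulmx1.
Qed.

Lemma frob_block k l (A : 'M[R]_k) (B : 'M[R]_(k, l)) (C : 'M[R]_(l, k)) (D : 'M[R]_l) :
  frob (block_mx A B C D) = frob A + frob B + (frob C + frob D).
Proof.
rewrite /frob big_split_ord /= -!big_split /=; congr (_ + _); apply: eq_bigr => a _.
  rewrite big_split_ord /=; congr (_ + _); apply: eq_bigr => b _.
    by rewrite block_mxEul.
  by rewrite block_mxEur.
rewrite big_split_ord /=; congr (_ + _); apply: eq_bigr => b _.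
  by rewrite block_mxEdl.
by rewrite block_mxEdr.
Qed.

Lemma frob_ge0 k l (A : 'M[R]_(k, l)) : 0 <= frob A.
Proof. by do 2![apply: sumr_ge0 => ? _]; exact: sqr_ge0. Qed.

Lemma frob_diag k (A : 'M[R]_k) : \sum_i A i i ^+ 2 <= frob A.
Proof.
apply: ler_sum => i _; rewrite (bigD1 i) //= lerDl.
by apply: sumr_ge0 => *; exact: sqr_ge0.
Qed.

(** In the orthonormal basis formed by the rows of [B1] and [B2], the matrix is block diagonal. *)
Lemma frob_slant d1 d2 r (B1 : 'M[R]_(d1, r)) (B2 : 'M[R]_(d2, r)) (M : 'M[R]_r) c1 c2 :
  (d1 + d2 = r)%N -> B1 *m B1^T = 1%:M -> B2 *m B2^T = 1%:M -> B1 *m B2^T = 0 ->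
  B1 *m M *m B2^T = 0 -> B2 *m M *m B1^T = 0 ->
  (forall a, \sum_b (B1 *m M *m B1^T) a b ^+ 2 = c1) ->
  (forall a, \sum_b (B2 *m M *m B2^T) a b ^+ 2 = c2) ->
  frob M = d1%:R * c1 + d2%:R * c2.
Proof.
move=> rE; case: _ / rE B1 B2 M => B1 B2 M BB1 BB2 B12 M12 M21 s1 s2.
pose U := col_mx B1 B2.
have UU : U *m U^T = 1%:M.
  rewrite /U tr_col_mx mul_col_row BB1 BB2 B12 -[B2 *m _]trmxK trmx_mul trmxK B12 trmx0.
  by rewrite -scalar_mx_block.
rewrite -(frob_orth M (mulmx1C UU)) /U mul_col_mx tr_col_mx mul_col_row M12 M21 frob_block.
have f0 k l : frob (0 : 'M[R]_(k, l)) = 0.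
  by apply: big1 => a _; apply: big1 => b _; rewrite mxE expr0n.
rewrite !f0 addr0 add0r /frob; congr (_ + _).
  by under eq_bigr do rewrite s1; exact: sum_const.
by under eq_bigr do rewrite s2; exact: sum_const.
Qed.

End Orthonormal.

Section CasoratiBounds.
Context {R : realType}.

(** [A] is a frame of a hyperplane and [a] its unit normal. The inequality drops the two mixed
    blocks of the matrix in the adapted basis. *)
Lemma adapted_trace k (A : 'M[R]_(k, k + 1)) (Z : 'M[R]_(k + 1)) (a : 'rV[R]_(k + 1)) :
  A *m A^T = 1%:M -> a *m a^T = 1%:M -> A *m a^T = 0 ->
  \tr Z = \sum_i (A *m Z *m A^T) i i + (a *m Z *m a^T) 0 0 /\
  frob (A *m Z *m A^T) + (a *m Z *m a^T) 0 0 ^+ 2 <= frob Z.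
Proof.
move=> AA aa Aa; pose U := col_mx A a.
have UU : U *m U^T = 1%:M.
  rewrite /U tr_col_mx mul_col_row AA aa Aa -[a *m A^T]trmxK trmx_mul trmxK Aa trmx0.
  by rewrite -scalar_mx_block.
have UU' := mulmx1C UU.
have E : U *m Z *m U^T = block_mx (A *m Z *m A^T) (A *m Z *m a^T) (a *m Z *m A^T) (a *m Z *m a^T).
  by rewrite /U mul_col_mx tr_col_mx mul_col_row.
split.
  rewrite -[LHS](_ : \tr (U *m Z *m U^T) = _); last by rewrite mxtrace_mulC mulmxA UU' mul1mx.
  by rewrite E mxtrace_block; congr (_ + _); rewrite /mxtrace big_ord1.
rewrite -(frob_orth Z UU') E frob_block; set D := a *m Z *m a^T.
have -> : frob D = D 0 0 ^+ 2 by rewrite /frob !big_ord1.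
have := frob_ge0 (A *m Z *m a^T); have := frob_ge0 (a *m Z *m A^T); lra.
Qed.

Variables (k q : nat) (Z : 'I_q -> 'M[R]_(k + 1)) (c : 'I_q -> R) (A : 'M[R]_(k, k + 1)).
Hypotheses (cc : \sum_al c al ^+ 2 <= 1) (cZ : \sum_al c al *: Z al = - 1%:M).
Hypothesis AA : A *m A^T = 1%:M.

(** For each i the c-combination of s x_i - t y is t - s, of absolute value 1, and [c] has norm at
    most 1; Cauchy-Schwarz bounds the sum of squares below by 1. *)
Lemma casorati_gap (x : 'I_q -> 'I_k -> R) (y : 'I_q -> R) (s t : R) :
  (forall i, \sum_al c al * x al i = -1) -> \sum_al c al * y al = -1 -> (s - t) ^+ 2 = 1 ->
  k%:R <= \sum_al \sum_i (s * x al i - t * y al) ^+ 2.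
Proof.
move=> cx cy st; rewrite exchange_big /= -[k in k%:R]card_ord -sumr_const.
apply: ler_sum => i _.
have := sum_cauchy_schwarz c (fun al => s * x al i - t * y al).
have -> : \sum_al c al * (s * x al i - t * y al) =
    s * (\sum_al c al * x al i) - t * (\sum_al c al * y al).
  by rewrite !mulr_sumr -sumrB; apply: eq_bigr => al _; ring.
rewrite cx cy (_ : s * -1 - t * -1 = t - s); last by ring.
rewrite -sqrrN opprB st => /le_trans; apply.
by rewrite ler_piMl //; apply: sumr_ge0 => *; exact: sqr_ge0.
Qed.

(** Each trace is split along the hyperplane and its normal. The remainders of [trace_sq_le] and
    [trace_sq_le_hat], summed over al, are at least k by [casorati_gap] with (s, t) = (2, 1) and (1,
    2). *)
Lemma casorati_bounds :
  \sum_al (\tr (Z al)) ^+ 2 + 2^-1 * k%:R <=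
    (k%:R + 2) / 2 * \sum_al frob (Z al) + (k%:R + 2) / 2 * \sum_al frob (A *m Z al *m A^T) /\
  \sum_al (\tr (Z al)) ^+ 2 + 2^-1 * k%:R <=
    (2 * k%:R + 1) * \sum_al frob (Z al) - (2 * k%:R + 1) / 2 * \sum_al frob (A *m Z al *m A^T).
Proof.
have [a [aa Aa]] := orthonormal_extend AA.
pose x al i := (A *m Z al *m A^T) i i; pose y al := (a *m Z al *m a^T) 0 0.
(* Since the combination is - I, every diagonal entry in any orthonormal frame combines to -1. *)
have sZ p l (P : 'M[R]_(p, k + 1)) (Q : 'M[R]_(k + 1, l)) i j :
    \sum_al c al * (P *m Z al *m Q) i j = - (P *m Q) i j.
  transitivity ((P *m (\sum_al c al *: Z al) *m Q) i j).
    rewrite mulmx_sumr mulmx_suml summxE; apply: eq_bigr => al _.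
    by rewrite -scalemxAr -scalemxAl [RHS]mxE.
  by rewrite cZ mulmxN mulmx1 mulNmx mxE.
have cx i : \sum_al c al * x al i = -1 by rewrite sZ AA mxE eqxx.
have cy : \sum_al c al * y al = -1 by rewrite sZ aa mxE eqxx.
have k0 : 0 <= k%:R :> R by exact: ler0n.
have trE al := adapted_trace (Z al) AA aa Aa.
split.
  have gap := casorati_gap (s := 2) (t := 1) cx cy _.
  have {}gap : k%:R <= \sum_al \sum_i (2 * x al i - y al) ^+ 2.
    by under eq_bigr do under eq_bigr do rewrite -(mul1r (y _)); apply: gap; ring.
  rewrite !mulr_sumr -big_split /=.
  have : \sum_al ((\tr (Z al)) ^+ 2 + 2^-1 * \sum_i (2 * x al i - y al) ^+ 2) <=
      \sum_al ((k%:R + 2) / 2 * frob (Z al) + (k%:R + 2) / 2 * frob (A *m Z al *m A^T)).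
    apply: ler_sum => al _; have [-> fZ] := trE al.
    have d : \sum_i x al i ^+ 2 <= _ := frob_diag (A *m Z al *m A^T).
    apply: le_trans (trace_sq_le (x al) (y al)) _.
    have k2 : 0 <= (k%:R + 2) / 2 :> R by lra.
    have := ler_wpM2l k2 d; have := ler_wpM2l k2 fZ; rewrite -/(y al); lra.
  by rewrite big_split /= -mulr_sumr; lra.
have gap := casorati_gap (s := 1) (t := 2) cx cy _.
have {}gap : k%:R <= \sum_al \sum_i (x al i - 2 * y al) ^+ 2.
  by under eq_bigr do under eq_bigr do rewrite -(mul1r (x _ _)); apply: gap; ring.
rewrite !mulr_sumr -sumrB /=.
have : \sum_al ((\tr (Z al)) ^+ 2 + 2^-1 * \sum_i (x al i - 2 * y al) ^+ 2) <=
    \sum_al ((2 * k%:R + 1) * frob (Z al) - (2 * k%:R + 1) / 2 * frob (A *m Z al *m A^T)).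
  apply: ler_sum => al _; have [-> fZ] := trE al.
  have d : \sum_i x al i ^+ 2 <= _ := frob_diag (A *m Z al *m A^T).
  apply: le_trans (trace_sq_le_hat (x al) (y al)) _.
  have k2 : 0 <= 2 * k%:R + 1 :> R by lra.
  have := ler_wpM2l k2 d; have := ler_wpM2l k2 fZ; rewrite -/(y al); lra.
by rewrite big_split /= -mulr_sumr; lra.
Qed.

End CasoratiBounds.

(** * Manifolds in charts *)

Section Projection.
Context {R : realType}.

Lemma pos_unitmx n (G : 'M[R]_n) : (forall u, u != 0 -> 0 < inner G u u) -> G \in unitmx.
Proof.
move=> Gpos; rewrite -row_free_unit -kermx_eq0; apply/eqP/row_matrixP => i; rewrite row0.
apply/eqP/negPn/negP => /Gpos.
by rewrite /inner -row_mul mulmx_ker row0 mul0mx mxE ltxx.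
Qed.

Lemma ocompl_inner n k (G : 'M[R]_n) (W : 'M[R]_(k, n)) u w :
  (u <= ocompl G W)%MS -> (w <= W)%MS -> inner G u w = 0.
Proof.
move=> /sub_kermxP uW /submxP[D ->].
by rewrite /inner trmx_mul -mulmxA (mulmxA G) (mulmxA u) uW mul0mx mxE.
Qed.

(** Positivity makes the intersection trivial, and the ranks then add up to at least n. *)
Lemma ocompl_decomp n k (G : 'M[R]_n) (W : 'M[R]_(k, n)) (u : 'rV[R]_n) :
  (forall u, u != 0 -> 0 < inner G u u) ->
  exists a b, [/\ (a <= W)%MS, (b <= ocompl G W)%MS & u = a + b].
Proof.
move=> Gpos; have cap0 : (W :&: ocompl G W)%MS = 0.
  apply/eqP/rowV0P => w; rewrite sub_capmx => /andP[wW wC].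
  apply/eqP/negPn/negP => /Gpos; by rewrite (ocompl_inner wC wW) ltxx.
have : (n <= \rank (W + ocompl G W)%MS)%N.
  have := mxrank_sum_cap W (ocompl G W); rewrite cap0 mxrank0 addn0 => ->.
  rewrite mxrank_ker addnBA ?rank_leq_row // addnC -addnBA ?leq_addr //.
  by rewrite -[X in (_ <= \rank X)%N]trmxK mxrank_tr (leq_trans (mxrankM_maxr _ _)).
rewrite col_leq_rank -sub1mx => full.
have /sub_addsmxP[[p q] /= E] : (u <= W + ocompl G W)%MS by rewrite -(mulmx1 u) mulmx_sub.
by exists (p *m W), (q *m ocompl G W); rewrite !submxMl.
Qed.

Section Isometry.
Variables (n m : nat) (G : 'M[R]_n) (J : 'M[R]_(n, m)) (G' : 'M[R]_m).
Hypothesis Gpos : forall u, u != 0 -> 0 < inner G u u.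
Hypothesis Gs : G^T = G.
Hypothesis iso : forall u v : 'rV[R]_n,
  (u <= ocompl G (kermx J))%MS -> (v <= ocompl G (kermx J))%MS ->
  inner G' (u *m J) (v *m J) = inner G u v.

Let Hm := J *m G' *m J^T.

(** Against a vector of the kernel both forms vanish on [b], against a horizontal one they agree by
    [iso]. *)
Lemma hor_mul (b : 'rV[R]_n) : (b <= ocompl G (kermx J))%MS -> b *m Hm = b *m G.
Proof.
move=> hb; apply/rowP => k.
have [a' [b' [ka' hb' E]]] := ocompl_decomp (kermx J) (delta_mx 0 k) Gpos.
have : inner Hm b (delta_mx 0 k) = inner G b (delta_mx 0 k).
  rewrite E !innerDr; congr (_ + _).
    have /sub_kermxP aJ := ka'; rewrite (ocompl_inner hb ka').
    by rewrite /inner /Hm -!mulmxA -trmx_mul aJ trmx0 !mulmx0 mxE.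
  by rewrite -(iso hb hb') /inner /Hm trmx_mul !mulmxA.
by rewrite /inner trmx_delta -!colE !mxE.
Qed.

Lemma hor_defect (b : 'rV[R]_n) : (b <= ocompl G (kermx J))%MS -> b *m (G - Hm) = 0.
Proof. by move=> hb; rewrite mulmxBr hor_mul ?subrr. Qed.

(** [Hm *m invmx G] is the orthogonal projection onto the horizontal space: zero on the kernel of
    [J], the identity on horizontal vectors. The claim is the idempotence of the complementary
    projection. *)
Lemma defect_idem : (G - Hm) *m invmx G *m (G - Hm) = G - Hm.
Proof.
have uG := pos_unitmx Gpos.
suff HNH : Hm *m invmx G *m Hm = Hm.
  by rewrite mulmxBl mulmxV // mulmxBl mul1mx mulmxBr HNH mulmxKV // subrr subr0.
apply/row_matrixP => k; rewrite !rowE (mulmxA _ (Hm *m invmx G)) (mulmxA _ Hm).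
have [a [b [ka hb ->]]] := ocompl_decomp (kermx J) (delta_mx 0 k) Gpos.
have /sub_kermxP aJ := ka.
have aH : a *m Hm = 0 by rewrite /Hm !mulmxA aJ !mul0mx.
rewrite !mulmxDl aH !mul0mx !add0r (hor_mul hb).
by rewrite mulmxK // hor_mul.
Qed.

End Isometry.
End Projection.

Section Charts.
Context {R : realType}.

Lemma img_open n (M : @manifold R n) (i : chart_index M) : open (img i).
Proof. exact: (@chart_map_open _ _ _ (atlas i)). Qed.

Lemma curvE n (M : @manifold R n) (D : connection M) (i : chart_index M) x u v w :
  curv D i x u v w = riem (gam D i) x u v w.
Proof.
rewrite /curv /curvature /nabla /cst /bracket.
have E a b : (fun y : 'rV[R]_n => 'D_a (fun=> b) y + bil (gam D i y) a b) =
    fun y => bil (gam D i y) a b.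
  by apply/funext => y; rewrite derive_cst add0r.
rewrite !E !derive_cst subrr !add0r bil0l subr0 /riem.
by rewrite opprD addrACA addrA.
Qed.

Lemma gam_diff_img n (M : @manifold R n) (D : connection M) (i : chart_index M) x :
  img i x -> gam_diff (gam D i) x.
Proof. by move=> ix a b; have := gam_smooth D (i := i) a b [::] ix. Qed.

Lemma levi_civita_sym n (M : @manifold R n) (g : riem_metric M) (D : connection M)
    (i : chart_index M) x :
  levi_civita g D -> img i x -> gam_sym (gam D i) x.
Proof.
have sc (u : 'rV[R]_n) : smooth_on (img i) (cst u) by exact: smooth_on_cst.
move=> LC ix a b.
have [+ _] := LC i (cst a) (cst b) (cst a) (sc _) (sc _) (sc _) x ix.
by rewrite /nabla /bracket /cst !derive_cst !add0r oppr0 => /subr0_eq.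
Qed.

Lemma levi_civita_compat n (M : @manifold R n) (g : riem_metric M) (D : connection M)
    (i : chart_index M) x :
  levi_civita g D -> img i x -> compat (gam D i) (g i) x.
Proof.
have sc (u : 'rV[R]_n) : smooth_on (img i) (cst u) by exact: smooth_on_cst.
move=> LC ix a v w.
have [_ +] := LC i (cst a) (cst v) (cst w) (sc _) (sc _) (sc _) x ix.
rewrite /nabla /cst !derive_cst !add0r => <-.
by rewrite derive_inner_cst //; exact: (gmat_smooth g [::] ix).
Qed.


Lemma kenmotsu_at_img m (M : @manifold R m) (g : riem_metric M) (S : almost_contact_metric g)
    (D : connection M) c (i : chart_index M) x :
  kenmotsu_space_form S D c -> img i x ->
  kenmotsu_at (gam D i) (g i) (psi S i) (xi S i) x c.
Proof.
move=> [[LC Ken] hol] ix; have oi : open (img i) by exact: img_open.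
have nI : \forall y \near x, img i y by exact: open_nbhs_nbhs.
have sc (u : 'rV[R]_m) : smooth_on (img i) (cst u) by exact: smooth_on_cst.
split.
- exact: gam_diff_img.
- by apply: filterS nI => y iy; exact: (levi_civita_sym LC iy).
- by apply: filterS nI => y iy; exact: (levi_civita_compat LC iy).
- exact: (smooth_on_twice_diff oi (@gmat_smooth _ _ _ g i)).
- exact: (smooth_on_twice_diff oi (@psi_smooth _ _ _ _ S i)).
- exact: (smooth_on_twice_diff oi (@xi_smooth _ _ _ _ S i)).
- exact: gmat_sym.
- by move=> u v; exact: psi_skew.
- by move=> u; rewrite -(eta_metric S u ix) (psi_psi S u ix).
- by move=> u; rewrite -(eta_metric S _ ix) (eta_psi S u ix).
- by move=> u; exact: gmat_pos.
- by move=> u uu ux; rewrite -curvE; exact: hol.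
- apply: filterS nI => y iy u; rewrite -(eta_metric S u iy).
  by have [_ +] := Ken i (cst u) (cst u) (sc u) (sc u) y iy.
- apply: filterS nI => y iy u w; rewrite -(eta_metric S w iy).
  have [+ _] := Ken i (cst u) (cst w) (sc u) (sc w) y iy.
  rewrite /nabla /cst derive_cst add0r => <-.
  by [].
Qed.

Section Map.
Context {n m : nat} {M1 : @manifold R n} {M2 : @manifold R m}.
Variables (F : M1 -> M2) (i : chart_index M1) (j : chart_index M2).

Lemma charts_of_rep_dom y : rep_dom F i j y ->
  [/\ charts_at F (chart_inv (atlas i) y) i j, x_ (chart_inv (atlas i) y) i = y &
      y_ F (chart_inv (atlas i) y) j = rep F i j y].
Proof.
move=> [q [qi qj] <-]; have qK : chart_inv (atlas i) (chart_map (atlas i) q) = q.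
  by apply: (@chart_mapK _ _ _ (atlas i)); rewrite inE.
by rewrite qK; split=> //; rewrite /y_ /rep /= qK.
Qed.

Lemma rep_dom_img y : rep_dom F i j y -> img i y /\ img j (rep F i j y).
Proof.
move=> /charts_of_rep_dom[[ci cj] xE yE]; split.
  by exists (chart_inv (atlas i) y).
by exists (F (chart_inv (atlas i) y)).
Qed.

Lemma charts_rep_dom p : charts_at F p i j -> rep_dom F i j (x_ p i).
Proof. by move=> [pi pj]; exists p. Qed.

Lemma rep_x p : charts_at F p i j -> rep F i j (x_ p i) = y_ F p j.
Proof.
move=> [pi _]; rewrite /rep /= /x_ (@chart_mapK _ _ _ (atlas i)) //.
by rewrite inE.
Qed.

Lemma rep_dom_open : continuous F -> open (rep_dom F i j).
Proof.
move=> cF; rewrite openE => y [q [qi qj] qy].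
have iy : img i y by exists q.
have nI : \forall z \near y, img i z by apply: open_nbhs_nbhs; split=> //; exact: img_open.
have qK : chart_inv (atlas i) y = q.
  by rewrite -qy (@chart_mapK _ _ _ (atlas i)) // inE.
have ci : {for y, continuous (chart_inv (atlas i))}.
  by apply: (@chart_inv_cont _ _ _ (atlas i)); rewrite inE.
have nO : nbhs (chart_inv (atlas i) y) (cdom (atlas i) `&` F @^-1` cdom (atlas j)).
  rewrite qK; apply: open_nbhs_nbhs; split=> //; apply: openI.
    exact: (@cdom_open _ _ _ (atlas i)).
  by apply: open_comp => [z _|]; [exact: cF | exact: (@cdom_open _ _ _ (atlas j))].
apply: filterS2 nI (ci _ nO) => z [q' q'i q'z] /=.
rewrite -q'z (@chart_mapK _ _ _ (atlas i)) ?inE // => O.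
by exists q'.
Qed.

Variables (g1 : riem_metric M1) (g2 : riem_metric M2) (D1 : connection M1) (D2 : connection M2).

Definition defect (y : 'rV[R]_n) : 'M[R]_n :=
  g1 i y - 'J (rep F i j) y *m g2 j (rep F i j y) *m ('J (rep F i j) y)^T.

Lemma twice_diff_jacobian k l (f : 'rV[R]_k -> 'rV[R]_l) x :
  (\forall y \near x, differentiable f y) -> (forall u, twice_diff ('D_u f) x) ->
  twice_diff (jacobian f) x.
Proof.
move=> nf f2; apply/twice_diff_mxP => a b.
have /twice_diff_mxP/(_ 0 b) := f2 (delta_mx 0 a); apply: twice_diff_near_eq.
by apply: filterS nf => y fy; rewrite deriveEjacobian // -rowE mxE.
Qed.

Lemma riem_map_at_chart r p : levi_civita g1 D1 -> levi_civita g2 D2 ->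
  riemannian_map g1 g2 F r -> charts_at F p i j ->
  riem_map_at (gam D1 i) (g1 i) (gam D2 j) (g2 j) (rep F i j) defect (x_ p i).
Proof.
move=> LC1 LC2 [[cF sF] _ _ iso] hij.
have dx := charts_rep_dom hij; have od := rep_dom_open cF.
have nd : \forall y \near x_ p i, rep_dom F i j y by exact: open_nbhs_nbhs.
have [ix jx] := rep_dom_img dx.
have nj : \forall z \near rep F i j (x_ p i), img j z.
  by apply: open_nbhs_nbhs; split=> //; exact: img_open.
have f2 : \forall y \near x_ p i, twice_diff (rep F i j) y.
  by apply: filterS nd => y; exact: (smooth_on_twice_diff od).
have Df2 w : twice_diff ('D_w (rep F i j)) (x_ p i).
  exact: (smooth_on_twice_diff_derive w od (sF i j) dx).
have G1 y : img i y -> twice_diff (g1 i) y.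
  by apply: smooth_on_twice_diff; [exact: img_open | exact: gmat_smooth].
have G2 y : img j y -> twice_diff (g2 j) y.
  by apply: smooth_on_twice_diff; [exact: img_open | exact: gmat_smooth].
have ndf : \forall y \near x_ p i, differentiable (rep F i j) y.
  by apply: filterS f2 => y; exact: twice_diffW.
split.
- exact: gam_diff_img.
- exact: G1.
- apply: filterS nd => y /rep_dom_img[iy _].
  by split; [exact: levi_civita_sym LC1 iy | exact: levi_civita_compat | exact: gmat_sym].
- by apply: filterS nd => y /rep_dom_img[iy _]; apply: pos_unitmx => u; exact: gmat_pos.
- by move=> u; have [->|u0] := eqVneq u 0; [rewrite inner0l | exact/ltW/gmat_pos].
- exact: gam_diff_img.
- exact: G2.
- apply: filterS nj => y jy.
  by split; [exact: levi_civita_sym LC2 jy | exact: levi_civita_compat | exact: gmat_sym].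
- by move=> u; exact: gmat_pos.
- exact: f2.
- exact: Df2.
- have J2 := twice_diff_jacobian ndf Df2.
  have Gf2 := twice_diff_comp (nbhs_singleton f2) (G2 _ jx).
  apply: twice_diffB (G1 _ ix) _.
  by apply: twice_diff_mulmx (twice_diff_trmx J2); exact: twice_diff_mulmx.
- apply: filterS ndf => y fy u v.
  rewrite /pullback !deriveEjacobian // /inner /defect mulmxBr mulmxBl [LHS]mxE.
  by rewrite [X in _ + X]mxE trmx_mul !mulmxA.
(* The isometry is given at points of the manifold, and [rm_idem] wants it at every coordinate y
   near the base point: it is applied at the point with coordinate y. *)
- apply: filterS nd => y dy; have [iy _] := rep_dom_img dy.
  have [ch xE yE] := charts_of_rep_dom dy.
  apply: defect_idem; first by move=> u; exact: gmat_pos.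
  move=> u v hu hv; have := iso _ _ _ u v ch.
  by rewrite /horizontal_space /dF xE yE; exact.
Qed.

End Map.

End Charts.

Lemma xi_arith (R : comNzRingType) (d p q q' o l : R) :
  d = p + q -> d = 0 -> o = 0 -> q = q' -> l = p - o -> l = - q'.
Proof. by move=> -> /eqP; rewrite addr_eq0 => /eqP -> -> -> ->; rewrite subr0. Qed.

(** * The component of the second fundamental form along xi *)

Section NormalXi.
Context {R : realType} {n m : nat}.
Variables (Gam1 : 'rV[R]_n -> 'I_n -> 'I_n -> 'rV[R]_n) (G1 : 'rV[R]_n -> 'M[R]_n).
Variables (Gam2 : 'rV[R]_m -> 'I_m -> 'I_m -> 'rV[R]_m) (G2 : 'rV[R]_m -> 'M[R]_m).
Variables (f : 'rV[R]_n -> 'rV[R]_m) (K : 'rV[R]_n -> 'M[R]_n) (x : 'rV[R]_n).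
Variable xi : 'rV[R]_m -> 'rV[R]_m.

(** The right side is the pulled back metric on arbitrary vectors; it becomes g1 once [a] and [b]
    are horizontal. *)
Lemma second_form_xi a b : riem_map_at Gam1 G1 Gam2 G2 f K x -> differentiable xi (f x) ->
  (forall u, nab Gam2 u xi (f x) = u - inner (G2 (f x)) u (xi (f x)) *: xi (f x)) ->
  (\forall y \near x, forall u, inner (G2 (f y)) ('D_u f y) (xi (f y)) = 0) ->
  inner (G2 (f x)) (second_form Gam1 Gam2 f x a b) (xi (f x)) =
  - inner (G2 (f x)) ('D_a f x) ('D_b f x).
Proof.
move=> H dxi nxi ort; have [s2 c2 t2] := nbhs_singleton (rm_near2 H).
have f2 := nbhs_singleton (rm_f H); have dfx := twice_diffW f2.
have dDf := twice_diffW (rm_Df H b).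
have dxf : differentiable (fun y => xi (f y)) x by exact: (differentiable_comp dfx dxi).
have E := derive_inner_cov a (twice_diffW (rm_G2 H)) c2 dfx dDf dxf.
have E0 : 'D_a (fun y => inner (G2 (f y)) ('D_b f y) (xi (f y))) x = 0.
  rewrite -(derive_cst (0 : R) x a); apply: near_eq_derive.
  by apply: filterS ort => y ->.
have C : cov Gam2 f a (fun y => xi (f y)) x = 'D_a f x.
  have N := nxi ('D_a f x); rewrite (nbhs_singleton ort a) scale0r subr0 in N.
  by rewrite -[RHS]N /cov (@derive_comp _ _ _ _ f xi).
have O := nbhs_singleton ort (bil (Gam1 x) a b).
have S := inner_sym ('D_b f x) ('D_a f x) t2.
have B := innerBl (G2 (f x)) (cov Gam2 f a ('D_b f) x) ('D_(bil (Gam1 x) a b) f x) (xi (f x)).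
rewrite C in E.
exact: (xi_arith E E0 O S B).
Qed.

End NormalXi.

(** * Slant distributions in orthonormal frames *)

Section Frames.
Context {R : realType} {m : nat}.
Variable G : 'M[R]_m.
Hypothesis Gs : G^T = G.
Hypothesis Gpos : forall u, u != 0 -> 0 < inner G u u.
Implicit Types (u w : 'rV[R]_m).

Lemma mx_inner (M : 'M[R]_m) k l (f : 'M[R]_(k, m)) (h : 'M[R]_(l, m)) a b :
  (f *m M *m h^T) a b = inner M (row a f) (row b h).
Proof.
rewrite /inner -row_mul [LHS]mxE [RHS]mxE; apply: eq_bigr => c _.
by rewrite [in RHS]mxE; congr (_ * _); rewrite !mxE.
Qed.

Lemma inner_ge0 u : 0 <= inner G u u.
Proof. by have [->|/Gpos/ltW//] := eqVneq u 0; rewrite inner0l. Qed.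

Lemma onbasis_coord l k (A : 'M[R]_(l, m)) (e : 'M[R]_(k, m)) p (w : 'M[R]_(p, m)) :
  onbasis G A e -> (w <= A)%MS -> w = w *m G *m e^T *m e.
Proof.
move=> [ee /andP[_ Ae]] wA; have /submxP[D ->] := submx_trans wA Ae.
by rewrite -(mulmxA D e G) -(mulmxA D (e *m G)) ee mulmx1.
Qed.

Lemma onbasis_rank l k (A : 'M[R]_(l, m)) (e : 'M[R]_(k, m)) : onbasis G A e -> \rank A = k.
Proof.
move=> [ee eA]; rewrite -(eqmx_rank eA); apply/eqP.
by apply/row_freeP; exists (G *m e^T); rewrite mulmxA.
Qed.

Lemma parseval l k (A : 'M[R]_(l, m)) (e : 'M[R]_(k, m)) u w :
  onbasis G A e -> (u <= A)%MS -> (w <= A)%MS ->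
  inner G u w = \sum_a inner G u (row a e) * inner G w (row a e).
Proof.
move=> he uA wA; have wE := onbasis_coord he wA.
have -> : inner G u w = ((u *m G *m e^T) *m (w *m G *m e^T)^T) 0 0.
  by rewrite {1}wE /inner trmx_mul !mulmxA.
rewrite mxE; apply: eq_bigr => a _; rewrite [_^T a 0]mxE !mx_inner.
by rewrite !row_id.
Qed.

Variables (P : 'M[R]_m) (xi : 'rV[R]_m) (r : nat) (fe : 'M[R]_(r, m)).
Hypothesis ff : fe *m G *m fe^T = 1%:M.
Hypothesis normP : forall W, (W <= fe)%MS -> inner G (W *m P) (W *m P) = inner G W W.

Local Notation Sp := (fe *m P *m G *m fe^T).

(** [Sp] is the matrix of the tangential part of psi in the frame [fe]. If W is the a-th vector of
    an orthonormal frame of [E], row a of the compressed matrix lists the coordinates of the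
    projection of psi W onto [E], and psi W has length 1. *)
Lemma slant_frame (E : 'M[R]_m) theta : (E <= fe)%MS ->
  (forall W : 'rV[R]_m, (W <= E)%MS -> W != 0 -> angle_subspace G (W *m P) E theta) ->
  exists B : 'M[R]_(\rank E, r), [/\ B *m B^T = 1%:M, (B *m fe == E)%MS &
    forall a, \sum_b (B *m Sp *m B^T) a b ^+ 2 = cos theta ^+ 2].
Proof.
move=> Efe slE; have hf : onbasis G fe fe by split=> //; rewrite submx_refl.
have bE := eq_row_base E; set E' := row_base E in bE.
have E'fe : (E' <= fe)%MS by rewrite bE.
have E'E := onbasis_coord hf E'fe; set C := E' *m G *m fe^T in E'E.
have fC : row_free C.
  rewrite /row_free eqn_leq rank_leq_row /=.
  have := mxrankM_maxl C fe; rewrite -E'E => /(leq_trans _); apply.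
  by rewrite bE.
have [B [BB BC]] := gram_schmidt fC.
have BfE : (B *m fe == E)%MS.
  move/andP: BC => [BC CB].
  have le1 : (B *m fe <= E')%MS by rewrite [X in (_ <= X)%MS]E'E submxMr.
  have le2 : (E' <= B *m fe)%MS by rewrite [X in (X <= _)%MS]E'E submxMr.
  by rewrite bE in le1; rewrite bE in le2; rewrite le1.
exists B; split=> // a; pose b := B *m fe.
have bb : b *m G *m b^T = 1%:M.
  by rewrite /b trmx_mul !mulmxA -(mulmxA B fe G) -(mulmxA B (fe *m G)) ff mulmx1.
have hb : onbasis G E b by [].
have bSb : B *m Sp *m B^T = b *m P *m G *m b^T by rewrite /b trmx_mul !mulmxA.
pose W := row a b.
have WE : (W <= E)%MS by rewrite (submx_trans (row_sub a b)) //; case/andP: BfE.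
have WW : inner G W W = 1 by rewrite -mx_inner bb mxE eqxx.
have W0 : W != 0.
  by apply/eqP => W0; have := WW; rewrite W0 inner0l => /eqP; rewrite eq_sym oner_eq0.
have Wfe : (W <= fe)%MS by exact: submx_trans WE Efe.
have [w [wE ort ->]] := slE W WE W0.
have nP : inner G (W *m P) (W *m P) = 1 by rewrite normP.
have sumE : \sum_c (B *m Sp *m B^T) a c ^+ 2 = inner G w w.
  rewrite (parseval hb wE wE) bSb; apply: eq_bigr => c _.
  have bcE : (row c b <= E)%MS by rewrite (submx_trans (row_sub c b)) //; case/andP: BfE.
  rewrite mx_inner row_mul -/W expr2.
  by have /eqP := ort _ bcE; rewrite innerBl subr_eq0 => /eqP ->.
have w1 : inner G w w <= 1.
  have := inner_ge0 (W *m P - w); rewrite -nP innerBl !innerBr (inner_sym w (W *m P) Gs).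
  have := ort _ wE; rewrite innerBl => /eqP; rewrite subr_eq0 => /eqP ->.
  by rewrite subrr subr0 subr_ge0.
have n1 : normv G (W *m P) = 1 by rewrite /normv nP sqrtr1.
have nw : 0 <= normv G w <= 1.
  by rewrite sqrtr_ge0 -[X in _ <= X]sqrtr1 ler_wsqrtr.
(* [acosK] asks for an argument in [-1, 1]: a projection is no longer than psi W. *)
rewrite n1 divr1 acosK; last first.
  by rewrite in_itv /=; move/andP: nw => [w0 ->]; rewrite (le_trans _ w0).
by rewrite sumE sqr_sqrtr // inner_ge0.
Qed.

(** In a frame adapted to [E1] and [E2], the conditions psi E1 orthogonal to E2 and conversely make
    psi block diagonal, and each row of the i-th block contributes cos^2 theta_i. *)
Lemma slant_sum (E1 E2 : 'M[R]_m) theta1 theta2 :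
  (fe == E1 + E2)%MS -> mxdirect (E1 + E2) ->
  orthogonal_sub G E1 E2 -> orthogonal_sub G (E1 *m P) E2 -> orthogonal_sub G (E2 *m P) E1 ->
  (forall W : 'rV[R]_m, (W <= E1)%MS -> W != 0 -> angle_subspace G (W *m P) E1 theta1) ->
  (forall W : 'rV[R]_m, (W <= E2)%MS -> W != 0 -> angle_subspace G (W *m P) E2 theta2) ->
  frob Sp = (\rank E1)%:R * cos theta1 ^+ 2 + (\rank E2)%:R * cos theta2 ^+ 2.
Proof.
move=> fE dE o12 p12 p21 s1 s2; have /andP[_ Ef] := fE.
move: Ef; rewrite addsmx_sub => /andP[E1f E2f].
have [B1 [BB1 BE1 S1]] := slant_frame E1f s1.
have [B2 [BB2 BE2 S2]] := slant_frame E2f s2.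
have subE d (B : 'M[R]_(d, r)) (E : 'M[R]_m) a : (B *m fe == E)%MS -> (row a (B *m fe) <= E)%MS.
  by move=> /andP[BE _]; exact: submx_trans (row_sub a _) BE.
apply: (frob_slant _ BB1 BB2 _ _ _ S1 S2).
- move: dE; rewrite mxdirectE /= => /eqP <-.
  have rfe : \rank fe = r by apply/eqP/row_freeP; exists (G *m fe^T); rewrite mulmxA.
  by rewrite -[RHS]rfe; apply/esym/eqmx_rank.
- apply/matrixP => a b; rewrite [RHS]mxE.
  have <- : (B1 *m fe *m G *m (B2 *m fe)^T) = B1 *m B2^T.
    by rewrite trmx_mul !mulmxA -(mulmxA B1 fe G) -(mulmxA B1 (fe *m G)) ff mulmx1.
  by rewrite mx_inner o12 ?subE.
- apply/matrixP => a b; rewrite [RHS]mxE.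
  have -> : B1 *m Sp *m B2^T = (B1 *m fe *m P) *m G *m (B2 *m fe)^T by rewrite trmx_mul !mulmxA.
  rewrite mx_inner row_mul; apply: p12; last exact: subE.
  by apply: submxMr; exact: subE.
- apply/matrixP => a b; rewrite [RHS]mxE.
  have -> : B2 *m Sp *m B1^T = (B2 *m fe *m P) *m G *m (B1 *m fe)^T by rewrite trmx_mul !mulmxA.
  rewrite mx_inner row_mul; apply: p21; last exact: subE.
  by apply: submxMr; exact: subE.
Qed.

End Frames.

Section SecondForm.
Context {R : realType} {n m : nat}.
Variables (Gam1 : 'rV[R]_n -> 'I_n -> 'I_n -> 'rV[R]_n) (G1 : 'rV[R]_n -> 'M[R]_n).
Variables (Gam2 : 'rV[R]_m -> 'I_m -> 'I_m -> 'rV[R]_m) (G2 : 'rV[R]_m -> 'M[R]_m).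
Variables (f : 'rV[R]_n -> 'rV[R]_m) (K : 'rV[R]_n -> 'M[R]_n) (x : 'rV[R]_n).
Hypothesis H : riem_map_at Gam1 G1 Gam2 G2 f K x.
Local Notation B := (second_form Gam1 Gam2 f x).

Lemma second_form_sym a b : B a b = B b a.
Proof.
have [s1 _ _] := nbhs_singleton (rm_near1 H); have [s2 _ _] := nbhs_singleton (rm_near2 H).
have f2 := nbhs_singleton (rm_f H).
by rewrite /second_form (cov_torsion_free a b s2 f2) (s1 a b).
Qed.

Lemma second_formD a a' b : B (a + a') b = B a b + B a' b.
Proof.
have dfx := twice_diffW (nbhs_singleton (rm_f H)); have dDf := twice_diffW (rm_Df H b).
have E1 := deriveDr a a' dDf; have E2 := deriveDr a a' dfx.
have E3 := bilDl (Gam2 (f x)) ('D_a f x) ('D_a' f x) ('D_b f x).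
have E4 := bilDl (Gam1 x) a a' b.
have E5 := deriveDr (bil (Gam1 x) a b) (bil (Gam1 x) a' b) dfx.
rewrite /second_form /cov E2 E1 E3 E4 E5.
move: ('D_a ('D_b f) x) ('D_a' ('D_b f) x) ('D_(bil _ _ _) f x) ('D_(bil _ _ _) f x).
move: (bil (Gam2 (f x)) ('D_a f x) ('D_b f x)) (bil (Gam2 (f x)) ('D_a' f x) ('D_b f x)).
by move=> p1 p2 p3 p4 p5 p6; apply/rowP => i; rewrite !mxE; ring.
Qed.

Lemma second_formZ k a b : B (k *: a) b = k *: B a b.
Proof.
have dfx := twice_diffW (nbhs_singleton (rm_f H)); have dDf := twice_diffW (rm_Df H b).
have E1 := deriveZr k a dDf; have E2 := deriveZr k a dfx.
have E3 := bilZl (Gam2 (f x)) k ('D_a f x) ('D_b f x).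
have E4 := bilZl (Gam1 x) k a b.
have E5 := deriveZr k (bil (Gam1 x) a b) dfx.
rewrite /second_form /cov E2 E1 E3 E4 E5.
by rewrite scalerBr scalerDr.
Qed.

End SecondForm.

Section FinalSums.
Context {R : realType}.

Lemma bilinear_mx n (b : 'rV[R]_n -> 'rV[R]_n -> R) :
  (forall u u' w, b (u + u') w = b u w + b u' w) -> (forall k u w, b (k *: u) w = k * b u w) ->
  (forall u w, b u w = b w u) -> exists M : 'M[R]_n, forall u w, b u w = inner M u w.
Proof.
move=> bD bZ bs; exists (\matrix_(i, j) b (delta_mx 0 i) (delta_mx 0 j)) => u w.
have b0 v : b 0 v = 0 by rewrite -(scale0r (0 : 'rV[R]_n)) bZ mul0r.
have sumE (c : 'I_n -> R) v : b (\sum_i c i *: delta_mx 0 i) v = \sum_i c i * b (delta_mx 0 i) v.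
  elim/big_rec2: _ => [|i y z _ <-]; first exact: b0.
  by rewrite bD bZ.
rewrite inner_sumE [u in LHS]row_sum_delta sumE; apply: eq_bigr => i _.
rewrite bs [w in LHS]row_sum_delta sumE mulr_sumr; apply: eq_bigr => j _.
by rewrite bs mxE mulrA.
Qed.

Lemma sum_lt_sym r (T : 'I_r -> 'I_r -> R) : (forall a b, T a b = T b a) ->
  (forall a, T a a = 0) -> \sum_a \sum_b T a b = 2 * \sum_(a < r) \sum_(b < r | (a < b)%N) T a b.
Proof.
move=> Ts T0; have -> : \sum_a \sum_b T a b =
    \sum_(a < r) \sum_(b < r | (a < b)%N) T a b + \sum_(a < r) \sum_(b < r | (b < a)%N) T a b.
  rewrite -big_split; apply: eq_bigr => a _ /=.
  rewrite (bigID (fun b : 'I_r => (a < b)%N)) /=; congr (_ + _).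
  rewrite (bigD1 a) /= ?ltnn // T0 add0r; apply: eq_bigl => b.
  by rewrite -leqNgt ltn_neqAle andbC.
have -> : \sum_(a < r) \sum_(b < r | (b < a)%N) T a b = \sum_(a < r) \sum_(b < r | (a < b)%N) T a b.
  rewrite (exchange_big_dep xpredT) //=; apply: eq_bigr => a _.
  by apply: eq_bigr => b _; rewrite Ts.
by ring.
Qed.

(** In the application the dimension is a variable [r], equal to k + 1 only through a proof; this
    form avoids casts of matrices. *)
Lemma casorati_bounds_eq k r q (Z : 'I_q -> 'M[R]_r) (c : 'I_q -> R) (A : 'M[R]_(k, r)) :
  r = (k + 1)%N -> \sum_al c al ^+ 2 <= 1 -> \sum_al c al *: Z al = - 1%:M -> A *m A^T = 1%:M ->
  \sum_al (\tr (Z al)) ^+ 2 + 2^-1 * (r%:R - 1) <=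
    (r%:R + 1) / 2 * \sum_al frob (Z al) + (r%:R + 1) / 2 * \sum_al frob (A *m Z al *m A^T) /\
  \sum_al (\tr (Z al)) ^+ 2 + 2^-1 * (r%:R - 1) <=
    (2 * r%:R - 1) * \sum_al frob (Z al) - (2 * r%:R - 1) / 2 * \sum_al frob (A *m Z al *m A^T).
Proof.
move=> rk; subst r => cc cZ AA; have [b1 b2] := casorati_bounds cc cZ AA.
rewrite natrD (_ : k%:R + 1%:R + 1 = k%:R + 2 :> R) ?addrK; last by ring.
by rewrite (_ : 2 * (k%:R + 1%:R) - 1 = 2 * k%:R + 1 :> R); last by ring.
Qed.

End FinalSums.

Section PointwiseFrames.
Context {R : realType} {n m r q : nat}.
Variables (G1 Hs : 'M[R]_n) (G2 Ns : 'M[R]_m) (e : 'M[R]_(r, n)) (v : 'M[R]_(q, m)).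
Variables (B : 'rV[R]_n -> 'rV[R]_n -> 'rV[R]_m) (xi : 'rV[R]_m).
Hypotheses (G2s : G2^T = G2) (he : onbasis G1 Hs e) (hv : onbasis G2 Ns v).
Hypotheses (BD : forall a a' b, B (a + a') b = B a b + B a' b)
  (BZ : forall k a b, B (k *: a) b = k *: B a b) (Bs : forall a b, B a b = B b a).
Hypothesis BN : forall a b, (a <= Hs)%MS -> (b <= Hs)%MS -> (B a b <= Ns)%MS.
Hypotheses (xiN : (xi <= Ns)%MS) (xi1 : inner G2 xi xi = 1).
Hypothesis Bxi : forall a b, (a <= Hs)%MS -> (b <= Hs)%MS -> inner G2 (B a b) xi = - inner G1 a b.

Definition frame_zeta s (f : 'M[R]_(s, n)) al a b := inner G2 (B (row a f) (row b f)) (row al v).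

Lemma frame_forms : exists (Z : 'I_q -> 'M[R]_r) (c : 'I_q -> R),
  [/\ \sum_al c al ^+ 2 <= 1, \sum_al c al *: Z al = - 1%:M &
      forall s (f : 'M[R]_(s, n)) al a b, (f <= Hs)%MS ->
        frame_zeta f al a b = (f *m G1 *m e^T *m Z al *m (f *m G1 *m e^T)^T) a b].
Proof.
have Mex al : exists M : 'M[R]_n, forall u w, inner G2 (B u w) (row al v) = inner M u w.
  apply: bilinear_mx => [u u' w|k u w|u w].
  - by rewrite BD innerDl.
  - by rewrite BZ innerZl.
  - by rewrite Bs.
pose M al := sval (cid (Mex al)).
have ME al u w : inner G2 (B u w) (row al v) = inner (M al) u w by exact: svalP (cid (Mex al)) u w.
have rowH a : (row a e <= Hs)%MS.
  by case: he => _ /andP[eH _]; exact: submx_trans (row_sub a e) eH.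
have [ee _] := he.
exists (fun al => e *m M al *m e^T), (fun al => inner G2 xi (row al v)); split.
- have := parseval hv xiN xiN; rewrite xi1 => ->.
  by apply: ler_sum => al _; rewrite expr2.
- apply/matrixP => a b; rewrite summxE.
  transitivity (inner G2 (B (row a e) (row b e)) xi); last first.
    by rewrite Bxi // -mx_inner ee [RHS]mxE.
  rewrite (parseval hv (BN (rowH a) (rowH b)) xiN); apply: eq_bigr => al _.
  by rewrite [LHS]mxE mulrC mx_inner ME.
- move=> s f al a b fH; rewrite /frame_zeta ME -mx_inner.
  have fE := onbasis_coord he fH; rewrite [in LHS]fE.
  by rewrite trmx_mul !mulmxA.
Qed.

Lemma gauss_trace (Z : 'I_q -> 'M[R]_r) :
  (forall al a b, frame_zeta e al a b = Z al a b) ->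
  \sum_a \sum_b (inner G2 (B (row a e) (row a e)) (B (row b e) (row b e)) -
    inner G2 (B (row a e) (row b e)) (B (row a e) (row b e))) =
  \sum_al (\tr (Z al)) ^+ 2 - \sum_al frob (Z al).
Proof.
move=> ZE; have rowH a : (row a e <= Hs)%MS.
  by case: he => _ /andP[eH _]; exact: submx_trans (row_sub a e) eH.
have P a b a' b' : inner G2 (B (row a e) (row b e)) (B (row a' e) (row b' e)) =
    \sum_al Z al a b * Z al a' b'.
  by rewrite (parseval hv) ?BN //; apply: eq_bigr => al _; rewrite -!ZE.
under eq_bigr do under eq_bigr do rewrite !P -sumrB.
under eq_bigr do rewrite exchange_big; rewrite exchange_big -sumrB; apply: eq_bigr => al _ /=.
rewrite expr2 mulr_suml /frob -sumrB; apply: eq_bigr => a _.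
by rewrite mulr_sumr -sumrB; apply: eq_bigr => b _; rewrite expr2.
Qed.

End PointwiseFrames.

Lemma sectional_arith (R : realType) (k l s X Y : R) (b : bool) :
  k * (true%:R * true%:R - b%:R ^+ 2) + l * s + X - Y <= k * (1 - b%:R) + l * s + (X - Y).
Proof. by case: b; rewrite ?expr1n ?expr0n /=; lra. Qed.

Lemma mulr_pred_gt0 (R : realType) (r : R) : 3 <= r -> 0 < r * (r - 1).
Proof. by move=> r3; rewrite mulr_gt0 //; lra. Qed.

Lemma normalized_bound_arith (R : realType) (c r1 r2 c1 c2 r T : R) : 3 <= r ->
  (c - 3) / 4 * (r * (r - 1)) + 3 * (c + 1) / 4 * (r1 * 2 * c1 + r2 * 2 * c2) + T <=
  ((c - 3) / 4 + 3 * (c + 1) / (2 * r * (r - 1)) * (r1 * c1 + r2 * c2) + T / (r * (r - 1)))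
    * (r * (r - 1)).
Proof.
move=> r3; have r1' : r - 1 != 0 by apply: lt0r_neq0; lra.
have r0 : r != 0 by apply: lt0r_neq0; lra.
by rewrite le_eqVlt; apply/orP; left; apply/eqP; field; rewrite r1' r0.
Qed.

(** * The estimates at a point of the manifold *)

Section ChartPoint.
Context {R : realType} {n m : nat}.
Variables (M1 : @manifold R n) (g1 : riem_metric M1) (D1 : connection M1)
  (M2 : @manifold R m) (g2 : riem_metric M2) (S : almost_contact_metric g2)
  (D2 : connection M2) (c : R) (F : M1 -> M2) (r r1 r2 : nat)
  (E1 : map_distribution F r1.*2) (E2 : map_distribution F r2.*2) (theta1 theta2 : R).
Hypotheses (hD1 : levi_civita g1 D1) (hM2 : kenmotsu_space_form S D2 c)
  (hF : bi_slant g1 S r E1 E2 theta1 theta2) (hxi : xi_normal S F) (hr3 : (3 <= r)%N).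
Variables (p : M1) (i : chart_index M1) (j : chart_index M2).
Hypothesis hij : charts_at F p i j.

Local Notation x := (x_ p i).
Local Notation f := (rep F i j).
Local Notation G1 := (g1 i x).
Local Notation G2 := (g2 j (f x)).
Local Notation B := (second_form (gam D1 i) (gam D2 j) f x).
Local Notation Hs := (horizontal_space g1 F p i j).
Local Notation Ns := (range_ortho g2 F p i j).
Local Notation ks := (defect F i j g1 g2).

Lemma sffE u w : sff D1 D2 F p i j u w = B u w.
Proof. by rewrite /sff /sff_field /nablaF /nabla /cst derive_cst add0r. Qed.

Let fx : y_ F p j = f x. Proof. by rewrite (rep_x hij). Qed.
Let ix : img i x. Proof. by have [] := rep_dom_img (charts_rep_dom hij). Qed.
Let jx : img j (f x). Proof. by have [] := rep_dom_img (charts_rep_dom hij). Qed.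

Let H : riem_map_at (gam D1 i) (g1 i) (gam D2 j) (g2 j) f ks x.
Proof. by have [[LC2 _] _] := hM2; exact: riem_map_at_chart hD1 LC2 (bi_riemannian hF) hij. Qed.

Let KA : kenmotsu_at (gam D2 j) (g2 j) (psi S j) (xi S j) (f x) c.
Proof. exact: kenmotsu_at_img. Qed.

Let df : differentiable f x.
Proof. exact: twice_diffW (nbhs_singleton (rm_f H)). Qed.

Let iso (u w : 'rV[R]_n) : (u <= Hs)%MS -> (w <= Hs)%MS ->
  inner G2 ('D_u f x) ('D_w f x) = inner G1 u w.
Proof.
move=> hu hw; have [_ _ _ /(_ p i j u w hij hu hw)] := bi_riemannian hF.
by rewrite /dF fx !deriveEjacobian.
Qed.

Let hor (u : 'rV[R]_n) : (u <= Hs)%MS -> u *m ks x = 0.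
Proof.
move=> hu; apply: hor_defect => //; first by move=> ?; exact: gmat_pos.
by move=> a b ha hb; rewrite -!deriveEjacobian //; exact: iso.
Qed.

Lemma second_form_le (u w : 'rV[R]_n) : (u <= Hs)%MS -> (w <= Hs)%MS -> (B u w <= Ns)%MS.
Proof.
move=> /hor hu /hor hw; rewrite /range_ortho /ocompl; apply/sub_kermxP.
apply/rowP => k; rewrite [RHS]mxE.
have := second_form_normal H (delta_mx 0 k) hu hw.
rewrite deriveEjacobian // -rowE fx => <-.
by rewrite -[X in inner _ X _](row_id 0) -mx_inner mulmxA /dF.
Qed.

Lemma xi_le : (xi S j (f x) <= Ns)%MS.
Proof. by rewrite -fx; exact: hxi. Qed.

Lemma xi_unit : inner G2 (xi S j (f x)) (xi S j (f x)) = 1.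
Proof. by rewrite -(eta_metric S _ jx) (eta_xi S jx). Qed.

Lemma second_form_xi_hor (u w : 'rV[R]_n) : (u <= Hs)%MS -> (w <= Hs)%MS ->
  inner G2 (B u w) (xi S j (f x)) = - inner G1 u w.
Proof.
move=> hu hw; have [[cF _] _ _ _] := bi_riemannian hF.
rewrite -(iso hu hw); apply: second_form_xi H _ _ _.
- exact: twice_diffW (ka_xi KA).
- exact: nbhs_singleton (ka_nab_xi KA).
have nd : \forall y \near x, rep_dom F i j y.
  by apply: open_nbhs_nbhs; split; [exact: rep_dom_open | exact: charts_rep_dom].
apply: filterS2 nd (rm_f H) => y dy fy u'.
have [ch xE yE] := charts_of_rep_dom dy; have [_ jy] := rep_dom_img dy.
have := hxi ch; rewrite /range_ortho /dF yE xE => hx.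
rewrite (inner_sym _ _ (gmat_sym g2 jy)); apply: ocompl_inner hx _.
by rewrite deriveEjacobian ?submxMl //; exact: twice_diffW.
Qed.

Lemma zetaE q (v : 'M[R]_(q, m)) s (e : 'M[R]_(s, n)) al a b :
  zeta g2 D1 D2 F p i j e v al a b = frame_zeta G2 v B e al a b.
Proof. by rewrite /zeta sffE fx. Qed.

Lemma point_forms q (e : 'M[R]_(r, n)) (v : 'M[R]_(q, m)) :
  onbasis G1 Hs e -> onbasis G2 Ns v ->
  exists (Z : 'I_q -> 'M[R]_r) (co : 'I_q -> R),
  [/\ \sum_al co al ^+ 2 <= 1, \sum_al co al *: Z al = - 1%:M &
      forall s (h : 'M[R]_(s, n)) al a b, (h <= Hs)%MS ->
        zeta g2 D1 D2 F p i j h v al a b = (h *m G1 *m e^T *m Z al *m (h *m G1 *m e^T)^T) a b].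
Proof.
move=> he hv.
have [Z [co [c1 c2 c3]]] := frame_forms he hv (second_formD H) (second_formZ H)
  (second_form_sym H) second_form_le xi_le xi_unit second_form_xi_hor.
by exists Z, co; split=> // s h al a b hh; rewrite zetaE c3.
Qed.

(** The first and the last diagonal entries both combine to -1, while the shape makes the first half
    of the last. *)
Lemma equality_shape_absurd q (e : 'M[R]_(r, n)) (v : 'M[R]_(q, m)) :
  onbasis G1 Hs e -> onbasis G2 Ns v -> ~ equality_shape g2 D1 D2 F p i j e v.
Proof.
move=> he hv shape; have [Z [co [_ cZ zE]]] := point_forms he hv.
have [ee /andP[eH _]] := he.
have ZE al a b : zeta g2 D1 D2 F p i j e v al a b = Z al a b.
  by rewrite zE // ee mul1mx trmx1 mulmx1.
have rl : (r.-1 < r)%N by case: (r) hr3.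
have r0 : (0 < r)%N by case: (r) hr3.
have sumE a : \sum_al co al * Z al a a = -1.
  have := congr1 (fun M : 'M[R]_r => M a a) cZ; rewrite summxE !mxE eqxx => <-.
  by apply: eq_bigr => al _; rewrite mxE.
have := sumE (Ordinal r0).
have -> : \sum_al co al * Z al (Ordinal r0) (Ordinal r0) =
    2^-1 * \sum_al co al * Z al (Ordinal rl) (Ordinal rl).
  rewrite mulr_sumr; apply: eq_bigr => al _; rewrite -!ZE.
  have [sh _] := shape al; rewrite (sh (Ordinal r0) (Ordinal rl)) //=; first by ring.
  by case: (r) hr3 => [|[|]].
by rewrite sumE; lra.
Qed.

Local Notation P := (psi S j (f x)).
Local Notation J := (dF F p i j).

(** The Gauss inequality summed over a frame: the space form formula contributes the constant term
    and the slant term, the second form contributes squared traces minus Frobenius norms. *)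
Lemma rho_bound q (e : 'M[R]_(r, n)) (v : 'M[R]_(q, m)) (Z : 'I_q -> 'M[R]_r) :
  onbasis G1 Hs e -> onbasis G2 Ns v ->
  (forall al a b, zeta g2 D1 D2 F p i j e v al a b = Z al a b) ->
  rho g1 D1 p i e <= (c - 3) / 4 + 3 * (c + 1) / (2 * r%:R * (r%:R - 1)) *
             (r1%:R * cos theta1 ^+ 2 + r2%:R * cos theta2 ^+ 2) +
    (\sum_al (\tr (Z al)) ^+ 2 - \sum_al frob (Z al)) / (r%:R * (r%:R - 1)).
Proof.
move=> he hv ZE; have [ee /andP[eH _]] := he.
have rowH a : (row a e <= Hs)%MS by exact: submx_trans (row_sub a e) eH.
have G2s := gmat_sym g2 jx; have G2p := fun u => @gmat_pos _ _ _ g2 j (f x) jx u.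
pose fe := e *m J.
have feE a : row a fe = 'D_(row a e) f x by rewrite /fe row_mul deriveEjacobian.
have ff : fe *m G2 *m fe^T = 1%:M.
  apply/matrixP => a b; rewrite mx_inner !feE iso // -mx_inner ee.
  by [].
have [_ rkJ _] : [/\ True, \rank J = r & True] by have [_ _ /(_ p i j hij)] := bi_riemannian hF.
have rkf : \rank fe = r by apply/eqP/row_freeP; exists (G2 *m fe^T); rewrite mulmxA.
have feJ : (fe == J)%MS.
  have := mxrank_leqif_eq (submxMl e J) => -[_].
  by rewrite -/fe rkf rkJ eqxx.
have [JE dE] := bi_range_normal hF hxi hij.
have feE12 : (fe == E1 j p + E2 j p)%MS.
  move/andP: feJ JE => [a1 a2] /andP[b1 b2]; apply/andP.
  by split; [exact: submx_trans b1 | exact: submx_trans a2].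
have xiP (W : 'rV[R]_m) : (W <= fe)%MS -> inner G2 W (xi S j (f x)) = 0.
  move=> Wf; rewrite (inner_sym _ _ G2s).
  apply: (@ocompl_inner _ _ _ G2 J); first by rewrite -fx; exact: hxi.
  by case/andP: feJ => fJ _; exact: submx_trans Wf fJ.
have normP (W : 'rV[R]_m) : (W <= fe)%MS -> inner G2 (W *m P) (W *m P) = inner G2 W W.
  by move=> Wf; rewrite (psi_metric S _ _ jx) (eta_metric S W jx) xiP // mulr0 subr0.
have cj : cdom (atlas j) (F p) by case: hij.
have o12 := bi_ortho hF cj; have p12 := bi_psi1 hF cj; have p21 := bi_psi2 hF cj.
have s1 (W : 'rV[R]_m) := bi_slant1 hF cj (W := W).
have s2 (W : 'rV[R]_m) := bi_slant2 hF cj (W := W).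
rewrite fx in o12 p12 p21 s1 s2.
have FS := slant_sum G2s G2p ff normP feE12 dE o12 p12 p21 s1 s2.
rewrite (dist_rank E1 cj) (dist_rank E2 cj) in FS.
set Sp := fe *m P *m G2 *m fe^T in FS.
have SpE a b : Sp a b = inner G2 (row a fe *m P) (row b fe).
  by rewrite /Sp mx_inner row_mul.
have Sps a b : Sp a b = - Sp b a.
  by rewrite !SpE (psi_skew S _ _ jx) (inner_sym _ _ G2s).
pose d a b := inner G2 (row a fe) (row b fe).
have dE' a b : d a b = (a == b)%:R by rewrite /d -mx_inner ff mxE.
(* For a != b this is the sectional curvature of M2 on the images of two frame vectors; the factor
   with a == b makes the diagonal vanish, so the full double sum is twice the sum over a < b. *)
pose R2 a b := (c - 3) / 4 * (1 - (a == b)%:R) + 3 * (c + 1) / 4 * Sp a b ^+ 2.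
pose Q a b := inner G2 (B (row a e) (row a e)) (B (row b e) (row b e)) -
    inner G2 (B (row a e) (row b e)) (B (row a e) (row b e)).
have HC := kenmotsu_holomorphic_curvature KA.
have R1 a b : inner G1 (curv D1 i x (row a e) (row b e) (row b e)) (row a e) <= R2 a b + Q a b.
  have := gauss_inequality H (hor (rowH a)) (hor (rowH b)).
  have rfe l : (row l fe <= fe)%MS by exact: row_sub.
  have := sectional_curvature HC (xiP _ (rfe a)) (xiP _ (rfe b)).
  rewrite -!feE curvE => -> /le_trans; apply.
  rewrite -/(d a a) -/(d b b) -/(d a b) -SpE !dE' !eqxx /R2 /Q.
  exact: sectional_arith.
have R2s a b : R2 a b = R2 b a by rewrite /R2 (Sps a b) sqrrN eq_sym.
have Qsym a b : Q a b = Q b a := congr2 (fun s t : R => s - t)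
  (inner_sym (B (row a e) (row a e)) (B (row b e) (row b e)) G2s)
  (congr1 (fun w => inner G2 w w) (second_form_sym H (row a e) (row b e))).
have Qs a b : R2 a b + Q a b = R2 b a + Q b a := congr2 (fun s t : R => s + t) (R2s a b) (Qsym a b).
have Qaa a : Q a a = 0 by exact: subrr.
have Q0 a : R2 a a + Q a a = 0.
  rewrite Qaa /R2 eqxx subrr mulr0 add0r addr0.
  have -> : Sp a a = 0 by have := Sps a a; lra.
  by rewrite expr0n mulr0.
have sumR2 : \sum_a \sum_b R2 a b =
    (c - 3) / 4 * (r%:R * (r%:R - 1)) + 3 * (c + 1) / 4 * frob Sp.
  have inn (a : 'I_r) : \sum_(b < r) (1 - (a == b)%:R) = r%:R - 1 :> R.
    rewrite sumrB sum_const mulr1 (bigD1 a) //= eqxx big1 ?addr0 // => b ba.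
    by rewrite eq_sym (negbTE ba).
  under eq_bigr do rewrite big_split /= -!mulr_sumr inn.
  by rewrite big_split /= sum_const -!mulr_sumr; congr (_ + _); ring.
have r3 : (3 : R) <= r%:R by rewrite ler_nat.
have rr0 : (0 : R) < r%:R * (r%:R - 1) by exact: mulr_pred_gt0.
rewrite /rho.
have le1 : 2 * \sum_(a < r) \sum_(b < r | (a < b)%N)
    inner G1 (curv D1 i x (row a e) (row b e) (row b e)) (row a e) <=
    \sum_a \sum_b (R2 a b + Q a b).
  rewrite (sum_lt_sym Qs Q0) ler_pM2l //; apply: ler_sum => a _; apply: ler_sum => b _.
  exact: R1.
have sumQ : \sum_a \sum_b Q a b = \sum_al (\tr (Z al)) ^+ 2 - \sum_al frob (Z al).
  have ZE' al a b : frame_zeta G2 v B e al a b = Z al a b by rewrite -zetaE.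
  exact: (gauss_trace he hv second_form_le ZE').
rewrite mulrAC ler_pdivrMr //; apply: le_trans le1 _.
under eq_bigr do rewrite big_split /=.
rewrite big_split /= sumR2 sumQ FS -!muln2 !natrM.
exact: normalized_bound_arith.
Qed.

(** [A] is the matrix of coordinates in [e] of a frame of the hyperplane; it is orthonormal because
    both frames are. *)
Lemma hyperplane_casoratiE q (v : 'M[R]_(q, m)) (e : 'M[R]_(r, n)) (Z : 'I_q -> 'M[R]_r) :
  onbasis G1 Hs e ->
  (forall s (h : 'M[R]_(s, n)) al a b, (h <= Hs)%MS ->
    zeta g2 D1 D2 F p i j h v al a b = (h *m G1 *m e^T *m Z al *m (h *m G1 *m e^T)^T) a b) ->
  forall C, hyperplane_casorati g1 g2 D1 D2 F p i j v C ->
  exists (k : nat) (A : 'M[R]_(k, r)),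
    [/\ r = (k + 1)%N, A *m A^T = 1%:M & C = (r%:R - 1)^-1 * \sum_al frob (A *m Z al *m A^T)].
Proof.
move=> he zE C [L [h [LH rL [hh /andP[hL _]] ->]]].
have rH := onbasis_rank he; have hH := submx_trans hL LH.
exists (\rank Hs).-1, (h *m G1 *m e^T).
have rk : r = ((\rank Hs).-1 + 1)%N by rewrite rH addn1 prednK //; case: (r) hr3.
split=> //.
  have hE := onbasis_coord he hH.
  rewrite trmx_mul trmxK mulmxA.
  rewrite trmx_mul (gmat_sym g1 ix) -(mulmxA (h *m G1 *m e^T)).
  by rewrite !mulmxA -hE hh.
rewrite /casorati (_ : r%:R - 1 = (\rank Hs).-1%:R); last by rewrite [in LHS]rk natrD addrK.
congr (_ * _); apply: eq_bigr => al _; apply: eq_bigr => a _; apply: eq_bigr => b _.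
by rewrite zE.
Qed.

(** Needed for bounds on [inf] and [sup]. The witness is the span of the first r - 1 vectors of
    [e]. *)
Lemma hyperplane_casorati_neq0 q (v : 'M[R]_(q, m)) (e : 'M[R]_(r, n)) :
  onbasis G1 Hs e -> hyperplane_casorati g1 g2 D1 D2 F p i j v !=set0.
Proof.
move=> he; have rH := onbasis_rank he; have [ee /andP[eH _]] := he.
have kr : ((\rank Hs).-1 <= r)%N by rewrite rH leq_pred.
pose h : 'M[R]_((\rank Hs).-1, n) := rowsub (widen_ord kr) e.
have hE : h = rowsub (widen_ord kr) 1%:M *m e by rewrite mul_rowsub_mx mul1mx.
have hh : h *m G1 *m h^T = 1%:M.
  apply/matrixP => a b; rewrite mx_inner !row_rowsub -mx_inner ee !mxE.
  by rewrite -(inj_eq val_inj).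
have rh : \rank h = (\rank Hs).-1.
  by apply/eqP/row_freeP; exists (G1 *m h^T); rewrite mulmxA.
exists (casorati g2 D1 D2 F p i j h v); exists (<<h>>%MS), h; split=> //.
- by rewrite genmxE hE (submx_trans (submxMl _ _)).
- by rewrite genmxE.
- by split=> //; rewrite !genmxE submx_refl.
Qed.

End ChartPoint.

(** The bound is solved for the Casorati curvature [L] of one hyperplane, so that its left side is a
    lower bound of the whole set. The summand (2 r)^-1 is the gap (r - 1) / 2 divided by r (r - 1);
    it makes the inequality strict after the infimum. *)
Lemma delta_arith (R : realType) (r rho K T C L X : R) : 3 <= r ->
  rho <= K + (T - C) / (r * (r - 1)) ->
  T + 2^-1 * (r - 1) <= (r + 1) / 2 * C + (r + 1) / 2 * X -> L = (r - 1)^-1 * X ->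
  (rho - K - 2^-1 * (r^-1 * C) + (2 * r)^-1) / ((r + 1) / (2 * r)) <= L.
Proof.
move=> r3 h1 h2 ->; have rp : 0 < r by lra.
have r1 : 0 < r - 1 by lra.
rewrite ler_pdivrMr ?divr_gt0 //; [|lra..].
have rr : 0 < r * (r - 1) by exact: mulr_gt0.
rewrite -(ler_pM2r rr).
rewrite -(ler_pM2r rr) mulrDl divfK ?gt_eqF // in h1.
have -> : (rho - K - 2^-1 * (r^-1 * C) + (2 * r)^-1) * (r * (r - 1)) =
    rho * (r * (r - 1)) - K * (r * (r - 1)) - 2^-1 * (r - 1) * C + 2^-1 * (r - 1).
  by field; rewrite gt_eqF.
have -> : (r - 1)^-1 * X * ((r + 1) / (2 * r)) * (r * (r - 1)) = (r + 1) / 2 * X.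
  by field; rewrite !gt_eqF.
have e : (r + 1) / 2 * C - C = 2^-1 * (r - 1) * C by field.
lra.
Qed.

Lemma delta_hat_arith (R : realType) (r rho K T C L X : R) : 3 <= r ->
  rho <= K + (T - C) / (r * (r - 1)) ->
  T + 2^-1 * (r - 1) <= (2 * r - 1) * C - (2 * r - 1) / 2 * X -> L = (r - 1)^-1 * X ->
  L <= (K + 2 * (r^-1 * C) - rho - (2 * r)^-1) / ((2 * r - 1) / (2 * r)).
Proof.
move=> r3 h1 h2 ->; have rp : 0 < r by lra.
have r1 : 0 < r - 1 by lra.
rewrite ler_pdivlMr ?divr_gt0 //; [|lra..].
have rr : 0 < r * (r - 1) by exact: mulr_gt0.
rewrite -(ler_pM2r rr).
rewrite -(ler_pM2r rr) mulrDl divfK ?gt_eqF // in h1.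
have -> : (K + 2 * (r^-1 * C) - rho - (2 * r)^-1) * (r * (r - 1)) =
    K * (r * (r - 1)) + 2 * (r - 1) * C - rho * (r * (r - 1)) - 2^-1 * (r - 1).
  by field; rewrite gt_eqF.
have -> : (r - 1)^-1 * X * ((2 * r - 1) / (2 * r)) * (r * (r - 1)) = (2 * r - 1) / 2 * X.
  by field; rewrite !gt_eqF.
have e : (2 * r - 1) * C - C = 2 * (r - 1) * C by ring.
lra.
Qed.

Lemma delta_lt_arith (R : realType) (r rho K C I : R) : 3 <= r ->
  (rho - K - 2^-1 * (r^-1 * C) + (2 * r)^-1) / ((r + 1) / (2 * r)) <= I ->
  rho < 2^-1 * (r^-1 * C) + (r + 1) / (2 * r) * I + K.
Proof.
move=> r3; have r0 : 0 < 2 * r by lra.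
have i0 : 0 < (2 * r)^-1 by rewrite invr_gt0.
rewrite ler_pdivrMr ?divr_gt0 //; [lra..].
Qed.

Lemma delta_hat_lt_arith (R : realType) (r rho K C I : R) : 3 <= r ->
  I <= (K + 2 * (r^-1 * C) - rho - (2 * r)^-1) / ((2 * r - 1) / (2 * r)) ->
  rho < 2 * (r^-1 * C) - (2 * r - 1) / (2 * r) * I + K.
Proof.
move=> r3; have r0 : 0 < 2 * r by lra.
have i0 : 0 < (2 * r)^-1 by rewrite invr_gt0.
rewrite ler_pdivlMr ?divr_gt0 //; [lra..].
Qed.

Theorem theorem13 (R : realType) (n m : nat)
    (M1 : @manifold R n) (g1 : riem_metric M1) (D1 : connection M1)
    (M2 : @manifold R m) (g2 : riem_metric M2) (S : almost_contact_metric g2)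
    (D2 : connection M2) (c : R)
    (F : M1 -> M2) (r r1 r2 : nat)
    (E1 : map_distribution F r1.*2) (E2 : map_distribution F r2.*2) (theta1 theta2 : R)
    (hD1 : levi_civita g1 D1) (hM2 : kenmotsu_space_form S D2 c)
    (hF : bi_slant g1 S r E1 E2 theta1 theta2)
    (hxi : xi_normal S F)
    (hr3 : (3 <= r)%N) (hrmin : (r < minn n m)%N)
    (p : M1) (i : chart_index M1) (j : chart_index M2) (hij : charts_at F p i j)
    (e : 'M[R]_(r, n)) (v : 'M[R]_(m - r, m))
    (he : onbasis (g1 i (x_ p i)) (horizontal_space g1 F p i j) e)
    (hv : onbasis (g2 j (y_ F p j)) (range_ortho g2 F p i j) v) :
  let K := (c - 3) / 4 + 3 * (c + 1) / (2 * r%:R * (r%:R - 1)) *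
             (r1%:R * cos theta1 ^+ 2 + r2%:R * cos theta2 ^+ 2) in
  let rho_p := rho g1 D1 p i e in
  let delta_p := delta g1 g2 D1 D2 F p i j e v in
  let delta_hat_p := delta_hat g1 g2 D1 D2 F p i j e v in
  let equality_case :=
    exists (e' : 'M[R]_(r, n)) (v' : 'M[R]_(m - r, m)),
      [/\ onbasis (g1 i (x_ p i)) (horizontal_space g1 F p i j) e',
          onbasis (g2 j (y_ F p j)) (range_ortho g2 F p i j) v' &
          equality_shape g2 D1 D2 F p i j e' v'] in
  [/\ rho_p <= delta_p + K,
      rho_p <= delta_hat_p + K,
      rho_p = delta_p + K <-> equality_case &
      rho_p = delta_hat_p + K <-> equality_case].
Proof.
have hv' : onbasis (g2 j (rep F i j (x_ p i))) (range_ortho g2 F p i j) v by rewrite rep_x.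
move=> K rho_p delta_p delta_hat_p equality_case.
have no_eq : ~ equality_case.
  move=> [e' [v' [he' hv'' shape]]].
  rewrite -(rep_x hij) in hv''.
  exact: (equality_shape_absurd hD1 hM2 hF hxi hr3 hij he' hv'' shape).
have [Z [co [cc cZ zE]]] := point_forms hD1 hM2 hF hxi hij he hv'.
have [ee /andP[eH _]] := he.
have ZE al a b : zeta g2 D1 D2 F p i j e v al a b = Z al a b.
  by rewrite zE // ee mul1mx trmx1 mulmx1.
have r3 : (3 : R) <= r%:R by rewrite ler_nat.
have RB := rho_bound hD1 hM2 hF hxi hr3 hij he hv' ZE.
have CE : casorati g2 D1 D2 F p i j e v = r%:R^-1 * \sum_al frob (Z al).
  rewrite /casorati; congr (_ * _); apply: eq_bigr => al _; apply: eq_bigr => a _.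
  by apply: eq_bigr => b _; rewrite ZE.
have ne : hyperplane_casorati g1 g2 D1 D2 F p i j v !=set0.
  exact: hyperplane_casorati_neq0 he.
have hyp := hyperplane_casoratiE hr3 hij he zE.
have lt1 : rho_p < delta_p + K.
  rewrite /delta_p /delta CE; apply: (delta_lt_arith r3); apply: lb_le_inf => // C /hyp.
  move=> [k [A [rk AA CA]]]; have [b1 _] := casorati_bounds_eq rk cc cZ AA.
  exact: (delta_arith r3 RB b1 CA).
have lt2 : rho_p < delta_hat_p + K.
  rewrite /delta_hat_p /delta_hat CE; apply: (delta_hat_lt_arith r3); apply: ge_sup => // C /hyp.
  move=> [k [A [rk AA CA]]]; have [_ b2] := casorati_bounds_eq rk cc cZ AA.
  exact: (delta_hat_arith r3 RB b2 CA).
split; [exact: ltW|exact: ltW| |].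
- by split=> [E|/no_eq//]; rewrite E ltxx in lt1.
- by split=> [E|/no_eq//]; rewrite E ltxx in lt2.
Qed.
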